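(* Let $R\in(0,1)$ and $\delta\in(0,1)$. Let $(\mathcal{C}_j)_{j\ge1}$ be a sequence of binary Reed–Muller codes with lengths $n_j\to\infty$ and rates $R_j\to R$, and let $H_j$ be a parity-check matrix of $\mathcal{C}_j$ (an $n_j(1-R_j)\times n_j$ binary matrix of full row rank with kernel $\mathcal{C}_j$). Let $Z_j$ be a vector of $n_j$ independent Bernoulli$(\delta)$ bits. If $R>1-h_p(\delta)$, then for every $p\in\{2,3,\dots\}\cup\{\infty\}$, $$\lim_{j\to\infty}D_p\big(P_{H_jZ_j}\,\|\,P_{U_{n_j(1-R_j)}}\big)=0.$$ If $R>(1-2\delta)^2$, then $\lim_{j\to\infty}D\big(P_{H_jZ_j}\,\|\,P_{U_{n_j(1-R_j)}}\big)=0$.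
   Context: The binary Reed–Muller code $\mathrm{RM}(r,\mu)$ is the linear code of length $2^\mu$ consisting of the evaluation vectors, over all points of $\mathbb{F}_2^\mu$, of polynomials in $\mu$ variables over $\mathbb{F}_2$ of degree at most $r$; its rate is $2^{-\mu}\sum_{i\le r}\binom{\mu}{i}$. $h_p(\delta)=\frac{1}{1-p}\log_2(\delta^p+(1-\delta)^p)$ for $p\in(1,\infty)$ and $h_\infty(\delta)=-\log_2\max(\delta,1-\delta)$. $P_{U_N}$ is the uniform distribution on $\mathbb{F}_2^N$. Divergences are in base 2: $D_p(P\|Q)=\frac{1}{p-1}\log_2\sum_xP(x)^pQ(x)^{1-p}$, $D_\infty(P\|Q)=\max_x\log_2\frac{P(x)}{Q(x)}$, and $D=D_1$ is the Kullback–Leibler divergence. *)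

(* Defs.v *)
From mathcomp Require Import all_boot all_order all_algebra.
From mathcomp Require Import all_classical all_reals all_analysis.
Set Implicit Arguments. Unset Strict Implicit. Unset Printing Implicit Defensive.
Import Order.TTheory GRing.Theory Num.Theory.
Local Open Scope ring_scope.

Definition log2 {R : realType} (x : R) : R := ln x / ln 2.

(** Points of F_2^mu, indexed by 'I_(2^mu) via binary expansion:
    coordinate k of point i is the k-th binary digit of i. *)
Definition rm_point (mu : nat) (i : 'I_(2 ^ mu)) : 'I_mu -> 'F_2 :=
  fun k => (odd (i %/ 2 ^ k))%:R.

Definition mdeg (mu r : nat) (e : {ffun 'I_mu -> 'I_r.+1}) : nat :=
  (\sum_(k < mu) (e k : nat))%N.

(** Evaluation at x of the polynomial of degree <= r in mu variables over F_2
    with coefficients a (monomials of total degree > r are ignored). *)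
Definition poly_eval (mu r : nat) (a : {ffun {ffun 'I_mu -> 'I_r.+1} -> 'F_2})
    (x : 'I_mu -> 'F_2) : 'F_2 :=
  \sum_(e : {ffun 'I_mu -> 'I_r.+1} | (mdeg e <= r)%N)
     a e * \prod_(k < mu) x k ^+ (e k : nat).

Definition RM (r mu : nat) (c : 'cV['F_2]_(2 ^ mu)) : Prop :=
  exists a : {ffun {ffun 'I_mu -> 'I_r.+1} -> 'F_2},
    c = \col_(i < 2 ^ mu) poly_eval a (rm_point i).

Definition RM_rate {R : realType} (r mu : nat) : R :=
  (\sum_(i < r.+1) 'C(mu, i))%:R / (2 ^ mu)%:R.

Definition h_p {R : realType} (p delta : R) : R :=
  (1 - p)^-1 * log2 (delta `^ p + (1 - delta) `^ p).
Definition h_inf {R : realType} (delta : R) : R :=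
  - log2 (Num.max delta (1 - delta)).

Definition Renyi_div {R : realType} {T : finType} (p : R) (P Q : T -> R) : R :=
  (p - 1)^-1 * log2 (\sum_(x : T) P x `^ p * Q x `^ (1 - p)).
Definition Renyi_inf {R : realType} {T : finType} (x0 : T) (P Q : T -> R) : R :=
  \big[Num.max/log2 (P x0 / Q x0)]_(x : T) log2 (P x / Q x).
Definition KL_div {R : realType} {T : finType} (P Q : T -> R) : R :=
  \sum_(x : T | P x != 0) P x * log2 (P x / Q x).

Definition unif {R : realType} (T : finType) : T -> R := fun (_ : T) => (#|T|%:R)^-1.

Definition PHZ {R : realType} (m n : nat) (delta : R) (H : 'M['F_2]_(m, n))
    (s : 'cV['F_2]_m) : R :=
  \sum_(z : 'cV['F_2]_n | H *m z == s)
     \prod_(i < n) (if z i ord0 == 1 then delta else 1 - delta).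
Arguments RM : clear implicits.
Arguments unif {R} T _.

(* Main.v *)
(** Write P_T for the uniform distribution on the span of the columns H_i, i in T.
    Replacing one at a time the bits Z_i by 0 or by a uniform bit, a two-point inequality
    shows that each divergence of H Z is at most the expectation of that of P_T, namely
    m - rk(H_T), where T contains each column independently with probability q > 1 - R.
    So the theorem reduces to an erasure problem: E[m - rk(H_T)] tends to 0.

    Counting coloops of T gives q h(q) <= 1 - R_j, where h(q) is the probability that H_x is
    not in the span of T \ x; hence h is bounded away from 1.  Affine maps preserve the code
    and act doubly transitively on the points, so a KKL inequality makes h decrease at
    rate c log n, and h = O(n^-c).  The rank is a Lipschitz function of T, so the deficit
    m - rk(H_T) concentrates and is at most K = 2 n^(1-c) up to superpolynomially small
    probability.  Finally a subspace of dimension d <= K of the dual code has support at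
    least (log n)^2 d, so every further random column shrinks the deficit by a large factor,
    and the deficit vanishes. *)
Require Import Defs.
From mathcomp Require Import all_boot all_order all_algebra.
From mathcomp Require Import all_classical all_reals all_analysis.
From mathcomp Require Import ring lra.
From mathcomp Require mxabelem.
Import Order.TTheory GRing.Theory Num.Theory numFieldNormedType.Exports.
Set Implicit Arguments. Unset Strict Implicit. Unset Printing Implicit Defensive.
Local Open Scope ring_scope.

(** * Averaging over random subsets *)

(** For moments and for the maximum, the weight lam of the two-point inequality is calibrated to
    give equality when one of the two points carries all the mass; for entropy it is the
    second-order constant at the uniform pair. The erasure parameter q = 1 - lam is then h_p(delta),
    h_inf(delta) or 1 - (1 - 2 delta)^2, and each hypothesis on R reads q > 1 - R. The obstacle is
    that h = O(n^-c) bounds the mean deficit only by n^(1-c). What removes this is a differential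
    inequality: the columns outside the span of H_T each lower the deficit by one, and they contain
    the support of all dual words vanishing on T, a space whose dimension is the deficit. If these
    columns always number at least A times the deficit, the mean deficit decays like exp(-A (q -
    q1)), and A = mu^2 beats n = 2^mu. Such expansion is available only for small deficits, hence
    the concentration step. The interval between 1 - R and q is therefore cut at q0 < q1: counting
    coloops at q0, decay of h from q0 to q1, decay of the deficit from q1 to q. *)

Section SetSingleton.
Variable X : finType.
Implicit Types (i : X) (T : {set X}).

Lemma setU1_idem i T : i |: (i |: T) = i |: T.
Proof. by apply/setP=> y; rewrite !inE; case: (y == i). Qed.
Lemma setU1_setD1 i T : i |: (T :\ i) = i |: T.
Proof. by apply/setP=> y; rewrite !inE; case: (y == i). Qed.
Lemma setD1_setU1 i T : (i |: T) :\ i = T :\ i.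
Proof. by apply/setP=> y; rewrite !inE; case: (y == i). Qed.
Lemma setD1_idem i T : (T :\ i) :\ i = T :\ i.
Proof. by apply/setP=> y; rewrite !inE; case: (y == i). Qed.
Lemma setD1_id i T : i \notin T -> T :\ i = T.
Proof.
move=> iT; apply/setP=> y; rewrite !inE; case: eqP => // ->.
by rewrite (negbTE iT).
Qed.
Lemma setU1_id i T : i \in T -> i |: T = T.
Proof. by move=> iT; apply/setP=> y; rewrite !inE; case: eqP => // ->; rewrite iT. Qed.

End SetSingleton.

Lemma sum_set_split (V : nmodType) (X : finType) (i : X) (F : {set X} -> V) :
  \sum_A F A = \sum_(A : {set X} | i \notin A) (F A + F (i |: A)).
Proof.
rewrite (bigID (fun A : {set X} => i \notin A)) /= big_split /=; congr (_ + _).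
rewrite (reindex_onto (fun A => i |: A) (fun A => A :\ i)) /=; last first.
  by move=> A /negPn iA; rewrite setU1_setD1 setU1_id.
apply: eq_bigl => A; rewrite !inE eqxx /= setD1_setU1.
by apply/eqP/idP => [<-|/setD1_id//]; rewrite !inE eqxx.
Qed.

Section Averaging.
Variables (R : realType) (X : finType).
Implicit Types (q : R) (i j x : X) (l : seq X) (g h : {set X} -> R) (T A : {set X}).

(** A conditional expectation given all coordinates but [i], kept as a function of the whole set:
    composing and commuting such averages is then purely equational. *)
Definition avg q i g : {set X} -> R :=
  fun T => q * g (i |: T) + (1 - q) * g (T :\ i).

(* The average over the coordinates in l alone, as a function of the others: every
   tensorization argument becomes an induction on l. *)
Definition pexp q l g : {set X} -> R := foldr (avg q) g l.

Definition expect q g : R := pexp q (enum X) g finset.set0.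

Lemma avgC q i j g : avg q i (avg q j g) = avg q j (avg q i g).
Proof.
have [->//|ij] := eqVneq i j.
apply/funext=> T; rewrite /avg.
have -> : j |: (i |: T) = i |: (j |: T).
  by apply/setP=> y; rewrite !inE; case: (y == i); case: (y == j).
have -> : (i |: T) :\ j = i |: (T :\ j).
  apply/setP=> y; rewrite !inE; case: eqP => [->|]; case: eqP => //.
  by move=> e; rewrite e eqxx in ij.
have -> : (j |: T) :\ i = j |: (T :\ i).
  apply/setP=> y; rewrite !inE; case: eqP => [->|]; case: eqP => //.
  by move=> e; rewrite e eqxx in ij.
have -> : (T :\ i) :\ j = (T :\ j) :\ i.
  by apply/setP=> y; rewrite !inE; case: (y == i); case: (y == j).
ring.
Qed.

Lemma avgU q i g T : avg q i g (i |: T) = avg q i g T.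
Proof. by rewrite /avg setU1_idem setD1_setU1. Qed.
Lemma avgD q i g T : avg q i g (T :\ i) = avg q i g T.
Proof. by rewrite /avg setU1_setD1 setD1_idem. Qed.

(** A factor already averaged over [i] is constant in [i], hence comes out of the average. This is
    the orthogonality behind [energy_Pythagoras]. *)
Lemma avg_pull q i g h :
  avg q i (fun T => g T * avg q i h T) = (fun T => avg q i g T * avg q i h T).
Proof.
apply/funext=> T; rewrite {1}/avg avgU avgD {3}/avg; ring.
Qed.

Lemma avg_cst q i c : avg q i (fun=> c) = (fun=> c).
Proof. by apply/funext=> T; rewrite /avg; ring. Qed.

Lemma avg_idem q i g : avg q i (avg q i g) = avg q i g.
Proof. by apply/funext=> T; rewrite {1}/avg avgU avgD; ring. Qed.

Lemma avg_lin q i a b g h :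
  avg q i (fun T => a * g T + b * h T) = (fun T => a * avg q i g T + b * avg q i h T).
Proof. by apply/funext=> T; rewrite /avg; ring. Qed.

Lemma le_avg q i g h T : 0 <= q <= 1 -> (forall T, g T <= h T) ->
  avg q i g T <= avg q i h T.
Proof.
by move=> /andP[q0 q1] gh; rewrite /avg lerD// ler_wpM2l// subr_ge0.
Qed.

Lemma pexp_cons q i l g : pexp q (i :: l) g = avg q i (pexp q l g).
Proof. by []. Qed.

Lemma avg_pexp q i l g : avg q i (pexp q l g) = pexp q l (avg q i g).
Proof. by elim: l => //= j l IH; rewrite avgC IH. Qed.

Lemma pexp_cst q l c : pexp q l (fun=> c) = (fun=> c).
Proof. by elim: l => //= j l ->; rewrite avg_cst. Qed.

Lemma pexp_lin q l a b g h :
  pexp q l (fun T => a * g T + b * h T) =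
  (fun T => a * pexp q l g T + b * pexp q l h T).
Proof. by elim: l => //= j l ->; rewrite avg_lin. Qed.

Lemma pexpD q l g h T :
  pexp q l (fun A => g A + h A) T = pexp q l g T + pexp q l h T.
Proof.
have := pexp_lin q l 1 1 g h; under eq_fun do rewrite !mul1r.
by move=> ->; rewrite !mul1r.
Qed.

Lemma pexpZ q l a g T : pexp q l (fun A => a * g A) T = a * pexp q l g T.
Proof.
have := pexp_lin q l a 0 g g; under eq_fun do rewrite mul0r addr0.
by move=> ->; rewrite mul0r addr0.
Qed.

Lemma pexpB q l g h T :
  pexp q l (fun A => g A - h A) T = pexp q l g T - pexp q l h T.
Proof.
have := pexp_lin q l 1 (-1) g h; under eq_fun do rewrite mul1r mulN1r.
by move=> ->; rewrite mul1r mulN1r.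
Qed.

Lemma pexp_sum q l (I : Type) (r : seq I) (P : pred I) (F : I -> {set X} -> R) T :
  pexp q l (fun A => \sum_(k <- r | P k) F k A) T =
  \sum_(k <- r | P k) pexp q l (F k) T.
Proof.
elim: r => [|k r IH].
  by under eq_fun do rewrite big_nil; rewrite pexp_cst big_nil.
under eq_fun do rewrite big_cons.
by rewrite big_cons; case: (P k) => //; rewrite pexpD IH.
Qed.

Lemma le_pexp q l g h T : 0 <= q <= 1 -> (forall T, g T <= h T) ->
  pexp q l g T <= pexp q l h T.
Proof. by move=> q01 gh; elim: l T => //= i l IH T; exact: le_avg. Qed.

Lemma pexp_ge0 q l g T : 0 <= q <= 1 -> (forall T, 0 <= g T) -> 0 <= pexp q l g T.
Proof.
move=> q01 g0; have := le_pexp l T q01 g0.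
by rewrite pexp_cst.
Qed.

Lemma pexp_cat q l1 l2 g : pexp q (l1 ++ l2) g = pexp q l1 (pexp q l2 g).
Proof. exact: foldr_cat. Qed.

Lemma pexpC q l1 l2 g : pexp q l1 (pexp q l2 g) = pexp q l2 (pexp q l1 g).
Proof. by elim: l1 => //= i l1 ->; rewrite avg_pexp. Qed.

Lemma pexp_perm q l1 l2 g : perm_eq l1 l2 -> pexp q l1 g = pexp q l2 g.
Proof.
apply: (catCA_perm_subst (F := fun l => pexp q l g)) => s1 s2 s3.
by rewrite !pexp_cat pexpC.
Qed.

Lemma pexp_local q l g T T' :
  (forall i, i \notin l -> (i \in T) = (i \in T')) -> pexp q l g T = pexp q l g T'.
Proof.
elim: l T T' => [|j l IH] T T' TT' /=.
  by congr g; apply/setP=> i; exact: TT'.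
rewrite /avg; congr (_ * _ + _ * _); apply: IH => i il; rewrite !inE;
  by case: eqP => //= /eqP ij; rewrite ?andbT ?TT' // inE negb_or ij.
Qed.

Lemma pexp_enum q g T : pexp q (enum X) g T = expect q g.
Proof. by apply: pexp_local => i; rewrite mem_enum. Qed.

Lemma expect_avg q i g : expect q (avg q i g) = expect q g.
Proof.
have e : perm_eq (enum X) (i :: rem i (enum X)).
  by apply: perm_to_rem; rewrite mem_enum.
by rewrite /expect (pexp_perm _ _ e) (pexp_perm _ _ e) /= -avg_pexp avg_idem.
Qed.

Lemma expect_pexp q l g : expect q (pexp q l g) = expect q g.
Proof. by elim: l => //= i l IH; rewrite expect_avg. Qed.

Lemma expect_cst q c : expect q (fun=> c) = c.
Proof. by rewrite /expect pexp_cst. Qed.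
Lemma expectD q g h : expect q (fun T => g T + h T) = expect q g + expect q h.
Proof. by rewrite /expect pexpD. Qed.
Lemma expectB q g h : expect q (fun T => g T - h T) = expect q g - expect q h.
Proof. by rewrite /expect pexpB. Qed.
Lemma expectZ q a g : expect q (fun T => a * g T) = a * expect q g.
Proof. by rewrite /expect pexpZ. Qed.
Lemma expect_sum q (I : Type) (r : seq I) (P : pred I) (F : I -> {set X} -> R) :
  expect q (fun T => \sum_(k <- r | P k) F k T) = \sum_(k <- r | P k) expect q (F k).
Proof. by rewrite /expect pexp_sum. Qed.
Lemma le_expect q g h : 0 <= q <= 1 -> (forall T, g T <= h T) ->
  expect q g <= expect q h.
Proof. by move=> q01 gh; exact: le_pexp. Qed.
Lemma expect_ge0 q g : 0 <= q <= 1 -> (forall T, 0 <= g T) -> 0 <= expect q g.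
Proof. by move=> q01 gh; exact: pexp_ge0. Qed.

Definition set_wt q A : R := \prod_x (if x \in A then q else 1 - q).

Lemma set_wtE q i A : i \notin A ->
  exists c, set_wt q A = (1 - q) * c /\ set_wt q (i |: A) = q * c.
Proof.
move=> iA; exists (\prod_(x | x != i) (if x \in A then q else 1 - q)).
rewrite /set_wt !(bigD1 i (P := predT)) //= (negbTE iA) !inE eqxx; split=> //.
by congr (_ * _); apply: eq_bigr => x /negbTE; rewrite !inE => ->.
Qed.

Lemma sum_wt_avg q i g :
  \sum_A set_wt q A * avg q i g A = \sum_A set_wt q A * g A.
Proof.
rewrite !(sum_set_split i); apply: eq_bigr => A iA.
have [c [-> ->]] := set_wtE q iA.
by rewrite avgU /avg setD1_id //; ring.
Qed.

Lemma sum_set_wt q : \sum_A set_wt q A = 1.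
Proof.
rewrite -(bigA_distr _ _ (fun _ : X => q) (fun _ => 1 - q)).
by rewrite big1 // => i _ /=; ring.
Qed.

(** Averaging over one coordinate preserves the weighted sum, and after all coordinates the function
    is constant. The sum form is what allows permuting the points and recognizing the law of the
    noise vector. *)
Lemma expectE q g : expect q g = \sum_A set_wt q A * g A.
Proof.
transitivity (\sum_A set_wt q A * pexp q (enum X) g A).
  under [RHS]eq_bigr do rewrite pexp_enum.
  by rewrite -mulr_suml sum_set_wt mul1r.
elim: (enum X) => //= i l <-; exact: sum_wt_avg.
Qed.

Lemma expect_inj_invariant q (s : X -> X) g : injective s ->
  expect q (fun T => g (s @^-1: T)) = expect q g.
Proof.
move=> s_inj; rewrite !expectE.
have [t st ts] := injF_bij s_inj.
rewrite (reindex (fun A => t @^-1: A)) /=; last first.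
  exists (fun A => s @^-1: A) => A _; apply/setP=> x; by rewrite !inE ?st ?ts.
apply: eq_bigr => A _; congr (_ * g _).
  rewrite /set_wt (reindex s) /=; last by exists t => x _.
  by apply: eq_bigr => x _; rewrite inE st.
by apply/setP=> x; rewrite !inE st.
Qed.
End Averaging.

(** * Entropy and concentration on the cube *)

Lemma ln_le_sub1 (R : realType) (x : R) : 0 < x -> ln x <= x - 1.
Proof.
move=> x0; have := expR_ge1Dx (ln x); rewrite lnK ?posrE //; lra.
Qed.

(** Entropy is at most variance over mean: use ln x <= x - 1 at x = a/m and x = b/m, where m is the
    mean, and average. *)
Lemma entropy_two_point (R : realType) (q a b : R) :
  0 <= q <= 1 -> 0 <= a -> 0 <= b -> 0 < q * a + (1 - q) * b ->
  q * (a * ln a) + (1 - q) * (b * ln b)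
    - (q * a + (1 - q) * b) * ln (q * a + (1 - q) * b)
  <= q * (1 - q) * (a - b) ^+ 2 / (q * a + (1 - q) * b).
Proof.
move=> /andP[q0 q1] a0 b0; set m := q * a + (1 - q) * b => m0.
have H (c : R) : 0 <= c -> c * ln c <= c * ln m + c * (c / m - 1).
  rewrite le_eqVlt => /orP[/eqP <-|c0]; first by rewrite !mul0r addr0.
  rewrite -mulrDr ler_pM2l // -lerBlDl -ln_div ?posrE //.
  by apply: ln_le_sub1; rewrite divr_gt0.
have Ha := ler_wpM2l q0 (H _ a0).
have q1' : 0 <= 1 - q by rewrite subr_ge0.
have Hb := ler_wpM2l q1' (H _ b0).
have -> : q * (1 - q) * (a - b) ^+ 2 / m =
   q * (a * (a / m - 1)) + (1 - q) * (b * (b / m - 1)).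
  by rewrite /m; field; rewrite -/m gt_eqF.
have -> : m * ln m = q * (a * ln m) + (1 - q) * (b * ln m) by rewrite /m; ring.
lra.
Qed.

Section CubeInequalities.
Variables (R : realType) (X : finType) (q : R).
Implicit Types (i j x : X) (l : seq X) (g h : {set X} -> R) (T A : {set X}).
Hypothesis q01 : 0 <= q <= 1.

Definition dcoord i g T := g (i |: T) - g (T :\ i).

Lemma pexp_shiftU i l g T : i \notin l ->
  pexp q l g (i |: T) = pexp q l (fun A => g (i |: A)) T.
Proof.
elim: l T => // j l IH T; rewrite inE negb_or => /andP[ij il].
rewrite !pexp_cons /avg -!IH //; congr (q * pexp q l g _ + (1 - q) * pexp q l g _);
  apply/setP=> y; rewrite !inE; case: (eqVneq y i) => [->|] /=; rewrite ?orbT //.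
by rewrite (negbTE ij).
Qed.

Lemma pexp_shiftD i l g T : i \notin l ->
  pexp q l g (T :\ i) = pexp q l (fun A => g (A :\ i)) T.
Proof.
elim: l T => // j l IH T; rewrite inE negb_or => /andP[ij il].
rewrite !pexp_cons /avg -!IH //; congr (q * pexp q l g _ + (1 - q) * pexp q l g _);
  apply/setP=> y; rewrite !inE; case: (eqVneq y i) => [->|] /=; rewrite ?andbF //.
by rewrite (negbTE ij).
Qed.

Lemma pexp_Cauchy_Schwarz l g h T :
  (pexp q l (fun A => g A * h A) T) ^+ 2 <=
  pexp q l (fun A => g A ^+ 2) T * pexp q l (fun A => h A ^+ 2) T.
Proof.
set t := pexp q l _ T; set u := pexp q l _ T; set v := pexp q l _ T.
have quad (c : R) : 0 <= u + c * (2 * t + c * v).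
  have -> : u + c * (2 * t + c * v) = pexp q l (fun A => (g A + c * h A) ^+ 2) T.
    transitivity (pexp q l (fun A => g A ^+ 2 + c * (2 * (g A * h A) + c * h A ^+ 2)) T).
      by rewrite pexpD pexpZ pexpD !pexpZ.
    by congr (pexp _ _ _ _); apply/funext => A; ring.
  by apply: pexp_ge0 => // A; exact: sqr_ge0.
have v0 : 0 <= v by apply: pexp_ge0 => // A; exact: sqr_ge0.
have [v_gt|] := ltP 0 v.
  have := quad (- t / v).
  have -> : u + - t / v * (2 * t + - t / v * v) = (u * v - t ^+ 2) / v.
    by field; rewrite gt_eqF.
  by rewrite pmulr_lge0 ?invr_gt0 // subr_ge0.
move=> v_le; have v_eq : v = 0 by apply/eqP; rewrite eq_le v0 v_le.
have [->|t0] := eqVneq t 0; first by rewrite v_eq mulr0 expr0n.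
(* For v = 0 the quadratic is affine in c, and this c would give it the value -1. *)
have := quad (- (u + 1) / (2 * t)).
have -> : u + - (u + 1) / (2 * t) * (2 * t + - (u + 1) / (2 * t) * v) = - 1.
  by rewrite v_eq; field.
lra.
Qed.

Lemma avg_sqr_sub i g T :
  avg q i (fun A => (g A - avg q i g A) ^+ 2) T = q * (1 - q) * dcoord i g T ^+ 2.
Proof.
by rewrite {1}/avg avgU avgD /avg /dcoord; ring.
Qed.

(** By the chain rule for entropy, a new coordinate adds the two-point entropy of the conditional
    second moments a and b. Writing the difference of squares as difference times sum,
    Cauchy-Schwarz gives (a - b)^2 <= 2 D (a + b), and a + b <= m / k because both q and 1 - q are
    at least k; hence the constant 2 / k. *)
Lemma log_Sobolev_list (k : R) l g T : 0 < k -> k <= q -> k <= 1 - q -> uniq l ->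
  pexp q l (fun A => g A ^+ 2 * ln (g A ^+ 2)) T
   - pexp q l (fun A => g A ^+ 2) T * ln (pexp q l (fun A => g A ^+ 2) T)
  <= 2 / k * \sum_(i <- l) pexp q l (fun A => (g A - avg q i g A) ^+ 2) T.
Proof.
move=> k0 kq kq'; elim: l T => [|i l IH] T; first by rewrite big_nil /= subrr mulr0.
rewrite cons_uniq => /andP[il ul].
rewrite big_cons.
set G := fun A => g A ^+ 2.
set F := fun A => g A ^+ 2 * ln (g A ^+ 2).
have IH1 := IH (i |: T) ul; have IH0 := IH (T :\ i) ul.
set a := pexp q l G (i |: T) in IH1.
set b := pexp q l G (T :\ i) in IH0.
have a0 : 0 <= a by apply: pexp_ge0 => // A; exact: sqr_ge0.
have b0 : 0 <= b by apply: pexp_ge0 => // A; exact: sqr_ge0.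
set m := q * a + (1 - q) * b.
have -> : pexp q (i :: l) G T = m by [].
have m0 : 0 <= m by rewrite /m; nra.
set D := pexp q l (fun A => dcoord i g A ^+ 2) T.
have -> : pexp q (i :: l) (fun A => (g A - avg q i g A) ^+ 2) T = q * (1 - q) * D.
  rewrite pexp_cons avg_pexp /D.
  by rewrite -pexpZ; congr (pexp _ _ _ _); apply/funext => A; rewrite avg_sqr_sub.
have D0 : 0 <= D by apply: pexp_ge0 => // A; exact: sqr_ge0.
have key : q * (a * ln a) + (1 - q) * (b * ln b) - m * ln m <=
           2 / k * (q * (1 - q) * D).
  have [mp|] := ltP 0 m; last first.
    move=> m_le; have m_eq : m = 0 by apply/eqP; rewrite eq_le m0 m_le.
    have a_eq : a = 0 by move: m_eq; rewrite /m; nra.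
    have b_eq : b = 0 by move: m_eq; rewrite /m; nra.
    rewrite m_eq a_eq b_eq !mul0r !mulr0 subr0 addr0.
    apply: mulr_ge0; first by rewrite divr_ge0 // ltW.
    by apply: mulr_ge0 => //; case/andP: q01 => *; apply: mulr_ge0; lra.
  apply: le_trans (entropy_two_point q01 a0 b0 mp) _.
  rewrite -/m ler_pdivrMr //.
  have CS : (a - b) ^+ 2 <= D * (2 * (a + b)).
    have -> : a - b = pexp q l (fun A => dcoord i g A * (g (i |: A) + g (A :\ i))) T.
      rewrite /a /b pexp_shiftU // pexp_shiftD //.
      rewrite -pexpB; congr (pexp _ _ _ _); apply/funext => A.
      by rewrite /G /dcoord; ring.
    apply: le_trans (pexp_Cauchy_Schwarz _ _ _ _) _; rewrite ler_wpM2l //.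
    rewrite /a /b pexp_shiftU // pexp_shiftD //.
    rewrite -pexpD -pexpZ; apply: le_pexp => // A.
    by rewrite /G; have := sqr_ge0 (g (i |: A) - g (A :\ i)); nra.
  have abm : a + b <= m / k.
    by rewrite ler_pdivlMr // /m; nra.
  have -> : 2 / k * (q * (1 - q) * D) * m = q * (1 - q) * (D * (2 * (m / k))) by ring.
  apply: ler_wpM2l; first by case/andP: q01 => *; apply: mulr_ge0; lra.
  apply: le_trans CS _; apply: ler_wpM2l => //; lra.
have -> : pexp q (i :: l) F T = q * pexp q l F (i |: T) + (1 - q) * pexp q l F (T :\ i) by [].
have -> : \sum_(j <- l) pexp q (i :: l) (fun A => (g A - avg q j g A) ^+ 2) T =
   q * (\sum_(j <- l) pexp q l (fun A => (g A - avg q j g A) ^+ 2) (i |: T)) +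
   (1 - q) * (\sum_(j <- l) pexp q l (fun A => (g A - avg q j g A) ^+ 2) (T :\ i)).
  by rewrite !mulr_sumr -big_split.
case/andP: q01 => q0 q1; have q1' : 0 <= 1 - q by lra.
have := ler_wpM2l q0 IH1; have := ler_wpM2l q1' IH0.
rewrite -/a -/b -/F -/G.
set s1 := \sum_(j <- l) _; set s0 := \sum_(j <- l) _ => H0 H1.
move: key H0 H1; set c := 2 / k => key H0 H1; lra.
Qed.

(** The bounded-difference argument: averaging over some coordinates keeps the variation in the
    others at most 1, so each coordinate costs a factor 1 + 2 t^2 at most, the linear terms
    cancelling. *)
Lemma pexp_exp_Lipschitz l g T (t : R) :
  0 <= t <= 2^-1 -> (forall i A, `|dcoord i g A| <= 1) -> uniq l ->
  pexp q l (fun A => expR (t * g A)) T <=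
  expR (t * pexp q l g T + (size l)%:R * (2 * t ^+ 2)).
Proof.
move=> /andP[t0 t1] lip.
have lip' l' i A : i \notin l' -> `|dcoord i (pexp q l' g) A| <= 1.
  move=> il; rewrite /dcoord pexp_shiftU // pexp_shiftD //.
  rewrite -pexpB ler_norml; apply/andP; split.
    have := le_pexp (g := fun=> -1) (h := fun T => g (i |: T) - g (T :\ i)) l' A q01.
    by rewrite pexp_cst; apply => B; have := lip i B; rewrite ler_norml => /andP[].
  have := le_pexp (h := fun=> 1) (g := fun T => g (i |: T) - g (T :\ i)) l' A q01.
  by rewrite pexp_cst; apply => B; have := lip i B; rewrite ler_norml => /andP[].
(* Compare (1 - x) exp(x) <= 1 with (1 - x)(1 + x + 2 x^2) = 1 + x^2 (1 - 2x) >= 1; this is why t is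
   at most 1/2. *)
have exp_le (x : R) : x <= 2^-1 -> expR x <= 1 + x + 2 * x ^+ 2.
  move=> xh; have e0 := expR_gt0 x.
  have := expR_ge1Dx (- x); rewrite expRN => h.
  have : (1 - x) * expR x <= 1.
    by rewrite -ler_pdivlMr // mul1r.
  have : 0 < 1 - x by lra.
  move=> x1 h1; have : 1 <= (1 - x) * (1 + x + 2 * x ^+ 2).
    have -> : (1 - x) * (1 + x + 2 * x ^+ 2) = 1 + x ^+ 2 * (1 - 2 * x) by ring.
    by rewrite lerDl mulr_ge0 ?sqr_ge0 //; lra.
  by move=> h2; rewrite -(ler_pM2l x1); apply: le_trans h2.
elim: l T => [|i l IH] T; first by rewrite mul0r addr0.
rewrite cons_uniq => /andP[il ul].
rewrite !pexp_cons /avg.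
have IH1 := IH (i |: T) ul; have IH0 := IH (T :\ i) ul.
have dl := lip' l i T il.
move: IH1 IH0 dl; rewrite /dcoord.
set a := pexp q l g (i |: T); set b := pexp q l g (T :\ i).
set s := (size l)%:R * _; rewrite !expRD.
set m := q * a + (1 - q) * b => IH1 IH0; rewrite ler_norml => /andP[d1 d2].
rewrite [size (i :: l)]/= -natr1 [X in _ <= expR (t * m) * expR X]mulrDl mul1r expRD -/s.
case/andP: q01 => q0 q1; have q1' : 0 <= 1 - q by lra.
have E0 := expR_ge0 s.
apply: (@le_trans _ _ ((q * expR (t * a) + (1 - q) * expR (t * b)) * expR s)).
  rewrite [leRHS]mulrDl; apply: lerD; rewrite -mulrA; exact: ler_wpM2l.
rewrite mulrCA [leRHS]mulrC; apply: ler_wpM2r => //.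
have am : a = m + (1 - q) * (a - b) by rewrite /m; ring.
have bm : b = m - q * (a - b) by rewrite /m; ring.
have -> : t * a = t * m + t * ((1 - q) * (a - b)) by rewrite {1}am; ring.
have -> : t * b = t * m + - (t * (q * (a - b))) by rewrite {1}bm; ring.
rewrite !expRD.
have -> : q * (expR (t * m) * expR (t * ((1 - q) * (a - b)))) +
  (1 - q) * (expR (t * m) * expR (- (t * (q * (a - b))))) =
  expR (t * m) * (q * expR (t * ((1 - q) * (a - b))) +
     (1 - q) * expR (- (t * (q * (a - b))))) by ring.
apply: ler_wpM2l; first exact: expR_ge0.
have le1 (u : R) : 0 <= u <= 1 -> `|u * (a - b)| <= 1.
  move=> /andP[u0 u1]; rewrite normrM ger0_norm //.
  by rewrite -[leRHS]mulr1 ler_pM //; rewrite ler_norml d1 d2.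
have tb (y : R) : `|y| <= 1 -> t * y <= 2^-1 /\ - (t * y) <= 2^-1.
  by rewrite ler_norml => /andP[y1 y2]; split; nra.
have [ha _] := tb _ (le1 (1 - q) ltac:(lra)).
have [_ hb] := tb _ (le1 q ltac:(lra)).
have {}ha := ler_wpM2l q0 (exp_le _ ha).
have {}hb := ler_wpM2l q1' (exp_le _ hb).
apply: le_trans (lerD ha hb) _.
apply: le_trans (expR_ge1Dx _).
have -> : q * (1 + t * ((1 - q) * (a - b)) + 2 * (t * ((1 - q) * (a - b))) ^+ 2) +
  (1 - q) * (1 + - (t * (q * (a - b))) + 2 * (- (t * (q * (a - b)))) ^+ 2) =
  1 + 2 * t ^+ 2 * ((q * (1 - q)) * (a - b) ^+ 2) by ring.
rewrite lerD2l -[leRHS]mulr1; apply: ler_wpM2l; first by rewrite mulr_ge0 ?sqr_ge0.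
have ab1 : (a - b) ^+ 2 <= 1.
  have : 0 <= (1 - (a - b)) * (1 + (a - b)) by apply: mulr_ge0; lra.
  by rewrite (_ : _ * _ = 1 - (a - b) ^+ 2) ?subr_ge0 //; ring.
rewrite -[leRHS]mulr1; apply: ler_pM => //; rewrite ?sqr_ge0 ?mulr_ge0 //.
by rewrite -[leRHS]mulr1; apply: ler_pM => //; lra.
Qed.

(** The mean variance of [g] in coordinate [i]; for an indicator, its influence times q (1 - q). *)
Definition energy i g := expect q (fun T => (g T - avg q i g T) ^+ 2).

Lemma energyE i g : energy i g = q * (1 - q) * expect q (fun T => dcoord i g T ^+ 2).
Proof.
rewrite /energy -(expect_avg _ i) -expectZ.
by congr (expect _ _); apply/funext => T; exact: avg_sqr_sub.
Qed.

Lemma energy_ge0 i g : 0 <= energy i g.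
Proof. by apply: expect_ge0 => // T; exact: sqr_ge0. Qed.

Lemma energy_Pythagoras i g :
  energy i g = expect q (fun T => g T ^+ 2) - expect q (fun T => avg q i g T ^+ 2).
Proof.
have -> : energy i g = expect q (fun T => g T ^+ 2)
   - 2 * expect q (fun T => g T * avg q i g T) + expect q (fun T => avg q i g T ^+ 2).
  rewrite -expectZ -expectB -expectD /energy.
  by congr (expect _ _); apply/funext => T; ring.
rewrite -(expect_avg _ i (fun T => g T * _)) avg_pull.
have -> : (fun T => avg q i g T * avg q i g T) = (fun T => avg q i g T ^+ 2).
  by apply/funext => T; rewrite expr2.
ring.
Qed.

Lemma pexp_sqr_le l g T : pexp q l g T ^+ 2 <= pexp q l (fun A => g A ^+ 2) T.
Proof.
have := pexp_Cauchy_Schwarz l g (fun=> 1) T.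
under eq_fun do rewrite mulr1; under [X in _ * pexp q l X T]eq_fun do rewrite expr1n.
by rewrite pexp_cst mulr1.
Qed.

Lemma log_Sobolev (k : R) g : 0 < k -> k <= q -> k <= 1 - q ->
  expect q (fun A => g A ^+ 2 * ln (g A ^+ 2))
   - expect q (fun A => g A ^+ 2) * ln (expect q (fun A => g A ^+ 2))
  <= 2 / k * \sum_i energy i g.
Proof.
move=> k0 kq kq'.
by have := log_Sobolev_list g finset.set0 k0 kq kq' (enum_uniq X); rewrite big_enum.
Qed.

(* Falik and Samorodnitsky: apply the log-Sobolev inequality to the martingale
   differences of f and bound their entropies below by x ln x >= 2x - 2 sqrt x.
   The energies of the differences add up to the energy of f. *)
Lemma KKL_energy (k w : R) (f : {set X} -> R) : 0 < k -> k <= q -> k <= 1 - q ->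
  (forall T, f T = 0 \/ f T = 1) -> 0 < w -> (forall i, energy i f <= w) ->
  (2 - ln w) * (expect q (fun T => f T ^+ 2) - expect q f ^+ 2)
  <= (2 / k + 4) * \sum_i energy i f.
Proof.
move=> k0 kq kq' f01 w0 fw.
(* Telescoping form: prepending [i] to [l] adds on the left the squared norm of the martingale
   difference [d] below, and on the right the sum of the energies of [d], to which the log-Sobolev
   inequality applies. At the full list the negative terms on the right are dropped. *)
suff H l : (2 - ln w) * (expect q (fun T => f T ^+ 2) - expect q (fun T => pexp q l f T ^+ 2))
   - 4 * \sum_(i <- l) energy i f <= 2 / k * \sum_j (energy j f
     - expect q (fun T => pexp q l (fun A => f A - avg q j f A) T ^+ 2)).
  have := H (enum X).
  have -> : (fun T => pexp q (enum X) f T ^+ 2) = fun=> expect q f ^+ 2.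
    by apply/funext => T; rewrite pexp_enum.
  rewrite expect_cst big_enum /= => {}H.
  rewrite [leRHS]mulrDl -lerBlDr; apply: le_trans H _.
  apply: ler_wpM2l; first by rewrite divr_ge0 // ltW.
  apply: ler_sum => j _; rewrite gerBl.
  by apply: expect_ge0 => // T; exact: sqr_ge0.
elim: l => [|i l IH].
  rewrite /= subrr mulr0 big_nil mulr0 subrr big1 ?mulr0 // => j _.
  by rewrite /energy subrr.
set u := pexp q l f.
set d := fun T => u T - avg q i u T.
have Ed2 : expect q (fun T => d T ^+ 2) = expect q (fun T => u T ^+ 2)
    - expect q (fun T => pexp q (i :: l) f T ^+ 2).
  by rewrite -[LHS]/(energy i u) energy_Pythagoras.
have Ek j : energy j d = expect q (fun T => pexp q l (fun A => f A - avg q j f A) T ^+ 2)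
   - expect q (fun T => pexp q (i :: l) (fun A => f A - avg q j f A) T ^+ 2).
  rewrite -[X in _ - X]/(expect q (fun T =>
    avg q i (pexp q l (fun A => f A - avg q j f A)) T ^+ 2)).
  rewrite -energy_Pythagoras /energy; congr (expect _ _); apply/funext => T; congr (_ ^+ 2).
  have avgB g h : avg q j (fun A => g A - h A) = (fun A => avg q j g A - avg q j h A).
    by apply/funext => A; rewrite /avg; ring.
  have avgBi g h : avg q i (fun A => g A - h A) = (fun A => avg q i g A - avg q i h A).
    by apply/funext => A; rewrite /avg; ring.
  have -> : pexp q l (fun A => f A - avg q j f A) = (fun A => u A - avg q j u A).
    by apply/funext => A; rewrite pexpB -avg_pexp.
  rewrite /d avgB avgBi (avgC _ j i); ring.
have dE T : d T = pexp q l (fun A => f A - avg q i f A) T.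
  by rewrite /d /u avg_pexp pexpB.
have Ed2w : expect q (fun T => d T ^+ 2) <= w.
  apply: le_trans (fw i).
  rewrite /energy -(expect_pexp q l (fun T => (f T - avg q i f T) ^+ 2)).
  by apply: le_expect => // T; rewrite dE; exact: pexp_sqr_le.
(* Only here is [f] Boolean: its increments satisfy |D| = D^2, so the first moment of f - avg f is
   twice the energy, and averaging over [l] can only decrease it. *)
have Ed1 : expect q (fun T => `|d T|) <= 2 * energy i f.
  have -> : 2 * energy i f = expect q (fun T => `|f T - avg q i f T|).
    rewrite energyE -(expect_avg _ i (fun T => `|f T - avg q i f T|)) -!expectZ.
    congr (expect _ _); apply/funext => T; rewrite {1}/avg avgU avgD /avg /dcoord.
    case/andP: q01 => q0 q1.
    set a := f (i |: T); set b := f (T :\ i).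
    have -> : a - (q * a + (1 - q) * b) = (1 - q) * (a - b) by ring.
    have -> : b - (q * a + (1 - q) * b) = - (q * (a - b)) by ring.
    rewrite normrN !normrM (ger0_norm q0) [`|1 - q|]ger0_norm ?subr_ge0 //.
    have -> : `|a - b| = (a - b) ^+ 2; last by ring.
    by rewrite /a /b; case: (f01 (i |: T)) => ->; case: (f01 (T :\ i)) => ->;
      rewrite ?subr0 ?subrr ?sub0r ?normrN ?normr0 ?normr1 ?sqrrN ?expr1n ?expr0n.
  rewrite -(expect_pexp q l (fun T => `|f T - avg q i f T|)).
  apply: le_expect => // T; rewrite dE ler_norml; apply/andP; split.
    rewrite lerNl -mulN1r -pexpZ.
    by apply: le_pexp => // A; rewrite mulN1r ler_normr lexx orbT.
  by apply: le_pexp => // A; rewrite ler_norm.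
have ls := log_Sobolev d k0 kq kq'.
have low : 2 * expect q (fun T => d T ^+ 2) - 2 * expect q (fun T => `|d T|) <=
   expect q (fun A => d A ^+ 2 * ln (d A ^+ 2)).
  rewrite -!expectZ -expectB; apply: le_expect => // T.
  have [->|d0] := eqVneq (d T) 0; first by rewrite normr0 expr0n /= !mulr0 mul0r subrr.
  have nd0 : 0 < `|d T| by rewrite normr_gt0.
  rewrite -(real_normK (num_real (d T))) lnXn // -mulr_natl.
  have := ln_le_sub1 (x := `|d T|^-1); rewrite invr_gt0 lnV ?posrE // => /(_ nd0) h.
  have := ler_wpM2l (ltW nd0) h; rewrite mulrBr divff ?gt_eqF // => {}h.
  have := ler_wpM2l (ltW nd0) h.
  set x := `|d T|; nra.
have d20 : 0 <= expect q (fun T => d T ^+ 2) by apply: expect_ge0 => // T; exact: sqr_ge0.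
have up : - (expect q (fun A => d A ^+ 2) * ln (expect q (fun A => d A ^+ 2))) >=
   - (expect q (fun A => d A ^+ 2) * ln w).
  move: d20; rewrite le_eqVlt => /orP[/eqP <-|d20]; first by rewrite !mul0r.
  by rewrite lerN2 ler_pM2l // ler_ln ?posrE.
have -> : \sum_j (energy j f -
   expect q (fun T => pexp q (i :: l) (fun A => f A - avg q j f A) T ^+ 2)) =
   \sum_j (energy j f - expect q (fun T => pexp q l (fun A => f A - avg q j f A) T ^+ 2))
   + \sum_j energy j d.
  by rewrite -big_split; apply: eq_bigr => j _; rewrite Ek /=; ring.
rewrite big_cons mulrDr [X in _ <= X]mulrDr.
move: IH ls Ed1 low up; rewrite Ed2 -/u.
set c := 2 / k; lra.
Qed.
End CubeInequalities.

(** * Russo's formula *)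

Lemma is_derive_nincr (R : realType) (f df : R -> R) (a b : R) :
  (forall x, a <= x <= b -> is_derive x 1 f (df x)) ->
  (forall x, a <= x <= b -> df x <= 0) ->
  forall x y, a <= x -> x <= y -> y <= b -> f y <= f x.
Proof.
move=> fd df0 x y ax xy yb.
have sub t : t \in `]a, b[ -> a <= t <= b.
  by rewrite in_itv /= => /andP[/ltW-> /ltW->].
apply: (@ler0_derive1_le_cc _ f a b) => //.
- by move=> t /sub tab; have := fd t tab => -[].
- by move=> t /sub tab; rewrite derive1E; have := fd t tab => -[_ ->]; exact: df0.
- apply: derivable_within_continuous => t; rewrite in_itv /= => tab.
  by have := fd t tab => -[].
- by rewrite in_itv /=; apply/andP; split; lra.
- by rewrite in_itv /=; apply/andP; split; lra.
Qed.

(** The integrating factor exp(A (x - a)) turns the hypothesis into monotonicity. *)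
Lemma Gronwall (R : realType) (f df : R -> R) (a b A c : R) : a <= b ->
  (forall x, a <= x <= b -> is_derive x 1 f (df x)) ->
  (forall x, a <= x <= b -> df x <= - A * (f x - c)) ->
  f b - c <= expR (- (A * (b - a))) * (f a - c).
Proof.
move=> ab fd dfA.
pose F x := (f x - c) * expR (A * (x - a)).
pose dF x := (df x + A * (f x - c)) * expR (A * (x - a)).
have Fd x : a <= x <= b -> is_derive x 1 F (dF x).
  move=> xab; have := fd x xab => fdx.
  rewrite /F /dF; apply: is_derive_eq.
  rewrite /GRing.scale /=; ring.
have : F b <= F a.
  apply: (is_derive_nincr Fd) => // x xab.
  rewrite /dF pmulr_lle0 ?expR_gt0 //; have := dfA x xab; lra.
rewrite /F subrr mulr0 expR0 mulr1 => H.
by rewrite expRN [leRHS]mulrC ler_pdivlMr ?expR_gt0.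
Qed.

Lemma Russo_list (R : realType) (X : finType) (l : seq X) (g : {set X} -> R) T (q : R) :
  uniq l ->
  is_derive q 1 (fun p => pexp p l g T) (\sum_(i <- l) pexp q l (dcoord i g) T).
Proof.
elim: l T => [|i l IH] T.
  move=> _; rewrite big_nil; exact: (is_derive_cst (g T)).
rewrite cons_uniq => /andP[il ul].
have d1 := IH (i |: T) ul; have d0 := IH (T :\ i) ul.
rewrite /= /avg; apply: is_derive_eq.
rewrite /GRing.scale /= big_cons.
have -> : q * pexp q l (dcoord i g) (i |: T) + (1 - q) * pexp q l (dcoord i g) (T :\ i)
  = pexp q l g (i |: T) - pexp q l g (T :\ i).
  rewrite !pexp_shiftU // !pexp_shiftD // -pexpB.
  have -> : (fun A => dcoord i g (i |: A)) = (fun A => g (i |: A) - g (A :\ i)).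
    by apply/funext => A; rewrite /dcoord setU1_idem setD1_setU1.
  have -> : (fun A => dcoord i g (A :\ i)) = (fun A => g (i |: A) - g (A :\ i)).
    by apply/funext => A; rewrite /dcoord setU1_setD1 setD1_idem.
  ring.
rewrite big_split /= -!mulr_sumr; ring.
Qed.

Lemma Russo (R : realType) (X : finType) (g : {set X} -> R) (q : R) :
  is_derive q 1 (fun p => expect p g) (\sum_i expect q (dcoord i g)).
Proof.
have := Russo_list g finset.set0 q (enum_uniq X); by rewrite big_enum.
Qed.

(** * The column matroid of a matrix *)

Section ColumnMatroid.
Variables (F : finFieldType) (m n : nat) (H : 'M[F]_(m, n)).
Implicit Types (T : {set 'I_n}) (x y : 'I_n).

(** Subspaces are row spaces, so columns of H enter as rows of its transpose; the brackets make each
    summand a square matrix of size m. *)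
Definition cspan T : 'M[F]_m := (\sum_(x in T) <<row x H^T>>)%MS.
Definition incl T x : bool := (row x H^T <= cspan T)%MS.
Definition rk T : nat := \rank (cspan T).

Lemma cspanS T T' : T \subset T' -> (cspan T <= cspan T')%MS.
Proof.
move=> /fintype.subsetP TT'; apply/sumsmx_subP => x xT.
by apply: (sumsmx_sup x) => //; exact: TT'.
Qed.

Lemma inclS T T' x : T \subset T' -> incl T x -> incl T' x.
Proof. by move=> TT' /submx_trans; apply; exact: cspanS. Qed.

Lemma incl_mem T x : x \in T -> incl T x.
Proof. by move=> xT; apply: (sumsmx_sup x) => //; rewrite genmxE. Qed.

Lemma cspanU1 T x : (cspan (x |: T) :=: cspan T + row x H^T)%MS.
Proof.
apply/eqmxP/andP; split.
  apply/sumsmx_subP => y; rewrite !inE => /orP[/eqP ->|yT].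
    by rewrite genmxE addsmxSr.
  by apply: submx_trans (addsmxSl _ _); apply: (sumsmx_sup y).
rewrite addsmx_sub cspanS ?andTb ?finset.subsetUr //.
by apply: incl_mem; rewrite !inE eqxx.
Qed.

Lemma rkU1 T x : rk (x |: T) = (rk T + ~~ incl T x)%N.
Proof.
rewrite /rk (cspanU1 T x).
case: (boolP (incl T x)) => [|xT].
  by move=> /addsmx_idPl ->; rewrite addn0.
apply/eqP; rewrite eqn_leq; apply/andP; split.
  apply: leq_trans (mxrank_adds_leqif _ _) _; rewrite leq_add2l.
  exact: rank_leq_row.
rewrite addn1 ltn_neqAle mxrankS ?addsmxSl // andbT.
apply: contra xT; rewrite /incl.
rewrite (mxrank_leqif_eq (addsmxSl (cspan T) (row x H^T))) => /andP[_].
by apply: submx_trans; exact: addsmxSr.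
Qed.

Lemma rk_le T : (rk T <= m)%N.
Proof. exact: rank_leq_row. Qed.

Lemma rk0 : rk finset.set0 = 0%N.
Proof. by rewrite /rk /cspan big_set0 mxrank0. Qed.

Lemma cspanP T (v : 'rV[F]_m) :
  reflect (exists2 c : 'cV[F]_n, forall y, y \notin T -> c y 0 = 0 & v^T = H *m c)
          (v <= cspan T)%MS.
Proof.
have e (c : 'cV[F]_n) : (forall y, y \notin T -> c y 0 = 0) ->
    (H *m c)^T = \sum_(x in T) c x 0 *: row x H^T.
  move=> cT; apply/rowP => k; rewrite summxE !mxE.
  rewrite (bigID (fun x => x \in T)) /= [X in _ + X]big1 ?addr0.
    by apply: eq_bigr => x _; rewrite !mxE mulrC.
  by move=> y yT; rewrite cT // mulr0.
apply: (iffP sub_sumsmxP) => [[u ->]|[c cT vc]].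
  have /fin_all_exists [w wE] x : exists a : F, u x *m <<row x H^T>>%MS = a *: row x H^T.
    by apply/sub_rVP; apply: submx_trans (submxMl _ _) _; rewrite genmxE.
  exists (\col_x (if x \in T then w x else 0)).
    by move=> y /negbTE; rewrite !mxE => ->.
  apply: (can_inj (@trmxK _ _ _)); rewrite trmxK e; last by move=> y /negbTE; rewrite !mxE => ->.
  by apply: eq_bigr => x xT; rewrite wE mxE xT.
have -> : v = \sum_(x in T) c x 0 *: row x H^T by rewrite -e // -vc trmxK.
have /fin_all_exists [w wE] x : exists u : 'rV[F]_m, c x 0 *: row x H^T = u *m <<row x H^T>>%MS.
  by apply/submxP; rewrite scalemx_sub // genmxE.
by exists w; apply: eq_bigr => x _; rewrite wE.
Qed.

Lemma inclP T x :
  reflect (exists2 c : 'cV[F]_n, forall y, y \notin T -> c y 0 = 0 &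
             col x H = H *m c) (incl T x).
Proof.
apply: (iffP (cspanP _ _)) => -[c c0 e]; exists c => //.
  by rewrite -e tr_row trmxK.
by rewrite tr_row trmxK.
Qed.

(** Expresses dependence of columns through the kernel of H alone, so that automorphisms of the
    code, which need not act on the rows of H, preserve it. *)
Lemma incl_codewordP T x : x \notin T ->
  reflect (exists c : 'cV[F]_n, [/\ H *m c = 0, c x 0 = 1 &
             forall y, y != x -> y \notin T -> c y 0 = 0]) (incl T x).
Proof.
move=> xT.
have ed : col x H = H *m delta_mx x (0 : 'I_1) by rewrite colE.
apply: (iffP (inclP _ _)) => [[c c0 e]|[c [c0 cx cT]]].
  exists (delta_mx x 0 - c); split.
  - by rewrite mulmxBr -ed e subrr.
  - by rewrite !mxE !eqxx c0 // subr0.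
  - by move=> y /negbTE yx yT; rewrite !mxE yx c0 // subr0.
exists (delta_mx x 0 - c); last by rewrite mulmxBr c0 subr0 ed.
move=> y yT; rewrite !mxE !eqxx andbT; case: eqP => [->|/eqP yx].
  by rewrite cx subrr.
by rewrite cT // subr0.
Qed.

(** Coloops are independent: listed one after the other, each lies outside the span of the previous
    ones, which all belong to T \ x. *)
Lemma coloops_le T : (#|[set x in T | ~~ incl (T :\ x) x]| <= rk T)%N.
Proof.
suff H1 l : uniq l -> {subset l <= T} ->
    (count (fun x => ~~ incl (T :\ x) x) l <= rk [set x in l])%N.
  have := H1 (enum T) (enum_uniq _) (fun x => _).
  rewrite -size_filter => /(_ _)/leq_trans.
  have -> : [set x in enum T] = T by apply/setP => x; rewrite !inE mem_enum.
  have -> : size [seq x <- enum T | ~~ incl (T :\ x) x] =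
            #|[set x in T | ~~ incl (T :\ x) x]|.
    rewrite cardE; apply: perm_size; apply: uniq_perm.
    - by apply: filter_uniq; exact: enum_uniq.
    - exact: enum_uniq.
    by move=> x; rewrite mem_filter !mem_enum inE andbC.
  by apply=> // x; rewrite mem_enum.
elim: l => [//|x l IH] /= /andP[xl ul] sub.
have -> : [set y in x :: l] = x |: [set y in l] by apply/setP => y; rewrite !inE.
rewrite rkU1 addnC leq_add //.
  by apply: IH => // y yl; apply: sub; rewrite inE yl orbT.
case: (boolP (incl _ x)) => //= xin; case: (boolP (incl [set _ in _] x)) => //=.
move=> /(inclS (T' := T :\ x)) h; case/negP: xin; apply: h.
apply/fintype.subsetP => y; rewrite !inE => yl; rewrite sub ?inE ?yl ?orbT // andbT.
by apply: contraNneq xl => <-.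
Qed.

Lemma rk_setT : rk [set: 'I_n] = \rank H.
Proof.
rewrite -mxrank_tr /rk; apply: eqmx_rank; apply/andP; split.
  by apply/sumsmx_subP => x _; rewrite genmxE row_sub.
by apply/row_subP => x; apply: incl_mem; rewrite inE.
Qed.

Definition missing T : {set 'I_n} := [set x | ~~ incl T x].

(** When all columns are added to T one at a time, only missing ones can raise the rank, each by one
    at most. *)
Lemma rank_le_missing T : (\rank H <= rk T + #|missing T|)%N.
Proof.
suff H1 l : uniq l -> (rk (T :|: [set x in l]) <= rk T + count (fun x => ~~ incl T x) l)%N.
  have := H1 (enum 'I_n) (enum_uniq _).
  have -> : T :|: [set x in enum 'I_n] = [set: 'I_n].
    by apply/setP => x; rewrite !inE mem_enum orbT.
  rewrite rk_setT => /leq_trans; apply.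
  rewrite leq_add2l /missing cardsE cardE -size_filter enumT.
  by rewrite leq_eqVlt -enumT /enum_mem filter_predT eqxx.
elim: l => [|x l IH] /=.
  by rewrite (_ : [set _ in [::]] = finset.set0) ?finset.setU0 ?addn0.
move=> /andP[xl ul].
have -> : T :|: [set y in x :: l] = x |: (T :|: [set y in l]).
  by apply/setP => y; rewrite !inE orbCA.
rewrite rkU1 (addnC (~~ _ : nat)) addnA leq_add ?IH //.
case: (boolP (incl T x)) => [xT|_]; last exact: leq_b1.
by rewrite (inclS (finset.subsetUl T [set y in l]) xT).
Qed.

(** Turns the deficit m - rk H_T into the dimension of a space of vectors v whose word v H vanishes
    on T. *)
Lemma card_annihilator T :
  #|[set v : 'rV[F]_m | [forall x in T, (v *m H) 0 x == 0]]| = (#|F| ^ (m - rk T))%N.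
Proof.
rewrite /rk -(mxrank_tr (cspan T)) -mxrank_ker -mxabelem.card_rowg.
apply: eq_card => v; rewrite !inE; apply/forall_inP/sub_kermxP => h.
  have /fin_all_exists [c cP] (i : 'I_m) : exists c : 'cV[F]_n,
     (forall y, y \notin T -> c y 0 = 0) /\ (row i (cspan T))^T = H *m c.
    by have /cspanP[c c0 e] := row_sub i (cspan T); exists c.
  apply/rowP => i; rewrite [RHS]mxE.
  have -> : (v *m (cspan T)^T) 0 i = (v *m (row i (cspan T))^T) 0 0.
    by rewrite !mxE; apply: eq_bigr => k _; rewrite !mxE.
  have [c0 ->] := cP i; rewrite mulmxA mxE big1 // => y _.
  case: (boolP (y \in T)) => yT; first by rewrite (eqP (h _ yT)) mul0r.
  by rewrite c0 // mulr0.
move=> x xT; have /submxP[w wE] := incl_mem xT.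
have -> : (v *m H) 0 x = (v *m (row x H^T)^T) 0 0.
  by rewrite !mxE; apply: eq_bigr => k _; rewrite !mxE.
by rewrite wE trmx_mul mulmxA h mul0mx mxE.
Qed.
End ColumnMatroid.

(** * Words orthogonal to low-degree polynomials *)

(** A counting form of rank-nullity: with a chosen preimage s(w) of each value w, the map u |-> (f
    u, u - s (f u)) is injective into I times the kernel. *)
Lemma card_subgroup_fibers (Y Z : finType) (V W : finZmodType)
    (f : {ffun Y -> V} -> {ffun Z -> W})
    (S : {set {ffun Y -> V}}) (I : {set {ffun Z -> W}}) :
  {morph f : u v / u - v} ->
  (forall u v, u \in S -> v \in S -> u - v \in S) -> (forall u, u \in S -> f u \in I) ->
  (#|S| <= #|I| * #|[set u in S | f u == 0%R]|)%N.
Proof.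
move=> fB Ssub SI.
pose s w := odflt 0 [pick u in S | f u == w].
have sP u : u \in S -> s (f u) \in S /\ f (s (f u)) = f u.
  move=> uS; rewrite /s; case: pickP => [v /andP[? /eqP ?] //|/(_ u)].
  by rewrite uS eqxx.
rewrite -cardsX -(card_in_imset (f := fun u => (f u, u - s (f u)))).
  apply/subset_leq_card/fintype.subsetP => _ /imsetP[u uS ->]; rewrite !inE SI //=.
  have [sS fs] := sP _ uS.
  by rewrite Ssub //= fB fs subrr.
by move=> u v uS vS [-> /addIr].
Qed.

Section Parities.
Variable K : finType.
Implicit Types (u v : {ffun {set K} -> 'F_2}) (A y : {set K}) (B : {set {set K}}).

Lemma addF2 (a : 'F_2) : a + a = 0.
Proof. by apply: addrr_pchar2; rewrite pchar_Fp. Qed.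

(* A point of F_2^K is the set y of its coordinates equal to 1, so that the monomial
   x^A takes the value 1 at y iff A is included in y. *)
Definition moment u A : 'F_2 := \sum_(y : {set K} | A \subset y) u y.

(* Words supported on B and orthogonal to every polynomial of degree < d. *)
Definition dual_words B (d : nat) : {set {ffun {set K} -> 'F_2}} :=
  [set u : {ffun {set K} -> 'F_2} | [forall y, (y \notin B) ==> (u y == 0)] &&
           [forall A : {set K}, (#|A| < d)%N ==> (moment u A == 0)]].

Lemma dual_wordsP B d u :
  reflect ((forall y, y \notin B -> u y = 0) /\
           (forall A, (#|A| < d)%N -> moment u A = 0)) (u \in dual_words B d).
Proof.
rewrite inE; apply: (iffP andP) => -[h1 h2]; split.
- by move=> y yB; apply/eqP; exact: (implyP (forallP h1 y)).
- by move=> A Ad; apply/eqP; exact: (implyP (forallP h2 A)).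
- by apply/forallP => y; apply/implyP => /h1 ->.
- by apply/forallP => A; apply/implyP => /h2 ->.
Qed.

Lemma momentB u v A : moment (u - v) A = moment u A - moment v A.
Proof. by rewrite /moment -sumrB; apply: eq_bigr => y _; rewrite !ffunE. Qed.

Lemma moment_split i u A : i \notin A ->
  moment u A = \sum_(y : {set K} | (A \subset y) && (i \notin y)) (u y + u (i |: y)).
Proof.
move=> iA; rewrite /moment big_mkcond (sum_set_split i) /= [RHS]big_mkcondl /=.
apply: eq_bigr => y iy.
have -> : (A \subset i |: y) = (A \subset y).
  apply/fintype.subsetP/fintype.subsetP => h x xA; have := h x xA; rewrite !inE.
    by case/orP => // /eqP xi; rewrite -xi xA in iA.
  by move=> ->; rewrite orbT.
by case: ifP => // _; rewrite addr0.
Qed.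

(** Moments are triangular for inclusion: at a point x of maximal size with u x nonzero, the moment
    of x is u x. *)
Lemma moment_inj u : (forall A, moment u A = 0) -> u = 0.
Proof.
move=> u0; apply/ffunP => y; rewrite ffunE; apply/eqP; apply: contraT => uy.
have [x ux xmax] : {x | u x != 0 & forall x', u x' != 0 -> (#|x'| <= #|x|)%N}.
  by case: (@arg_maxnP _ y (fun x => u x != 0) (fun x => #|x|) uy) => x; exists x.
have := u0 x; rewrite /moment (bigD1 x) //= big1 ?addr0.
  by move=> e; rewrite e eqxx in ux.
move=> x' /andP[xx' x'x]; apply/eqP; apply: contraT => /xmax.
rewrite leqNgt => /negP; case; apply: proper_card.
by rewrite finset.properEneq eq_sym x'x.
Qed.

(** By [moment_inj] a word is determined by its moments, and only those of sets of size at least d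
    are free. *)
Lemma card_dual_words_setT d :
  (#|dual_words [set: {set K}] d| <= 2 ^ #|[set A : {set K} | (d <= #|A|)%N]|)%N.
Proof.
set S := [set A : {set K} | _].
have -> : (2 ^ #|S| = #|'F_2| ^ #|S|)%N by rewrite card_Fp.
rewrite -(card_pffun_on 0%R (mem S) (mem 'F_2)).
rewrite -(card_in_imset (f := fun u => [ffun A => moment u A])).
  apply/subset_leq_card/fintype.subsetP => _ /imsetP[u /dual_wordsP[_ um] ->].
  apply/pffun_onP; split; last by move=> a _.
  apply/fintype.subsetP => A; rewrite !inE ffunE; apply: contraNT.
  by rewrite -ltnNge => /um ->.
move=> u v _ _ /ffunP uv; apply/eqP; rewrite -subr_eq0; apply/eqP/moment_inj => A.
by rewrite momentB; have := uv A; rewrite !ffunE => ->; rewrite subrr.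
Qed.

Section Split.
Variables (i : K) (B : {set {set K}}).

Definition shadowU : {set {set K}} :=
  [set y : {set K} | (i \notin y) && ((y \in B) || (i |: y \in B))].
Definition shadowI : {set {set K}} :=
  [set y : {set K} | [&& i \notin y, y \in B & i |: y \in B]].

Lemma card_shadows : (#|shadowU| + #|shadowI| = #|B|)%N.
Proof.
rewrite -!sum1_card big_mkcond [X in (_ + X)%N]big_mkcond [RHS]big_mkcond /=.
rewrite -big_split /= [LHS](sum_set_split i) [RHS](sum_set_split i) /=.
apply: eq_bigr => y iy; rewrite !inE iy eqxx /= addn0.
by case: (y \in B); case: (i |: y \in B).
Qed.

Let fold_word u : {ffun {set K} -> 'F_2} :=
  [ffun y : {set K} => if i \in y then 0 else u y + u (i |: y)].

Let fold_wordB : {morph fold_word : u v / u - v}.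
Proof.
move=> u v; apply/ffunP => y; rewrite !ffunE; case: ifP => _; first by rewrite subrr.
by rewrite opprD addrACA.
Qed.
(* Sum over the two fibres of the projection along coordinate i: the image lives on
   the union of the two slices of B, the kernel on their intersection, where
   duality against x_i-multiples costs one degree. *)
Lemma card_dual_words_split d :
  (#|dual_words B d| <= #|dual_words shadowU d| * #|dual_words shadowI d.-1|)%N.
Proof.
have step := @card_subgroup_fibers _ _ _ _ fold_word
  (dual_words B d) (dual_words shadowU d) fold_wordB.
apply: leq_trans (step _ _) _.
- move=> u v /dual_wordsP[u1 u2] /dual_wordsP[v1 v2]; apply/dual_wordsP; split.
    by move=> y yB; rewrite !ffunE u1 // v1 // subr0.
  by move=> A Ad; rewrite momentB u2 // v2 // subr0.
- move=> u /dual_wordsP[u1 u2]; apply/dual_wordsP; split.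
    move=> y; rewrite inE negb_and negbK negb_or /= ffunE => /orP[->//|/andP[y1 y2]].
    by rewrite !u1 // addr0 if_same.
  move=> A Ad; case: (boolP (i \in A)) => iA.
    rewrite /moment big1 // => y /fintype.subsetP/(_ i iA) iy.
    by rewrite ffunE iy.
  rewrite -(u2 _ Ad) !(moment_split _ iA); apply: eq_bigr => y /andP[_ iy].
  by rewrite !ffunE (negbTE iy) !inE eqxx addr0.
rewrite leq_mul2l; apply/orP; right.
pose half u := [ffun y : {set K} => if i \in y then 0 else u y] : {ffun {set K} -> 'F_2}.
have kerP u : fold_word u == 0 -> forall y, u (i |: y) = u (y :\ i).
  move=> /eqP/ffunP fu y; have := fu (y :\ i); rewrite !ffunE !inE eqxx /=.
  rewrite setU1_setD1 => /eqP; rewrite addrC addr_eq0 => /eqP ->.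
  by apply/eqP; rewrite eq_sym -addr_eq0 addF2.
rewrite -(card_in_imset (f := half)).
  apply/subset_leq_card/fintype.subsetP => _ /imsetP[u uS ->].
  move: uS; rewrite inE => /andP[/dual_wordsP[u1 u2] /kerP fu].
  apply/dual_wordsP; split.
    move=> y; rewrite inE ffunE; case: ifP => //= /negbT iy; rewrite negb_and.
    move=> /orP[/u1//|/u1]; by rewrite fu setD1_id.
  move=> A Ad; case: (boolP (i \in A)) => iA.
    rewrite /moment big1 // => y /fintype.subsetP/(_ i iA) iy.
    by rewrite ffunE iy.
  (* A kernel word takes equal values on the two slices, so its moment at i |: A is the moment of
     one slice at A. Passing from A to i |: A costs one degree, hence d.-1. *)
  have Ad' : (#|i |: A| < d)%N.
    by rewrite cardsU1 iA add1n; case: (d) Ad => [|d'] //=; rewrite ltnS.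
  rewrite -(u2 _ Ad') /moment [LHS]big_mkcond [RHS]big_mkcond /=.
  rewrite [LHS](sum_set_split i) [RHS](sum_set_split i) /=.
  apply: eq_bigr => y iy; rewrite !ffunE (negbTE iy) !inE eqxx /= if_same addr0.
  have -> : (i |: A \subset y) = false.
    by apply/negP => /fintype.subsetP/(_ i); rewrite !inE eqxx (negbTE iy) => /(_ isT).
  have -> : (i |: A \subset i |: y) = (A \subset y).
    apply/fintype.subsetP/fintype.subsetP => h x; have := h x; rewrite !inE.
      move=> {}h xA; have := h; rewrite xA orbT => /(_ isT)/orP[/eqP xi|//].
      by rewrite -xi xA in iA.
    by case: (x == i) => //=.
  by rewrite fu setD1_id // add0r.
move=> u v; rewrite !inE => /andP[_ /kerP fu] /andP[_ /kerP fv] /ffunP uv.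
apply/ffunP => y; have := uv (y :\ i); rewrite !ffunE !inE eqxx /=.
case: (boolP (i \in y)) => iy; last by rewrite setD1_id.
by rewrite -fu -fv setU1_id.
Qed.
End Split.

(** The base case, once every coordinate has been split off: if d > 0 the moment at the empty set is
    the only value of the word and kills it. *)
Lemma dual_words_nil B d : B \subset [set finset.set0] ->
  (#|dual_words B d| <= 2 ^ ((d == 0%N) * #|B|))%N.
Proof.
move=> /fintype.subsetP B0.
have [->|Bn] := eqVneq B finset.set0.
  rewrite cards0 muln0 expn0; apply/card_le1_eqP => u v.
  move=> /dual_wordsP[u0 _] /dual_wordsP[v0 _]; apply/ffunP => y.
  by rewrite u0 ?inE // v0 ?inE.
have B1 : B = [set finset.set0].
  apply/setP => y; rewrite inE; apply/idP/idP => [/B0|/eqP ->]; first by rewrite inE.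
  by case/set0Pn: Bn => z zB; have := B0 _ zB; rewrite inE => /eqP <-.
have zero u : u \in dual_words B d -> forall y, y != finset.set0 -> u y = 0.
  by move=> /dual_wordsP[h _] y y0; apply: h; rewrite B1 inE.
rewrite B1 cards1 muln1; case: eqP => [_|/eqP d0].
  rewrite expn1 -[X in (_ <= X)%N](card_Fp (p := 2)) //.
  rewrite -(card_in_imset (f := fun u : {ffun {set K} -> 'F_2} => u finset.set0)).
    exact: max_card.
  move=> u v; rewrite -B1 => /zero u0 /zero v0 uv; apply/ffunP => y.
  by have [->//|y0] := eqVneq y finset.set0; rewrite u0 // v0.
rewrite expn0; apply/card_le1_eqP => u v; rewrite -B1 => uB vB.
have nul w : w \in dual_words B d -> w = 0.
  move=> wB; have w0 := zero _ wB; apply/ffunP => y; rewrite ffunE.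
  have [->|/w0//] := eqVneq y finset.set0.
  case/dual_wordsP: wB => _ /(_ finset.set0); rewrite cards0 lt0n d0 => /(_ isT).
  by rewrite /moment (bigD1 finset.set0) ?sub0set //= big1 ?addr0 // => y' /andP[_ /w0].
by rewrite (nul u) // (nul v).
Qed.
End Parities.

(** For fixed b, t^k - (t + b)^k is nonincreasing in t, and at t = b the claim is an equality. *)
Lemma powR_superadditive (R : realType) (k a b : R) : 1 <= k -> 0 <= b <= a ->
  a `^ k + (2 `^ k - 1) * b `^ k <= (a + b) `^ k.
Proof.
move=> k1 /andP[]; rewrite le_eqVlt => /orP[/eqP <- a0|b0 ba].
  by rewrite powR0 ?mulr0 ?addr0 // gt_eqF //; lra.
pose F (t : R) := t `^ k - (t + b) `^ k.
pose dF (t : R) := k * t `^ (k - 1) - k * (t + b) `^ (k - 1).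
have Fd x : b <= x <= a -> is_derive x 1 F (dF x).
  move=> /andP[bx xa]; have x0 : 0 < x by lra.
  have xb0 : 0 < x + b by lra.
  have d1 := is_derive1_powR k x0.
  have d2 := is_derive1_powR k xb0.
  have d3 : is_derive x 1 (fun t : R => t + b) 1.
    by apply: is_derive_eq; rewrite addr0.
  have d4 := @is_derive1_comp _ (@powR R ^~ k) (fun t : R => t + b) x _ _ d2 d3.
  rewrite /F /dF; apply: is_derive_eq; rewrite ?mulr1 //.
have : F a <= F b.
  apply: (is_derive_nincr Fd) => // x /andP[bx xa].
  rewrite /dF -mulrBr; apply: mulr_ge0_le0; first lra.
  rewrite subr_le0; apply: ge0_ler_powR; rewrite ?nnegrE; lra.
rewrite /F; have -> : b + b = 2 * b by ring.
have b0' := ltW b0; rewrite powRM //; lra.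
Qed.

(* The exponent k, close to 1, is tuned by [powR_superadditive] to make the bound stable
   under [card_dual_words_split]. *)
Lemma card_dual_words (R : realType) (K : finType) (k : R) (B : {set {set K}}) (d : nat) :
  1 <= k ->
  exists2 e : nat, (#|dual_words B d| <= 2 ^ e)%N &
     (2 `^ k - 1) ^+ d * e%:R <= #|B|%:R `^ k.
Proof.
move=> k1; set z := 2 `^ k - 1.
have z1 : 1 <= z.
  have : (2 : R) <= 2 `^ k by apply: le1r_powR => //; lra.
  by rewrite /z; lra.
have nat_pow (c : nat) : (c%:R : R) <= c%:R `^ k.
  case: c => [|c]; first by rewrite powR_ge0.
  by apply: le1r_powR => //; rewrite ler1n.
suff H l : uniq l -> (forall y, y \in B -> y \subset [set x in l]) ->
    exists2 e : nat, (#|dual_words B d| <= 2 ^ e)%N & z ^+ d * e%:R <= #|B|%:R `^ k.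
  apply: (H (enum K) (enum_uniq _)) => y _.
  by apply/fintype.subsetP => x _; rewrite inE mem_enum.
elim: l B d => [|i l IH] B d.
  move=> _ B0; exists ((d == 0%N) * #|B|)%N.
    apply: dual_words_nil; apply/fintype.subsetP => y /B0; rewrite inE.
    by rewrite (_ : [set x in [::]] = finset.set0) ?finset.subset0.
  by case: eqP => [->|_]; rewrite ?mul0n ?mulr0 ?powR_ge0 // mul1n expr0 mul1r.
rewrite cons_uniq => /andP[il ul] sub.
have shadow_sub (y : {set K}) : i \notin y -> (y \in B) || (i |: y \in B) -> y \subset [set x in l].
  move=> iy yB; have : y \subset [set x in i :: l].
    case/orP: yB => /sub // ; apply: fintype.subset_trans; exact: finset.subsetUr.
  move=> /fintype.subsetP h; apply/fintype.subsetP => x xy; have := h x xy.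
  by rewrite !inE => /orP[/eqP xi|//]; rewrite -xi xy in iy.
have subU y : y \in shadowU i B -> y \subset [set x in l].
  by rewrite inE => /andP[]; exact: shadow_sub.
have subI y : y \in shadowI i B -> y \subset [set x in l].
  by rewrite inE => /and3P[iy yB _]; apply: shadow_sub; rewrite ?yB.
have [e1 c1 b1] := IH (shadowU i B) d ul subU.
have [e2 c2 b2] := IH (shadowI i B) d.-1 ul subI.
exists (e1 + e2)%N.
  by apply: leq_trans (card_dual_words_split i B d) _; rewrite expnD leq_mul.
have IU : (#|shadowI i B| <= #|shadowU i B|)%N.
  apply: subset_leq_card; apply/fintype.subsetP => y; rewrite !inE.
  by move=> /and3P[-> ->].
have := powR_superadditive (a := #|shadowU i B|%:R) (b := #|shadowI i B|%:R) k1.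
rewrite ler0n ler_nat IU => /(_ isT).
rewrite -natrD card_shadows -/z; apply: le_trans.
rewrite natrD mulrDr; apply: lerD => //.
(* The degree lost on the intersection is paid by the factor z = 2^k - 1 of [powR_superadditive];
   for d = 0, where d.-1 = d, it is z >= 1 that serves. *)
apply: (@le_trans _ _ (z * (z ^+ d.-1 * e2%:R))).
  rewrite mulrA -exprS; apply: ler_wpM2r => //.
  by apply: ler_weXn2l => //; exact: leqSpred.
by apply: ler_wpM2l => //; lra.
Qed.

(** * Affine symmetries of Reed-Muller codes *)

Section DegreeClass.
Variable K : finType.
Implicit Types (g : {set K} -> 'F_2) (A y w L : {set K}) (k : K) (r : nat).

(** Positive powers of a coordinate coincide over F_2, so squarefree monomials, indexed by sets,
    suffice. *)
Definition deg_le r g := exists b : {set K} -> 'F_2,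
  forall y, g y = \sum_(A : {set K} | (#|A| <= r)%N) b A * (A \subset y)%:R.

Lemma deg_leD r g1 g2 : deg_le r g1 -> deg_le r g2 -> deg_le r (fun y => g1 y + g2 y).
Proof.
move=> [b1 e1] [b2 e2]; exists (fun A => b1 A + b2 A) => y.
by rewrite e1 e2 -big_split; apply: eq_bigr => A _; rewrite mulrDl.
Qed.

Lemma deg_leZ r a g : deg_le r g -> deg_le r (fun y => a * g y).
Proof.
move=> [b e]; exists (fun A => a * b A) => y.
by rewrite e mulr_sumr; apply: eq_bigr => A _; rewrite mulrA.
Qed.

Lemma deg_le_mono r A : (#|A| <= r)%N -> deg_le r (fun y => (A \subset y)%:R).
Proof.
move=> Ar; exists (fun A' => (A' == A)%:R) => y.
rewrite (bigD1 A) //= eqxx mul1r big1 ?addr0 // => A' /andP[_ /negbTE ->].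
by rewrite mul0r.
Qed.

Lemma eq_deg_le r g1 g2 : g1 =1 g2 -> deg_le r g1 -> deg_le r g2.
Proof. by move=> e [b eb]; exists b => y; rewrite -e. Qed.

Lemma deg_le_sum r (I : Type) (s : seq I) (P : pred I) (g : I -> {set K} -> 'F_2) :
  (forall i, P i -> deg_le r (g i)) -> deg_le r (fun y => \sum_(i <- s | P i) g i y).
Proof.
move=> gr; elim: s => [|i s IH].
  by exists (fun=> 0) => y; rewrite big_nil big1 // => A _; rewrite mul0r.
case: (boolP (P i)) => Pi.
  by apply: eq_deg_le (deg_leD (gr _ Pi) IH) => y; rewrite big_cons Pi.
by apply: eq_deg_le IH => y; rewrite big_cons (negbTE Pi).
Qed.

Lemma deg_leS r g : deg_le r g -> deg_le r.+1 g.
Proof.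
move=> [b e]; apply: (@eq_deg_le _ _ _ (fsym e)).
by apply: deg_le_sum => A Ar; apply/deg_leZ/deg_le_mono/leqW.
Qed.

Lemma deg_leMX r g k : deg_le r g -> deg_le r.+1 (fun y => g y * (k \in y)%:R).
Proof.
move=> [b e]; pose g' y := \sum_(A : {set K} | (#|A| <= r)%N) b A * (k |: A \subset y)%:R.
apply: (@eq_deg_le _ g').
  move=> y; rewrite e mulr_suml; apply: eq_bigr => A _.
  rewrite -mulrA; congr (_ * _).
  rewrite finset.subUset finset.sub1set; by case: (k \in y); rewrite /= ?mulr1 ?mulr0.
apply: deg_le_sum => A Ar; apply/deg_leZ/deg_le_mono.
by apply: leq_trans (leq_card_setU _ _) _; rewrite cards1.
Qed.

Definition affine g := exists c (a : K -> 'F_2),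
  forall y, g y = c + \sum_k a k * (k \in y)%:R.

Lemma deg_leM_affine r g h : deg_le r g -> affine h -> deg_le r.+1 (fun y => g y * h y).
Proof.
move=> gr [c [a e]].
apply: (@eq_deg_le _ (fun y => c * g y + \sum_k a k * (g y * (k \in y)%:R))).
  move=> y; rewrite e mulrDr mulrC mulr_sumr; congr (_ + _).
  by apply: eq_bigr => k _; ring.
apply: deg_leD; first exact/deg_leZ/deg_leS.
by apply: deg_le_sum => k _; apply/deg_leZ/deg_leMX.
Qed.

(** A monomial of size at most r becomes a product of as many affine functions, and each factor
    raises the degree by at most one. *)
Lemma deg_le_subst r g (s : {set K} -> {set K}) :
  (forall k, affine (fun y => (k \in s y)%:R)) -> deg_le r g -> deg_le r (g \o s).
Proof.
move=> s_aff [b e].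
apply: (@eq_deg_le _ (fun y => \sum_(A : {set K} | (#|A| <= r)%N) b A * (A \subset s y)%:R)).
  by move=> y; rewrite /= e.
apply: deg_le_sum => A Ar; apply: deg_leZ.
suff H l : deg_le (size l) (fun y => \prod_(k <- l) (k \in s y)%:R).
  have : deg_le #|A| (fun y => (A \subset s y)%:R).
    rewrite cardE; apply: eq_deg_le (H (enum A)) => y.
    rewrite big_enum /=; case: (boolP (A \subset s y)).
      by move=> /fintype.subsetP As; rewrite big1 // => k /As ->.
    by move=> /fintype.subsetPn[k kA ks]; rewrite (bigD1 k) //= (negbTE ks) mul0r.
  elim: r Ar {b e} => [|r IH]; first by rewrite leqn0 => /eqP ->.
  by rewrite leq_eqVlt => /orP[/eqP ->//|/IH h /h]; exact: deg_leS.
elim: l => [|k l IH].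
  apply: (@eq_deg_le _ (fun y => (finset.set0 \subset y)%:R)).
    by move=> y; rewrite big_nil finset.sub0set.
  by apply: deg_le_mono; rewrite cards0.
apply: eq_deg_le (deg_leM_affine IH (s_aff k)) => y.
by rewrite big_cons mulrC.
Qed.

Definition symdiff y w : {set K} := [set k | (k \in y) (+) (k \in w)].

Definition parity L y : 'F_2 := \sum_(k in L) (k \in y)%:R.

Lemma parity_symdiff L y w : parity L (symdiff y w) = parity L y + parity L w.
Proof.
rewrite /parity -big_split; apply: eq_bigr => k _; rewrite inE.
by case: (k \in y); case: (k \in w); rewrite /= ?addr0 ?add0r ?addF2.
Qed.

(* An affine involution of F_2^K whenever [c = 1] and [L] is empty (a translation)
   or [w] is in the kernel of the linear form [L] (a transvection). *)
Definition shear (c : 'F_2) L w y : {set K} :=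
  if c + parity L y == 1 then symdiff y w else y.

Lemma F2_cases (a : 'F_2) : a = 0 \/ a = 1.
Proof. by case: a => -[|[|//]] i; [left|right]; apply: val_inj. Qed.

Lemma shear_affine c L w k : affine (fun y => (k \in shear c L w y)%:R).
Proof.
exists (c * (k \in w)%:R), (fun j => (j == k)%:R + (j \in L)%:R * (k \in w)%:R) => y.
under eq_bigr do rewrite mulrDl.
rewrite big_split /= (bigD1 k) //= eqxx mul1r big1 ?addr0; last first.
  by move=> j /negbTE ->; rewrite mul0r.
have -> : \sum_j (j \in L)%:R * (k \in w)%:R * (j \in y)%:R = (k \in w)%:R * parity L y.
  rewrite /parity mulr_sumr [RHS]big_mkcond; apply: eq_bigr => j _.
  by case: (j \in L); rewrite ?mul0r // mul1r.
rewrite addrCA mulrC -mulrDr /shear.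
case: (F2_cases (c + parity L y)) => ->; rewrite ?eqxx ?mulr0 ?addr0 // mulr1 inE.
by case: (k \in y); case: (k \in w); rewrite /= ?addr0 ?add0r // addF2.
Qed.

Lemma shearK c L w : parity L w = 0 -> involutive (shear c L w).
Proof.
move=> Lw y; rewrite /shear.
have [e|/negbTE e] := boolP (c + parity L y == 1); last by rewrite e.
rewrite parity_symdiff Lw addr0 e.
by apply/setP => k; rewrite !inE -addbA addbb addbF.
Qed.

Lemma separating_parity y y' : y != finset.set0 -> y' != finset.set0 ->
  exists L, parity L y = 1 /\ parity L y' = 1.
Proof.
move=> /set0Pn[k ky] /set0Pn[k' ky'].
have p1 j z : parity [set j] z = (j \in z)%:R by rewrite /parity big_set1.
case: (boolP (k \in y')) => [h|h]; first by exists [set k]; rewrite !p1 ky h.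
case: (boolP (k' \in y)) => [h'|h']; first by exists [set k']; rewrite !p1 ky' h'.
have kk' : k != k' by apply: contraNneq h' => <-.
exists [set k; k']; rewrite /parity !big_setU1 ?inE // !big_set1.
by rewrite ky ky' (negbTE h) (negbTE h') /= addr0 add0r.
Qed.

Lemma affine_translation y y' : exists c L w,
  involutive (shear c L w) /\ shear c L w y = y'.
Proof.
exists 1, finset.set0, (symdiff y y').
have p0 z : parity finset.set0 z = 0 by rewrite /parity big_set0.
split; first exact/shearK.
rewrite /shear p0 addr0 eqxx; apply/setP => k; rewrite !inE.
by case: (k \in y); case: (k \in y').
Qed.

(** The map adds y + y' to z when L(z + x) = 1, for a form L equal to 1 at both y + x and y' + x. It
    fixes x, moves y to y', and is an involution because L(y + y') = 1 + 1 = 0. *)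
Lemma affine_two_transitive x y y' : y != x -> y' != x -> exists c L w,
  [/\ involutive (shear c L w), shear c L w x = x & shear c L w y = y'].
Proof.
move=> yx y'x.
have nz z : z != x -> symdiff z x != finset.set0.
  apply: contraNneq => e; apply/eqP/setP => k; have := congr1 (fun s : {set K} => k \in s) e.
  by rewrite !inE; case: (k \in z); case: (k \in x).
have [L [Ly Ly']] := separating_parity (nz _ yx) (nz _ y'x).
exists (parity L x), L, (symdiff y y'); split.
- apply: shearK; rewrite parity_symdiff.
  by move: Ly Ly'; rewrite !parity_symdiff => <- /addIr ->; exact: addF2.
- by rewrite /shear addF2 eq_sym oner_eq0.
rewrite /shear addrC -parity_symdiff Ly eqxx.
by apply/setP => k; rewrite !inE; case: (k \in y); case: (k \in y').
Qed.
End DegreeClass.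

Lemma binary_digits_inj (mu i j : nat) : (i < 2 ^ mu)%N -> (j < 2 ^ mu)%N ->
  (forall k, (k < mu)%N -> odd (i %/ 2 ^ k) = odd (j %/ 2 ^ k)) -> i = j.
Proof.
elim: mu i j => [|mu IH] i j.
  by rewrite expn0 !ltnS !leqn0 => /eqP -> /eqP ->.
move=> i_lt j_lt ij.
rewrite (divn_eq i 2) (divn_eq j 2) !modn2.
have := ij 0%N isT; rewrite expn0 !divn1 => ->.
congr (_ * 2 + _)%N; apply: IH => [||k km].
- by rewrite ltn_divLR // -expnSr.
- by rewrite ltn_divLR // -expnSr.
by rewrite -!divnMA -expnS; exact: ij.
Qed.

(** * Reed-Muller codes and their dual words in terms of sets *)

Section RMPoints.
Variable mu : nat.

Definition pt (i : 'I_(2 ^ mu)) : {set 'I_mu} := [set k : 'I_mu | odd (i %/ 2 ^ k)].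

Lemma pt_inj : injective pt.
Proof.
move=> i j /setP ij; apply/val_inj/(@binary_digits_inj mu) => //= k km.
by have := ij (Ordinal km); rewrite !inE.
Qed.

Lemma pt_bij : bijective pt.
Proof.
apply: (inj_card_bij pt_inj).
by rewrite -cardsT -finset.powersetT card_powerset cardsT !card_ord.
Qed.

(** The value of a monomial depends only on the support of its exponent vector, whose size is at
    most the degree; conversely a set is encoded by its 0/1 exponent vector. *)
Lemma RM_degP r (c : 'cV['F_2]_(2 ^ mu)) :
  RM r mu c <-> exists2 g, deg_le r g & forall i, c i 0 = g (pt i).
Proof.
pose supp (e : {ffun 'I_mu -> 'I_r.+1}) : {set 'I_mu} := [set k | (e k : nat) != 0%N].
have monoE (e : {ffun 'I_mu -> 'I_r.+1}) i :
    \prod_(k < mu) rm_point i k ^+ (e k : nat) = (supp e \subset pt i)%:R.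
  case: (boolP (supp e \subset pt i)).
    move=> /fintype.subsetP s; rewrite big1 // => k _.
    have [->|ek] := eqVneq (e k : nat) 0%N; first by rewrite expr0.
    by have := s k; rewrite !inE /rm_point => /(_ ek) ->; rewrite expr1n.
  move=> /fintype.subsetPn[k]; rewrite !inE => ek /negbTE ik.
  by rewrite (bigD1 k) //= /rm_point ik expr0n (negbTE ek) mul0r.
split.
  move=> [a ->]; exists (fun y : {set 'I_mu} => \sum_(e : {ffun 'I_mu -> 'I_r.+1} | (mdeg e <= r)%N)
      a e * (supp e \subset y)%:R); last first.
    by move=> i; rewrite mxE /poly_eval; apply: eq_bigr => e _; rewrite monoE.
  apply: deg_le_sum => e er; apply/deg_leZ/deg_le_mono.
  apply: leq_trans er; rewrite /mdeg -sum1_card big_mkcond; apply: leq_sum => k _.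
  by rewrite inE; case: (e k : nat).
move=> [g [b gE] cE].
(* [inord 1] is a true 1 only for r > 0; in [indE] this follows from a member of A together with
   #|A| <= r. *)
pose ind (A : {set 'I_mu}) : {ffun 'I_mu -> 'I_r.+1} :=
  [ffun k => if k \in A then inord 1 else ord0].
have indE (A : {set 'I_mu}) k : (#|A| <= r)%N -> (ind A k : nat) = (k \in A).
  rewrite ffunE; case: (boolP (k \in A)) => //= kA Ar; rewrite inordK // ltnS.
  by apply: leq_trans Ar; apply/card_gt0P; exists k.
exists [ffun e => \sum_(A : {set 'I_mu} | (#|A| <= r)%N && (ind A == e)) b A].
apply/colP => i; rewrite cE gE mxE /poly_eval.
rewrite (partition_big ind (fun e => mdeg e <= r)%N) /=; last first.
  move=> A Ar; apply: leq_trans (Ar); rewrite /mdeg -sum1_card [leqRHS]big_mkcond.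
  by apply: leq_sum => k _; rewrite indE //; case: (k \in A).
apply: eq_bigr => e er; rewrite monoE ffunE mulr_suml.
apply: eq_bigr => A /andP[Ar /eqP <-]; rewrite (_ : supp (ind A) = A) //.
by apply/setP => k; rewrite inE indE //; case: (k \in A).
Qed.
End RMPoints.

Section RMCode.
Variables (mu r m : nat) (H : 'M['F_2]_(m, 2 ^ mu)).
Hypothesis H_ker : forall c : 'cV['F_2]_(2 ^ mu), RM r mu c <-> H *m c = 0.
Hypothesis H_rank : \rank H = m.
Implicit Types (x y : 'I_(2 ^ mu)) (T : {set 'I_(2 ^ mu)}).

Lemma code_automorphism cc L w : involutive (@shear 'I_mu cc L w) ->
  exists s : 'I_(2 ^ mu) -> 'I_(2 ^ mu), [/\ involutive s,
    forall i, pt (s i) = shear cc L w (pt i) &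
    forall c : 'cV['F_2]_(2 ^ mu), H *m c = 0 -> H *m (\col_i c (s i) 0) = 0].
Proof.
move=> inv; have [g gK Kg] := pt_bij mu.
exists (fun i => g (shear cc L w (pt i))); split.
- by move=> i; rewrite Kg inv gK.
- by move=> i; rewrite Kg.
move=> c /H_ker/RM_degP[h hr hE]; apply/H_ker/RM_degP.
exists (h \o shear cc L w).
  by apply: deg_le_subst => // k; exact: shear_affine.
by move=> i; rewrite mxE hE Kg.
Qed.

(** With T read as the set of erased positions, bit x is recoverable from the other unerased ones.
    Removing x from T makes the event independent of whether x is in T. *)
Definition extrinsic_miss x T : bool := ~~ incl H (T :\ x) x.

Lemma extrinsic_missP x T : reflect (forall c : 'cV['F_2]_(2 ^ mu), H *m c = 0 ->
    (forall y, y != x -> y \notin T -> c y 0 = 0) -> c x 0 = 0) (extrinsic_miss x T).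
Proof.
have xT : x \notin T :\ x by rewrite !inE eqxx.
apply: (iffP idP) => [|h].
  move=> nin c c0 cT; case: (F2_cases (c x 0)) => // cx; case/negP: nin.
  apply/(incl_codewordP _ xT); exists c; split=> // y yx yT.
  by apply: cT => //; apply: contra yT; rewrite !inE yx.
apply/negP => /(incl_codewordP _ xT)[c [c0 cx cT]].
have := h c c0; rewrite cx => /(_ _)/eqP; rewrite oner_eq0 => h'.
suff : false by []. apply: h' => y yx yT; apply: cT => //.
by apply: contra yT; rewrite !inE => /andP[].
Qed.

Lemma extrinsic_miss_sym (s : 'I_(2 ^ mu) -> 'I_(2 ^ mu)) x T : involutive s ->
  (forall c : 'cV['F_2]_(2 ^ mu), H *m c = 0 -> H *m (\col_i c (s i) 0) = 0) ->
  extrinsic_miss (s x) T = extrinsic_miss x (s @^-1: T).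
Proof.
move=> sK sH; apply/extrinsic_missP/extrinsic_missP => h c c0 cT.
  have := h _ (sH _ c0); rewrite mxE sK; apply => y yx yT; rewrite mxE.
  apply: cT; first by apply: contraNneq yx => <-; rewrite sK.
  by rewrite inE sK.
have := h _ (sH _ c0); rewrite mxE; apply => y yx yT; rewrite mxE.
apply: cT; last by rewrite inE in yT.
by apply: contraNneq yx => /(can_inj sK) ->.
Qed.

Variable R : realType.

Definition miss x T : R := (extrinsic_miss x T)%:R.

Lemma expect_miss_const q x y : expect q (miss x) = expect q (miss y).
Proof.
have [cc [L [w [inv e]]]] := affine_translation (pt x) (pt y).
have [s [sK sP sH]] := code_automorphism inv.
have sx : s x = y by apply: (@pt_inj mu); rewrite sP.
rewrite -(expect_inj_invariant q (miss x) (can_inj sK)) -sx.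
by congr (expect _ _); apply/funext => T; rewrite /miss extrinsic_miss_sym.
Qed.

Lemma energy_miss_const q x y y' : y != x -> y' != x ->
  energy q y (miss x) = energy q y' (miss x).
Proof.
move=> yx y'x.
have ne z : z != x -> pt z != pt x by apply: contra_neq => /pt_inj.
have [cc [L [w [inv ex ey]]]] := affine_two_transitive (ne _ yx) (ne _ y'x).
have [s [sK sP sH]] := code_automorphism inv.
have sx : s x = x by apply: (@pt_inj mu); rewrite sP.
have sy : s y = y' by apply: (@pt_inj mu); rewrite sP.
have inva T : miss x (s @^-1: T) = miss x T by rewrite /miss -extrinsic_miss_sym ?sx.
have sU z T : z |: s @^-1: T = s @^-1: (s z |: T).
  by apply/setP => k; rewrite !inE (inj_eq (can_inj sK)).
have sD z T : (s @^-1: T) :\ z = s @^-1: (T :\ s z).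
  by apply/setP => k; rewrite !inE (inj_eq (can_inj sK)).
rewrite /energy -(expect_inj_invariant q _ (can_inj sK)).
congr (expect _ _); apply/funext => T.
by rewrite inva /avg sU sD !inva sy.
Qed.

Lemma energy_miss_self q x : energy q x (miss x) = 0.
Proof.
rewrite /energy -(expect_cst 'I_(2 ^ mu) q 0); congr (expect _ _); apply/funext => T.
rewrite /avg /miss /extrinsic_miss setD1_setU1 setD1_idem.
by rewrite -mulrDl (addrC q) subrK mul1r subrr expr0n.
Qed.

(** A word v H vanishing on T also vanishes at every column spanned by H_T, so it lives on
    [missing]; it is orthogonal to the code, so its moments up to degree r vanish; full row rank
    makes v |-> v H injective. *)
Lemma annihilator_dual_words T :
  (2 ^ (m - rk H T) <= #|dual_words (@pt mu @: missing H T) r.+1|)%N.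
Proof.
have -> : (2 ^ (m - rk H T) = #|'F_2| ^ (m - rk H T))%N by rewrite card_Fp.
have [g gK Kg] := pt_bij mu.
rewrite -card_annihilator.
pose u (v : 'rV['F_2]_m) : {ffun {set 'I_mu} -> 'F_2} := [ffun y => (v *m H) 0 (g y)].
rewrite -(card_in_imset (f := u)).
  apply/subset_leq_card/fintype.subsetP => _ /imsetP[v + ->].
  rewrite inE => /forall_inP vT; apply/dual_wordsP; split.
    move=> y yT; rewrite ffunE.
    have : incl H T (g y).
      apply: contraR yT => gy; apply/imsetP; exists (g y); rewrite ?Kg //.
      by rewrite inE.
    move=> /inclP[c c0 e].
    have -> : (v *m H) 0 (g y) = (v *m col (g y) H) 0 0.
      by rewrite !mxE; apply: eq_bigr => k _; rewrite !mxE.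
    rewrite e mulmxA mxE big1 // => z _.
    case: (boolP (z \in T)) => zT; first by rewrite (eqP (vT _ zT)) mul0r.
    by rewrite c0 // mulr0.
  move=> A Ar; pose c : 'cV['F_2]_(2 ^ mu) := \col_i (A \subset pt i)%:R.
  have c0 : H *m c = 0.
    apply/H_ker/RM_degP; exists (fun y : {set 'I_mu} => (A \subset y)%:R); first exact: deg_le_mono.
    by move=> i; rewrite mxE.
  have <- : (v *m H *m c) 0 0 = moment (u v) A.
    rewrite /moment mxE (reindex (@pt mu)) /=; last by exists g => x _; rewrite ?gK ?Kg.
    rewrite [RHS]big_mkcond; apply: eq_bigr => i _; rewrite !ffunE gK [c i 0]mxE.
    by case: (A \subset pt i); rewrite ?mulr1 ?mulr0.
  by rewrite -mulmxA c0 mulmx0 mxE.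
move=> v v' _ _ /ffunP uv; apply: (row_free_inj (A := H)).
  by rewrite /row_free H_rank.
by apply/rowP => i; have := uv (pt i); rewrite !ffunE gK.
Qed.

(** A generalized Hamming weight estimate: a space of dual words of large dimension has large
    support. *)
Lemma deficit_missing (k : R) T : 1 <= k ->
  (2 `^ k - 1) ^+ r.+1 * (m - rk H T)%:R <= #|missing H T|%:R `^ k.
Proof.
move=> k1; have [e e1 e2] := card_dual_words (@pt mu @: missing H T) r.+1 k1.
have z0 : 0 <= 2 `^ k - 1.
  by have : (2 : R) <= 2 `^ k by [apply: le1r_powR => //; lra]; lra.
rewrite -(card_imset _ (@pt_inj mu)); apply: le_trans e2.
apply: ler_wpM2l; first exact: exprn_ge0.
by rewrite ler_nat -(leq_exp2l (m := 2)) //; apply: leq_trans e1; exact: annihilator_dual_words.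
Qed.

(** At T empty every dual word is counted, and such words have at most as many free moments as there
    are sets of size above r. It provides m / n <= 1 - rate for the area bound. *)
Lemma codim_le : (m + \sum_(i < r.+1) 'C(mu, i) <= 2 ^ mu)%N.
Proof.
have -> : (\sum_(i < r.+1) 'C(mu, i) = #|[set A : {set 'I_mu} | (#|A| <= r)%N]|)%N.
  rewrite -sum1_card (partition_big (fun A : {set 'I_mu} => inord #|A| : 'I_r.+1) predT) //=.
  apply: eq_bigr => i _; rewrite -[X in 'C(X, _)]card_ord -card_draws -sum1_card.
  apply: eq_bigl => A; rewrite !inE; apply/eqP/andP => [Ai|[Ar /eqP <-]].
    by rewrite Ai -ltnS ltn_ord; split=> //; apply/eqP/val_inj; rewrite /= inordK.
  by rewrite inordK.
have : (m <= #|[set A : {set 'I_mu} | (r < #|A|)%N]|)%N.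
  rewrite -(leq_exp2l (m := 2)) //; apply: leq_trans (card_dual_words_setT _ _).
  have := annihilator_dual_words finset.set0; rewrite rk0 subn0 => /leq_trans; apply.
  apply/subset_leq_card/fintype.subsetP => u /dual_wordsP[_ h].
  by apply/dual_wordsP; split=> // y; rewrite inE.
rewrite -(leq_add2r #|[set A : {set 'I_mu} | (#|A| <= r)%N]|) => /leq_trans; apply.
have <- : #|{set 'I_mu}| = (2 ^ mu)%N.
  by rewrite -cardsT -finset.powersetT card_powerset cardsT card_ord.
rewrite -cardsUI (_ : _ :&: _ = finset.set0) ?cards0 ?addn0 ?max_card //.
by apply/setP => A; rewrite !inE; case: ltnP.
Qed.
End RMCode.

(** * Sharp threshold for a single coordinate *)

Lemma expR_beats_power (R : realType) (a C : R) : 0 < a ->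
  exists M : nat, forall mu : nat, (M <= mu)%N -> C * mu%:R ^+ 4 < expR (a * mu%:R).
Proof.
(* 120 is 5!: the degree-five term of the exponential series alone beats C mu^4 once mu >= 120 C /
   a^5. *)
move=> a0; pose b := C * 120 / a ^+ 5.
have [M bM] : exists M : nat, b <= M%:R.
  by exists (Num.truncn b).+1; rewrite ltW // truncnS_gt.
exists M => mu Mmu; have bmu : b <= mu%:R by apply: le_trans bM _; rewrite ler_nat.
have amu : 0 <= a * mu%:R by rewrite mulr_ge0 // ltW.
apply: lt_le_trans (expR_ge1Dxn 4 amu).
apply: (@le_lt_trans _ _ ((a * mu%:R) ^+ 5 / (5 `!)%:R)); last by rewrite ltrDr.
rewrite (_ : (5 `!)%:R = 120 :> R) // exprMn.
rewrite ler_pdivlMr //.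
have a5 : 0 < a ^+ 5 by rewrite exprn_gt0.
have := bmu; rewrite /b ler_pdivrMr // => h.
have m4 : 0 <= mu%:R ^+ 4 :> R by rewrite exprn_ge0.
have := ler_wpM2r m4 h.
have -> : mu%:R * a ^+ 5 * mu%:R ^+ 4 = a ^+ 5 * mu%:R ^+ 5 :> R by ring.
by have -> : C * 120 * mu%:R ^+ 4 = C * mu%:R ^+ 4 * 120 :> R by ring.
Qed.

Lemma expect1 (R : realType) (X : finType) (g : {set X} -> R) :
  expect 1 g = g [set: X].
Proof.
suff H l T : pexp 1 l g T = g (T :|: [set x in l]).
  rewrite /expect H; congr g; apply/setP => x; by rewrite !inE mem_enum.
elim: l T => [|i l IH] T.
  by congr g; apply/setP => x; rewrite !inE orbF.
rewrite pexp_cons /avg subrr mul0r addr0 mul1r IH; congr g.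
by apply/setP => x; rewrite !inE; case: (x == i); rewrite ?orbT.
Qed.

Section RMThreshold.
Variables (R : realType) (mu r m : nat) (H : 'M['F_2]_(m, 2 ^ mu)).
Hypothesis H_ker : forall c : 'cV['F_2]_(2 ^ mu), RM r mu c <-> H *m c = 0.
Hypothesis H_rank : \rank H = m.
Implicit Types (x y : 'I_(2 ^ mu)) (T : {set 'I_(2 ^ mu)}) (q : R).

Let n : R := (2 ^ mu)%:R.
Let x0 : 'I_(2 ^ mu) := Ordinal (expn_gt0 2 mu).
Let h q := expect q (miss H R x0).
Definition deficit T : R := (m - rk H T)%:R.

Lemma miss01 x T : miss H R x T = 0 \/ miss H R x T = 1.
Proof. by rewrite /miss; case: extrinsic_miss; [right|left]. Qed.

Lemma dcoord_miss i x T : dcoord i (miss H R x) T = 0 \/ dcoord i (miss H R x) T = -1.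
Proof.
rewrite /dcoord /miss /extrinsic_miss.
have : incl H ((T :\ i) :\ x) x -> incl H ((i |: T) :\ x) x.
  apply: inclS; apply/fintype.subsetP => y; rewrite !inE.
  by case: (y == x); case: (y == i).
case: (incl H (T :\ i :\ x) x) => [->//|_]; rewrite /= ?subrr; first by left.
by case: incl; rewrite /= ?sub0r ?subrr; [right|left].
Qed.

Lemma energy_miss q i x :
  energy q i (miss H R x) = - (q * (1 - q)) * expect q (dcoord i (miss H R x)).
Proof.
rewrite energyE mulNr -mulrN; congr (_ * _).
rewrite -mulN1r -expectZ; congr (expect _ _); apply/funext => T.
by case: (dcoord_miss i x T) => ->; ring.
Qed.

(** For a decreasing indicator each discrete derivative is minus its square, so Russo's sum is minus
    the total energy over q (1 - q). *)
Lemma miss_deriv q : 0 < q < 1 ->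
  is_derive q 1 h (- ((\sum_i energy q i (miss H R x0)) / (q * (1 - q)))).
Proof.
move=> /andP[q0 q1]; have := Russo (miss H R x0) q.
suff -> : - ((\sum_i energy q i (miss H R x0)) / (q * (1 - q))) =
    \sum_i expect q (dcoord i (miss H R x0)) by [].
rewrite mulr_suml -sumrN; apply: eq_bigr => i _; rewrite energy_miss.
by field; rewrite ?gt_eqF ?mulr_gt0 ?subr_gt0 //=.
Qed.

Lemma miss_nincr q q' : 0 < q -> q <= q' -> q' < 1 -> h q' <= h q.
Proof.
move=> q0 qq' q1.
apply: (@is_derive_nincr _ h
  (fun t => - ((\sum_i energy t i (miss H R x0)) / (t * (1 - t)))) q q') => //.
  by move=> t /andP[qt tq']; apply: miss_deriv; apply/andP; split; lra.
move=> t /andP[qt tq']; rewrite oppr_le0 divr_ge0 //; last by apply: mulr_ge0; lra.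
by apply: sumr_ge0 => i _; apply: energy_ge0; apply/andP; split; lra.
Qed.

(** Membership of x in T is independent of the extrinsic event and h is the same at all points, so
    the left side is the mean number of coloops of T. *)
Lemma miss_area q : 0 <= q <= 1 -> q * n * h q <= m%:R.
Proof.
move=> q01.
have -> : q * n * h q = expect q (fun T => \sum_x (x \in T)%:R * miss H R x T).
  rewrite expect_sum.
  transitivity (\sum_(x : 'I_(2 ^ mu)) q * h q).
    by rewrite sumr_const card_ord -[RHS]mulr_natl /n; ring.
  apply: eq_bigr => x _; rewrite /h (expect_miss_const H_ker q x0 x).
  rewrite -expectZ -(expect_avg q x (fun T => (x \in T)%:R * miss H R x T)); congr (expect _ _).
  apply/funext => T; rewrite /avg !inE eqxx /= mul1r mul0r mulr0 addr0.
  by rewrite /miss /extrinsic_miss setD1_setU1.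
rewrite -(expect_cst 'I_(2 ^ mu) q m%:R); apply: le_expect => // T.
have := leq_trans (coloops_le H T) (rk_le H T); rewrite -(ler_nat R); apply: le_trans.
rewrite -sum1_card natr_sum [leRHS]big_mkcond; apply: ler_sum => x _.
by rewrite !inE /miss /extrinsic_miss; case: (x \in T); case: incl; rewrite /= ?mulr1 ?mulr0 ?mul1r.
Qed.

Lemma deficit_le_miss q : 0 <= q <= 1 -> expect q deficit <= n * h q.
Proof.
move=> q01.
have -> : n * h q = expect q (fun T => \sum_x miss H R x T).
  rewrite expect_sum /n [LHS]mulr_natl; transitivity (\sum_(x : 'I_(2 ^ mu)) h q).
    by rewrite sumr_const card_ord.
  by apply: eq_bigr => x _; rewrite /h (expect_miss_const H_ker q x0 x).
apply: le_expect => // T; rewrite /deficit.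
have := rank_le_missing H T; rewrite H_rank -leq_subLR -(ler_nat R) => /le_trans; apply.
rewrite -sum1_card natr_sum [leLHS]big_mkcond; apply: ler_sum => x _.
rewrite inE /miss /extrinsic_miss; case: (boolP (incl H T x)) => //= xT.
case: (boolP (incl H (T :\ x) x)) => // /(inclS (T' := T)) hx.
case/negP: xT; apply: hx; exact: subsetDl.
Qed.

(* By double transitivity all coordinates but x0 have the same energy w; either w is
   polynomially small and ln w provides the logarithm, or the total energy is huge. *)
Lemma miss_KKL k q : (2 <= 2 ^ mu)%N -> 0 < k -> k <= q -> k <= 1 - q ->
  ln (n - 1) / 2 * (h q * (1 - h q)) <= (2 / k + 4) * \sum_i energy q i (miss H R x0).
Proof.
move=> n2 k0 kq kq'.
have q01 : 0 <= q <= 1 by apply/andP; split; lra.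
set J := \sum_i _; set L := ln (n - 1) / 2.
have n1 : 1 <= n - 1.
  have : (2%:R : R) <= n by rewrite /n ler_nat.
  by lra.
have L0 : 0 <= L by rewrite /L divr_ge0 // ln_ge0.
have h0 : 0 <= h q by apply: expect_ge0 => // T; case: (miss01 x0 T) => ->.
have h1 : h q <= 1.
  rewrite -(expect_cst 'I_(2 ^ mu) q 1); apply: le_expect => // T.
  by case: (miss01 x0 T) => ->.
have kk : 0 <= 2 / k by rewrite divr_ge0 // ltW.
have [x1 x1n] : exists x1, x1 != x0.
  by exists (Ordinal n2).
set w := energy q x1 (miss H R x0).
have w0 : 0 <= w by apply: energy_ge0.
have Jw : J = (n - 1) * w.
  rewrite /J (bigD1 x0) //= energy_miss_self add0r.
  rewrite (eq_bigr (fun=> w)); last by move=> y yx; exact: (energy_miss_const H_ker).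
  rewrite sumr_const -[in LHS]mulr_natl; congr (_ * _).
  rewrite cardC1 card_ord /n -subn1 natrB //.
  by apply: leq_trans n2.
have V : expect q (fun T => miss H R x0 T ^+ 2) - expect q (miss H R x0) ^+ 2 = h q * (1 - h q).
  rewrite (_ : (fun T => _) = miss H R x0); first by rewrite -/(h q); ring.
  by apply/funext => T; case: (miss01 x0 T) => ->; rewrite ?expr1n ?expr0n.
have V0 : 0 <= h q * (1 - h q) by apply: mulr_ge0; lra.
have wle (w' : R) i : w <= w' -> energy q i (miss H R x0) <= w'.
  move=> ww'; have [->|ix] := eqVneq i x0; last by rewrite (energy_miss_const H_ker q ix x1n).
  by rewrite energy_miss_self (le_trans w0).
have KK (w' : R) : 0 < w' -> w <= w' -> (2 - ln w') * (h q * (1 - h q)) <= (2 / k + 4) * J.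
  move=> w'0 ww'; rewrite -V; apply: KKL_energy => //; first exact: miss01.
  by move=> i; exact: wle.
(* The threshold is (n - 1)^(-1/2): below it -ln supplies L; above it the total energy (n - 1) w
   exceeds (n - 1)^(1/2) = exp(L) >= L. *)
have [wL|wL] := leP w (expR (- L)).
  have := KK _ (expR_gt0 _) wL; rewrite expRK; apply: le_trans.
  by apply: ler_wpM2r => //; lra.
have JL : L <= J.
  rewrite Jw; apply: (@le_trans _ _ (expR L)).
    by have := expR_ge1Dx L; lra.
  have -> : n - 1 = expR (L + L).
    by rewrite /L -splitr lnK // posrE; lra.
  have -> : expR L = expR (L + L) * expR (- L) by rewrite -expRD; congr expR; ring.
  by apply: ler_wpM2l; [exact: expR_ge0|exact: ltW].
have VL : h q * (1 - h q) <= 1.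
  by rewrite -[leRHS]mulr1; apply: ler_pM => //; lra.
apply: (@le_trans _ _ L); first by rewrite -[leRHS]mulr1; exact: ler_wpM2l.
apply: le_trans JL _; have J0 : 0 <= J by rewrite Jw; apply: mulr_ge0 => //; lra.
by rewrite -[leLHS]mul1r; apply: ler_wpM2r => //; lra.
Qed.
End RMThreshold.

(** * The rank deficit of a random set of columns *)

Section RMDeficit.
Variables (R : realType) (mu r m : nat) (H : 'M['F_2]_(m, 2 ^ mu)).
Hypothesis H_ker : forall c : 'cV['F_2]_(2 ^ mu), RM r mu c <-> H *m c = 0.
Hypothesis H_rank : \rank H = m.
Implicit Types (T : {set 'I_(2 ^ mu)}) (q : R).

Let n : R := (2 ^ mu)%:R.
Let x0 : 'I_(2 ^ mu) := Ordinal (expn_gt0 2 mu).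
Let h q := expect q (miss H R x0).

(** As h is nonincreasing, 1 - h >= eta persists after q0, so [miss_KKL] becomes h' <= -A h. *)
Lemma miss_decay k eta q0 q1 : (2 <= 2 ^ mu)%N -> 0 < k -> k <= q0 -> q0 <= q1 ->
  k <= 1 - q1 -> 0 <= eta -> h q0 <= 1 - eta ->
  h q1 <= expR (- (ln (n - 1) / 2 * eta / (2 / k + 4) * (q1 - q0))).
Proof.
move=> n2 k0 kq0 q01 kq1 eta0 h0.
have C0 : 0 < 2 / k + 4 by have := divr_gt0 (ltr0n R 2) k0; lra.
set A := ln (n - 1) / 2 * eta / (2 / k + 4).
have hpos q : 0 <= q <= 1 -> 0 <= h q.
  by move=> q01'; apply: expect_ge0 => // T; case: (miss01 R H x0 T) => ->.
have n1 : 1 <= n - 1.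
  have : (2%:R : R) <= n by rewrite /n ler_nat.
  by lra.
have dh s : q0 <= s <= q1 ->
    is_derive s 1 h (- ((\sum_i energy s i (miss H R x0)) / (s * (1 - s)))).
  by move=> /andP[a b]; apply: miss_deriv; apply/andP; split; lra.
have := @Gronwall R h _ q0 q1 A 0 q01 dh.
rewrite !subr0 => /(_ _)/le_trans; apply.
- move=> x /andP[a b]; rewrite subr0.
  set J := \sum_i _.
  have xx : 0 < x * (1 - x) by apply: mulr_gt0; lra.
  have J0 : 0 <= J.
    by apply: sumr_ge0 => i _; apply: energy_ge0; apply/andP; split; lra.
  have JJ : J <= J / (x * (1 - x)).
    by rewrite ler_pdivlMr // -[leRHS]mulr1; apply: ler_wpM2l => //; nra.
  rewrite mulNr lerN2; apply: le_trans JJ.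
  have := @miss_KKL R mu r m H H_ker k x n2 k0 ltac:(lra) ltac:(lra).
  rewrite -/n -/J -/x0 -/(h x) => KK.
  rewrite -(ler_pM2l C0); apply: le_trans KK.
  have -> : (2 / k + 4) * (A * h x) = ln (n - 1) / 2 * (h x * eta).
    by rewrite /A; field; rewrite gt_eqF //= gt_eqF //; lra.
  apply: ler_wpM2l; first by rewrite divr_ge0 // ln_ge0.
  apply: ler_wpM2l; first by apply: hpos; apply/andP; split; lra.
  have : h x <= h q0 by apply: (@miss_nincr R mu m H); lra.
  by lra.
- rewrite -[leRHS]mulr1; apply: ler_wpM2l; first exact: expR_ge0.
  by apply: le_trans h0 _; lra.
Qed.

Lemma dcoord_deficit i T :
  dcoord i (deficit R H) T = - (i \in missing H (T :\ i))%:R.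
Proof.
rewrite /dcoord /deficit -setU1_setD1 rkU1 /missing inE.
have := rk_le H (i |: (T :\ i)); rewrite rkU1.
case: (incl H (T :\ i) i) => /= rm; first by rewrite addn0 subrr oppr0.
rewrite addn1 in rm *; rewrite subnS -subn1 natrB ?subn_gt0 //.
ring.
Qed.

(** Exponential Markov inequality; one column changes the rank by at most one. *)
Lemma deficit_tail q (t K : R) : 0 <= q <= 1 -> 0 <= t <= 2^-1 ->
  expect q (fun T => (K < deficit R H T)%R%:R) <=
  expR (t * (expect q (deficit R H) - K) + n * (2 * t ^+ 2)).
Proof.
move=> q01 t01.
have lip i T : `|dcoord i (deficit R H) T| <= 1.
  by rewrite dcoord_deficit normrN normr_nat lern1 leq_b1.
have := @pexp_exp_Lipschitz R _ q q01 (enum 'I_(2 ^ mu)) (deficit R H) finset.set0 t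
  t01 lip (enum_uniq _).
rewrite -cardE card_ord -/n => dev.
apply: (@le_trans _ _ (expect q (fun T => expR (- (t * K)) * expR (t * deficit R H T)))).
  apply: le_expect => // T; rewrite -expRD.
  case: ltP => [KD|_]; last exact: expR_ge0.
  apply: le_trans (expR_ge1Dx _); rewrite lerDl.
  by have : 0 <= t * (deficit R H T - K); [apply: mulr_ge0; lra|lra].
rewrite expectZ; apply: le_trans (ler_wpM2l (expR_ge0 _) dev) _.
by rewrite -expRD; rewrite ler_expR /expect; lra.
Qed.

(* The expansion is only available below K, hence the differential inequality is
   integrated for the truncation min(deficit, K). *)
Lemma truncated_deficit_decay q1 q2 (A K p : R) : 0 < q1 -> q1 <= q2 -> q2 < 1 ->
  0 <= A -> 0 <= K -> 0 <= p ->
  (forall T, deficit R H T <= K -> A * deficit R H T <= #|missing H T|%:R) ->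
  (forall q, q1 <= q <= q2 -> expect q (fun T => (K < deficit R H T)%R%:R) <= p) ->
  expect q2 (deficit R H) <= n * p + K * p + K * expR (- (A * (q2 - q1))).
Proof.
move=> q10 q12 q21 A0 K0 p0 expand tail.
pose g T := Num.min (deficit R H T) K.
have D0 T : 0 <= deficit R H T by rewrite /deficit ler0n.
have Dn T : deficit R H T <= n.
  rewrite /deficit /n ler_nat; apply: leq_trans (leq_subr _ _) _.
  by rewrite -H_rank rank_leq_col.
have g0 T : 0 <= g T by rewrite le_min D0.
(* A missing column lowers the deficit by exactly one, hence the minimum too when the deficit is at
   most K; above K it is only known that the minimum does not grow. *)
have dg T : \sum_i dcoord i g T <= - (#|missing H T|%:R * (deficit R H T <= K)%R%:R).
  rewrite -sum1_card natr_sum mulr_suml -sumrN [leRHS]big_mkcond.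
  apply: ler_sum => i _; rewrite /g /dcoord.
  have := dcoord_deficit i T; rewrite /dcoord => dD.
  case: ifP => iT; last first.
    rewrite subr_le0; have : deficit R H (i |: T) <= deficit R H (T :\ i).
      by rewrite -subr_le0 dD oppr_le0 ler0n.
    by move=> dd; rewrite le_min !ge_min dd lexx orbT.
  have niT : i \notin T by apply: contraL iT => /incl_mem iT'; rewrite inE iT'.
  have {}dD : deficit R H (i |: T) - deficit R H T = -1.
    by move: dD; rewrite (setD1_id niT) iT.
  rewrite mul1r (setD1_id niT).
  have -> : deficit R H (i |: T) = deficit R H T - 1 by lra.
  case: (leP (deficit R H T) K) => KD; rewrite ?mulr1n ?mulr0n.
    by rewrite (min_idPl _); lra.
  by rewrite oppr0 subr_le0 ge_min lexx orbT.
have G q : is_derive q 1 (fun t => expect t g) (\sum_i expect q (dcoord i g)) by exact: Russo.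
have gK : expect q1 g <= K.
  rewrite -(expect_cst 'I_(2 ^ mu) q1 K); apply: le_expect => [|T].
    by apply/andP; split; lra.
  by rewrite ge_min lexx orbT.
have bound : expect q2 g <= K * p + K * expR (- (A * (q2 - q1))).
  have dec s : q1 <= s <= q2 -> \sum_i expect s (dcoord i g) <= - A * (expect s g - K * p).
    move=> sq; have s01 : 0 <= s <= 1 by case/andP: sq => *; apply/andP; split; lra.
    rewrite -expect_sum.
    (* Where the deficit exceeds K no expansion is available; there g = K, and the first term
       cancels A g, at a mean cost of A K p. *)
    apply: (@le_trans _ _ (expect s (fun T => A * K * (K < deficit R H T)%R%:R - A * g T))).
      apply: le_expect => // T; apply: le_trans (dg T) _.
      have := expand T; rewrite /g; case: leP => KD /=.
        by rewrite mulr0 mulr1 sub0r lerN2; apply.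
      by rewrite mulr0 mulr1 oppr0 subrr.
    rewrite expectB !expectZ.
    have := ler_wpM2l (mulr_ge0 A0 K0) (tail s sq); lra.
  have := @Gronwall R (fun t => expect t g) _ q1 q2 A (K * p) q12 (fun s _ => G s) dec.
  rewrite lerBlDl => /le_trans; apply; rewrite lerD2l mulrC.
  apply: ler_wpM2r; first exact: expR_ge0.
  by have := mulr_ge0 K0 p0; lra.
have q2q : q1 <= q2 <= q2 by rewrite q12 lexx.
have q201 : 0 <= q2 <= 1 by apply/andP; split; lra.
have n0 : 0 <= n by rewrite /n ler0n.
rewrite -addrA; apply: le_trans (lerD (ler_wpM2l n0 (tail _ q2q)) bound).
rewrite -expectZ -expectD; apply: le_expect => // T; rewrite /g.
case: leP => KD; rewrite /= ?mulr0 ?mulr1 ?add0r.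
  by [].
by have := Dn T; lra.
Qed.

(** Use [deficit_missing] with exponent 1 + l, l = log2 w, so that 2^(1+l) - 1 = 2w - 1. If fewer
    than A D columns were missing, D being the deficit, then (2w - 1)^(r+1) <= A^(1+l) D^l <=
    A^(1+l) K^l. *)
Lemma missing_expansion (w A K : R) T : 1 < w -> 1 <= A -> 0 < K ->
  A `^ (1 + ln w / ln 2) * K `^ (ln w / ln 2) < (2 * w - 1) ^+ r.+1 ->
  deficit R H T <= K -> A * deficit R H T <= #|missing H T|%:R.
Proof.
move=> w1 A1 K0 AK DK; rewrite leNgt; apply/negP => small.
set l := ln w / ln 2 in AK.
have ln20 : 0 < ln 2 :> R by rewrite ln_gt0 // ltr1n.
have l0 : 0 <= l by apply: divr_ge0; [apply: ln_ge0|]; exact: ltW.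
have zE : 2 `^ (1 + l) = 2 * w.
  rewrite powRD; last by rewrite (gt_eqF (ltr0n R 2)) implybT.
  rewrite powRr1 // /l; congr (_ * _).
  by rewrite /powR (gt_eqF (ltr0n R 2)) divfK ?gt_eqF // lnK // posrE; lra.
have := @deficit_missing mu r m H H_ker H_rank R (1 + l) T _.
rewrite lerDl zE -/(deficit R H T) => /(_ l0) dm.
have D0 : 0 < deficit R H T.
  have : 0 <= deficit R H T by rewrite /deficit ler0n.
  rewrite le_eqVlt => /orP[/eqP e|//]; move: small; rewrite -e mulr0.
  by rewrite ltNge ler0n.
have l1 : 0 <= 1 + l by lra.
have AD : #|missing H T|%:R `^ (1 + l) <= (A * deficit R H T) `^ (1 + l).
  apply: ge0_ler_powR => //; rewrite ?nnegrE ?ler0n ?(ltW small) //.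
  by rewrite mulr_ge0 // ltW //; lra.
have := le_trans dm AD; rewrite powRM ?(ltW D0) //; last lra.
rewrite (powRD (x := deficit R H T)); last by rewrite (gt_eqF D0) implybT.
rewrite powRr1 ?(ltW D0) //.
have -> (a b c : R) : a * (b * c) = (a * c) * b by ring.
rewrite ler_pM2r // leNgt => /negP; apply; apply: le_lt_trans AK.
apply: ler_wpM2l; first exact: powR_ge0.
by apply: ge0_ler_powR => //; rewrite nnegrE ltW.
Qed.
End RMDeficit.

(** A Chernoff bound: weight the binomial of index i <= r by z^(r-i) >= 1 and complete to the full
    binomial sum. It is used backwards, to see that a rate bounded below forces z^r to be large. *)
Lemma RM_rate_le (R : realType) (r mu : nat) (z rho : R) : 1 <= z ->
  rho <= RM_rate r mu -> rho * 2 ^+ mu <= z ^+ r * (1 + z^-1) ^+ mu.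
Proof.
move=> z1; rewrite /RM_rate ler_pdivlMr ?ltr0n ?expn_gt0 // natrX => /le_trans; apply.
have z0 : 0 < z by lra.
rewrite exprDn mulr_sumr natr_sum.
under [leRHS]eq_bigr do rewrite expr1n mul1r.
have F0 (i : nat) : 0 <= z ^+ r * (z^-1 ^+ i *+ 'C(mu, i)).
  by rewrite mulr_ge0 ?mulrn_wge0 // ?exprn_ge0 ?invr_ge0 // ltW.
have F1 (i : nat) : (i <= r)%N -> 'C(mu, i)%:R <= z ^+ r * (z^-1 ^+ i *+ 'C(mu, i)).
  move=> ir; rewrite -[in leRHS]mulr_natr mulrA -[leLHS]mul1r; apply: ler_wpM2r => //.
  rewrite -{1}(subnK ir) exprD -mulrA -exprMn divff ?gt_eqF // expr1n mulr1.
  exact: exprn_ege1.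
rewrite (big_ord_widen _ (fun i => 'C(mu, i)%:R) (leq_addr mu r.+1)).
rewrite (big_ord_widen (r.+1 + mu) (fun i => z ^+ r * (z^-1 ^+ i *+ 'C(mu, i)))); last first.
  by rewrite addSn ltnS leq_addl.
rewrite [leLHS]big_mkcond [leRHS]big_mkcond; apply: ler_sum => i _ /=.
case: (ltnP i r.+1) => ir; case: (ltnP i mu.+1) => im //; first exact: F1.
by rewrite bin_small.
Qed.

(** Two terms of order c^2 compete: 2 ln(1+c) - ln(1+2c) is at most c^2/(1+2c), while c ln(1+c) is
    at least c^2/(1+c), which is larger. *)
Lemma ln_gap (R : realType) (c : R) : 0 < c ->
  0 < ln (1 + 2 * c) - (2 - c) * ln (1 + c).
Proof.
move=> c0.
have w0 : 0 < 1 + c by lra.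
have z0 : 0 < 1 + 2 * c by lra.
have h1 : 2 * ln (1 + c) - ln (1 + 2 * c) <= c ^+ 2 / (1 + 2 * c).
  have -> : 2 * ln (1 + c) = ln ((1 + c) ^+ 2) by rewrite lnXn // mulr_natl.
  rewrite -ln_div ?posrE ?exprn_gt0 //.
  apply: le_trans (ln_le_sub1 _) _; first by rewrite divr_gt0 ?exprn_gt0.
  rewrite le_eqVlt; apply/orP; left; apply/eqP; field; rewrite gt_eqF //.
have h2 : c / (1 + c) <= ln (1 + c).
  rewrite -lerN2 -lnV ?posrE //.
  apply: le_trans (ln_le_sub1 _) _; first by rewrite invr_gt0.
  rewrite le_eqVlt; apply/orP; left; apply/eqP; field; rewrite gt_eqF //.
have h3 := ler_wpM2l (ltW c0) h2.
have h4 : c ^+ 2 / (1 + 2 * c) < c * (c / (1 + c)).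
  rewrite mulrA -expr2 ltr_pM2l ?exprn_gt0 // ltf_pV2 ?posrE //; lra.
lra.
Qed.

(** * Asymptotics of the expected deficit *)

Section DeficitAsymptotics.
Variables (R : realType) (mu r m : nat) (H : 'M['F_2]_(m, 2 ^ mu)).
Hypothesis H_ker : forall c : 'cV['F_2]_(2 ^ mu), RM r mu c <-> H *m c = 0.
Hypothesis H_rank : \rank H = m.
Hypothesis mu2 : (2 <= mu)%N.
Implicit Types (c eps rho q : R).

(** The logarithm of the length n, so that n^(1-c) is [expR ((1 - c) * x)]. *)
Let x : R := mu%:R * ln 2.
Let i0 : 'I_(2 ^ mu) := Ordinal (expn_gt0 2 mu).

Let ln2_gt0 : 0 < ln 2 :> R.
Proof. by rewrite ln_gt0 // ltr1n. Qed.
Let mu_ge2 : 2 <= mu%:R :> R.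
Proof. by rewrite ler_nat. Qed.
Let x_ge : 2 * ln 2 <= x.
Proof. by apply: ler_wpM2r => //; exact: ltW. Qed.
Let nE : (2 ^ mu)%:R = expR x.
Proof. by rewrite /x expRM_natl lnK ?posrE // natrX. Qed.
Let n_ge2 : (2 <= 2 ^ mu)%N.
Proof. by rewrite -{1}(expn1 2) leq_exp2l // ltnW. Qed.

Lemma ln_length_ge : x / 2 <= ln ((2 ^ mu)%:R - 1).
Proof.
have y2 : 2 <= expR (x / 2).
  apply: (@le_trans _ _ (expR (ln 2))); first by rewrite lnK ?posrE.
  by rewrite ler_expR; have := x_ge; lra.
have en : expR (x / 2) <= (2 ^ mu)%:R - 1.
  have -> : (2 ^ mu)%:R = expR (x / 2) * expR (x / 2) by rewrite nE -expRD -splitr.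
  by have := ler_wpM2r (expR_ge0 (x / 2)) y2; lra.
rewrite -[leLHS]expRK ler_ln ?posrE ?expR_gt0 //.
by apply: lt_le_trans en; exact: expR_gt0.
Qed.

Lemma miss_le_area rho q : 0 < q <= 1 -> rho <= RM_rate r mu ->
  expect q (miss H R i0) <= (1 - rho) / q.
Proof.
move=> /andP[q0 q1] rate.
have n0 : 0 < (2 ^ mu)%:R :> R by rewrite nE expR_gt0.
have qI : 0 <= q <= 1 by rewrite ltW.
have area := @miss_area R mu r m H H_ker q qI.
have mn : m%:R <= (1 - rho) * (2 ^ mu)%:R.
  have : (m + \sum_(i < r.+1) 'C(mu, i))%:R <= (2 ^ mu)%:R :> R.
    by rewrite ler_nat; exact: codim_le.
  by move: rate; rewrite /RM_rate ler_pdivlMr // natrD; lra.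
rewrite ler_pdivlMr // -(ler_pM2r n0); apply: le_trans mn.
by rewrite (mulrC _ q) mulrAC.
Qed.

Lemma miss_small (k eta q0 q1 : R) : 0 < k -> k <= q0 -> q0 <= q1 -> k <= 1 - q1 ->
  0 <= eta -> expect q0 (miss H R i0) <= 1 - eta ->
  expect q1 (miss H R i0) <= expR (- (eta * (q1 - q0) / (4 * (2 / k + 4)) * x)).
Proof.
move=> k0 kq0 q01 kq1 eta0 h0.
apply: le_trans (miss_decay H_ker n_ge2 k0 kq0 q01 kq1 eta0 h0) _.
rewrite ler_expR lerN2; have := ln_length_ge; set L := ln _ => xL.
have C0 : 0 < 2 / k + 4 by have := divr_gt0 (ltr0n R 2) k0; lra.
have q010 : 0 <= q1 - q0 by lra.
move: (q1 - q0) q010 (2 / k + 4) C0 => d d0 C C0.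
have -> : L / 2 * eta / C * d = eta * d / (2 * C) * L by field; rewrite gt_eqF.
have -> : eta * d / (4 * C) * x = eta * d / (2 * C) * (x / 2) by field; rewrite gt_eqF.
apply: ler_wpM2l => //; apply: divr_ge0; first exact: mulr_ge0.
by rewrite mulr_ge0 // ltW.
Qed.

Lemma deficit_tail_small c q : 0 <= c <= 1 / 16 -> 0 <= q <= 1 ->
  expect q (deficit R H) <= expR ((1 - c) * x) ->
  expect q (fun T => (2 * expR ((1 - c) * x) < deficit R H T)%R%:R)
    <= expR (- (expR (x / 2) / 8)).
Proof.
move=> /andP[c0 c1] qI ED.
have x0 : 0 <= x by have := x_ge; have := ln2_gt0; lra.
(* With t = n^(-c)/4 the exponent is at most -t n^(1-c) + 2 n t^2 = -n^(1-2c)/8, and 1 - 2c >=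
   1/2. *)
pose t : R := expR (- (c * x)) / 4.
have tI : 0 <= t <= 2^-1.
  have cx0 : 0 <= c * x by rewrite mulr_ge0.
  have : expR (- (c * x)) <= 1 by rewrite -[leRHS]expR0 ler_expR; lra.
  by have := expR_ge0 (- (c * x)); rewrite /t => ? ?; apply/andP; split; lra.
apply: le_trans (@deficit_tail R mu m H q t _ qI tI) _.
rewrite ler_expR nE.
set E := expR ((1 - 2 * c) * x).
have e1 : t * expR ((1 - c) * x) = E / 4.
  by rewrite /t mulrAC -expRD; congr (expR _ / _); ring.
have e2 : expR x * (2 * t ^+ 2) = E / 8.
  have -> : E = expR x * (expR (- (c * x)) * expR (- (c * x))).
    by rewrite -!expRD; congr expR; ring.
  by rewrite /t; field.
have e3 : expR (x / 2) <= E.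
  by rewrite ler_expR mulrC; apply: ler_wpM2r => //; lra.
case/andP: tI => t0 _.
have := ler_wpM2l t0 ED; rewrite e1 e2 mulrBr.
have -> : t * (2 * expR ((1 - c) * x)) = 2 * (t * expR ((1 - c) * x)) by ring.
by rewrite e1; lra.
Qed.

(** [missing_expansion] with w = 1 + c and z = 2w - 1 = 1 + 2c. The rate gives z^r >= rho (z/w)^mu,
    while K^l = w w^((1-c) mu); the quotient grows with the exponent of [ln_gap]. *)
Lemma missing_expansion_asymptotic c rho T : 0 < c <= 1 / 16 -> 0 < rho ->
  rho <= RM_rate r mu ->
  (1 + c) / rho * mu%:R ^+ 4 < expR ((ln (1 + 2 * c) - (2 - c) * ln (1 + c)) * mu%:R) ->
  deficit R H T <= 2 * expR ((1 - c) * x) ->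
  mu%:R ^+ 2 * deficit R H T <= #|missing H T|%:R.
Proof.
move=> /andP[c0 c1] rho0 rate large.
have w1 : 1 < 1 + c by lra.
have z1 : 1 <= 1 + 2 * c by lra.
have zE : 2 * (1 + c) - 1 = 1 + 2 * c by ring.
have zwE : 1 + (1 + 2 * c)^-1 = 2 * ((1 + c) / (1 + 2 * c)) by field; lra.
have w2 : 1 + c <= 2 by lra.
move: (1 + c) (1 + 2 * c) w1 z1 zE zwE w2 large => w z w1 z1 zE zwE w2 large.
have w0 : 0 < w by lra.
have z0 : 0 < z by lra.
have K0 : 0 < 2 * expR ((1 - c) * x) by rewrite mulr_gt0 // expR_gt0.
have A1 : 1 <= mu%:R ^+ 2 :> R by apply: exprn_ege1; have := mu_ge2; lra.
apply: (@missing_expansion R mu r m H H_ker H_rank w) => //.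
rewrite zE.
have lnw0 : 0 < ln w by rewrite ln_gt0.
have lnw1 : ln w <= ln 2 by rewrite ler_ln ?posrE.
set l := ln w / ln 2.
have l1 : l <= 1 by rewrite /l ler_pdivrMr // mul1r.
(* The expansion factor mu^2 is raised to a power at most 2, whence mu^4 in the growth condition. *)
have a1 : (mu%:R ^+ 2) `^ (1 + l) <= mu%:R ^+ 4 :> R.
  have -> : mu%:R ^+ 4 = (mu%:R ^+ 2) `^ 2 :> R.
    by rewrite powR_mulrn ?exprn_ge0 // -exprM.
  by apply: ler_powR => //; lra.
have a2 : (2 * expR ((1 - c) * x)) `^ l = w * expR ((1 - c) * mu%:R * ln w).
  rewrite /powR gt_eqF // lnM ?posrE ?expR_gt0 // expRK /l.
  have -> : ln w / ln 2 * (ln 2 + (1 - c) * x) = ln w + (1 - c) * mu%:R * ln w.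
    by rewrite /x; field; rewrite gt_eqF.
  by rewrite expRD lnK.
have a3 : rho * expR (mu%:R * (ln z - ln w)) <= z ^+ r.
  have := RM_rate_le z1 rate; rewrite zwE exprMn mulrCA [X in X <= _]mulrC.
  rewrite ler_pM2l ?exprn_gt0 //.
  have -> : w / z = expR (ln w - ln z) by rewrite expRB !lnK.
  rewrite -expRM_natl => rz.
  have : rho * expR (mu%:R * (ln z - ln w)) <=
     (z ^+ r * expR (mu%:R * (ln w - ln z))) * expR (mu%:R * (ln z - ln w)).
    by apply: ler_wpM2r => //; exact: expR_ge0.
  rewrite -mulrA -expRD.
  have -> : mu%:R * (ln w - ln z) + mu%:R * (ln z - ln w) = 0 by ring.
  by rewrite expR0 mulr1.
apply: (@lt_le_trans _ _ (z ^+ r)); last by apply: ler_weXn2l.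
apply: lt_le_trans a3; rewrite a2.
apply: le_lt_trans (_ : mu%:R ^+ 4 * (w * expR ((1 - c) * mu%:R * ln w)) < _).
  by apply: ler_wpM2r => //; rewrite mulr_ge0 ?expR_ge0 // ltW.
have -> : mu%:R * (ln z - ln w) =
   (ln z - (2 - c) * ln w) * mu%:R + (1 - c) * mu%:R * ln w by ring.
rewrite expRD !mulrA ltr_pM2r ?expR_gt0 // -ltr_pdivrMl //.
suff -> : rho^-1 * (mu%:R ^+ 4 * w) = w / rho * mu%:R ^+ 4 by [].
ring.
Qed.

Lemma deficit_bound c rho q1 q : 0 < c <= 1 / 16 -> 0 < rho -> rho <= RM_rate r mu ->
  0 < q1 -> q1 <= q -> q < 1 ->
  expect q1 (miss H R i0) <= expR (- (c * x)) ->
  (1 + c) / rho * mu%:R ^+ 4 < expR ((ln (1 + 2 * c) - (2 - c) * ln (1 + c)) * mu%:R) ->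
  expect q (deficit R H) <=
    3 * expR mu%:R * expR (- (expR (x / 2) / 8)) +
    2 * expR mu%:R * expR (- (mu%:R ^+ 2 * (q - q1))).
Proof.
move=> cI rho0 rate q10 q1q q_lt h1 large.
have /andP[c0 c1] := cI.
have x0 : 0 <= x by have := x_ge; have := ln2_gt0; lra.
have xmu : x <= mu%:R.
  have l1 : ln 2 <= 1 :> R by have := ln_le_sub1 (ltr0n R 2); lra.
  by rewrite /x -[leRHS]mulr1; apply: ler_wpM2l.
set p := expR (- (expR (x / 2) / 8)).
have p0 : 0 <= p by exact: expR_ge0.
set K := 2 * expR ((1 - c) * x).
have K0 : 0 <= K by rewrite mulr_ge0 ?expR_ge0.
have tail s : q1 <= s <= q -> expect s (fun T => (K < deficit R H T)%R%:R) <= p.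
  move=> /andP[s1 s2]; have sI : 0 <= s <= 1 by apply/andP; split; lra.
  apply: deficit_tail_small => //; first by rewrite ltW.
  apply: le_trans (deficit_le_miss H_ker H_rank sI) _.
  have -> : (1 - c) * x = x + - (c * x) by ring.
  rewrite expRD nE; apply: ler_wpM2l; first exact: expR_ge0.
  by apply: le_trans h1; apply: (@miss_nincr R mu m H); lra.
have expansion T : deficit R H T <= K -> mu%:R ^+ 2 * deficit R H T <= #|missing H T|%:R.
  exact: (missing_expansion_asymptotic cI rho0 rate large).
have A0 : 0 <= mu%:R ^+ 2 :> R by rewrite exprn_ge0.
apply: le_trans (truncated_deficit_decay H_rank q10 q1q q_lt A0 K0 p0 expansion tail) _.
(* Bounding n by exp(mu) and K by 2 exp(mu) gives the constants 3 = 1 + 2 and 2. *)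
rewrite nE; have Kn : K <= 2 * expR mu%:R.
  rewrite /K; apply: ler_wpM2l => //; rewrite ler_expR; apply: le_trans xmu.
  by rewrite -[leRHS]mul1r; apply: ler_wpM2r => //; lra.
have nn : expR x <= expR mu%:R by rewrite ler_expR.
have b1 := ler_wpM2r p0 nn.
have b2 := ler_wpM2r p0 Kn.
have b3 := ler_wpM2r (expR_ge0 (- (mu%:R ^+ 2 * (q - q1)))) Kn.
move: (expR x) (expR mu%:R) (expR (- (mu%:R ^+ 2 * _))) K p b1 b2 b3 {K0 p0 tail expansion Kn nn}.
by move=> a b d K p b1 b2 b3; lra.
Qed.
End DeficitAsymptotics.

Lemma expected_deficit_small (R : realType) (rho q e : R) :
  0 < rho < 1 -> 1 - rho < q < 1 -> 0 < e ->
  exists M : nat, forall (mu r m : nat) (H : 'M['F_2]_(m, 2 ^ mu)),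
    (M <= mu)%N -> \rank H = m ->
    (forall c : 'cV['F_2]_(2 ^ mu), RM r mu c <-> H *m c = 0) ->
    rho <= RM_rate r mu ->
    expect q (deficit R H) <= e.
Proof.
move=> /andP[rho0 rho1] /andP[q_gt q_lt] e0.
(* q0 is the midpoint of 1 - rho and q, and q1 that of q0 and q. *)
have [q0 [q1 [eps [rq0 q00 q10 qq1 [eps0 eps1]]]]] : exists q0 q1 eps : R,
    [/\ 1 - rho < q0, 0 < q0, q1 - q0 = eps, q - q1 = eps & 0 < eps /\ eps <= 1].
  exists ((1 - rho + q) / 2), (((1 - rho + q) / 2 + q) / 2), ((q - (1 - rho)) / 4).
  by split; [lra|lra|lra|lra|split; lra].
have [k [k0 kq0 kq]] : exists k : R, [/\ 0 < k, k <= q0 & k <= 1 - q].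
  exists (Num.min q0 (1 - q)); split; rewrite ?ge_min ?lexx ?orbT // lt_min q00; lra.
have [eta [etaE eta0 eta1]] : exists eta : R, [/\ (1 - rho) / q0 = 1 - eta, 0 < eta & eta <= 1].
  have pos : 0 < (1 - rho) / q0 by rewrite divr_gt0 //; lra.
  have lt1 : (1 - rho) / q0 < 1 by rewrite ltr_pdivrMr // mul1r.
  by exists (1 - (1 - rho) / q0); split; lra.
(* The decay exponent of [miss_small] from q0 to q1; it is at most 1/16 since eta, eps <= 1 and 2/k
   + 4 >= 4. *)
have [c [cE c0 c1]] : exists c : R,
    [/\ c = eta * eps / (4 * (2 / k + 4)), 0 < c & c <= 1 / 16].
  exists (eta * eps / (4 * (2 / k + 4))).
  have C4 : 4 <= 2 / k + 4 by have := divr_gt0 (ltr0n R 2) k0; lra.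
  move: (2 / k + 4) C4 => C C4; split=> //.
    by rewrite divr_gt0 ?mulr_gt0 //; lra.
  rewrite ler_pdivrMr ?mulr_gt0 //; last lra.
  apply: (@le_trans _ _ 1); last lra.
  by rewrite -[leRHS]mulr1; apply: ler_pM => //; exact: ltW.
have ln22 : 0 < ln 2 / 2 :> R by rewrite divr_gt0 // ln_gt0 // ltr1n.
(* M1 gives the expansion, M2 makes n^(1/2)/8 exceed 2 mu, and mu > 2/eps makes mu^2 eps exceed 2
   mu. Both terms of [deficit_bound] are then multiples of exp(-mu), with total 5 exp(-mu), which M3
   brings below e. *)
have [M1 HM1] := expR_beats_power ((1 + c) / rho) (ln_gap c0).
have [M2 HM2] := expR_beats_power 16 ln22.
have [M3 HM3] := expR_beats_power (5 / e) (@ltr01 R).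
exists (maxn M1 (maxn M2 (maxn M3 (maxn (Num.truncn (2 / eps)).+1 2)))) => mu r m H.
rewrite !geq_max => /and5P[/HM1 {}HM1 /HM2 {}HM2 /HM3 {}HM3 m4 mu2] H_rank H_ker rate.
have mu4 : 2 / eps < mu%:R by apply: lt_le_trans (truncnS_gt _) _; rewrite ler_nat.
have mu1 : 1 <= mu%:R :> R by rewrite ler1n ltnW.
have mu14 : mu%:R <= mu%:R ^+ 4 :> R by rewrite -{1}[mu%:R]expr1; apply: ler_weXn2l.
have q0I : 0 < q0 <= 1 by apply/andP; split; lra.
have h0 := miss_le_area H_ker H_rank q0I rate; rewrite etaE in h0.
have q01 : q0 <= q1 by lra.
have kq1 : k <= 1 - q1 by lra.
have h1 := miss_small H_ker mu2 k0 kq0 q01 kq1 (ltW eta0) h0.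
rewrite q10 -cE in h1.
have cI : 0 < c <= 1 / 16 by rewrite c0.
have q1_gt0 : 0 < q1 by lra.
have q1q : q1 <= q by lra.
apply: le_trans (deficit_bound H_ker H_rank mu2 cI rho0 rate q1_gt0 q1q q_lt h1 HM1) _.
rewrite qq1.
have pn : expR mu%:R * expR (- (expR (mu%:R * ln 2 / 2) / 8)) <= expR (- mu%:R) :> R.
  rewrite -expRD ler_expR; move: HM2.
  rewrite (_ : ln 2 / 2 * mu%:R = mu%:R * ln 2 / 2 :> R); last by field.
  by move: (expR _) => y; lra.
have an : expR mu%:R * expR (- (mu%:R ^+ 2 * eps)) <= expR (- mu%:R) :> R.
  rewrite -expRD ler_expR; move: mu4; rewrite ltr_pdivrMr // => mu4.
  have := ler_wpM2l (ler0n R mu) (ltW mu4); rewrite expr2; lra.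
have fin : 5 * expR (- mu%:R) <= e.
  move: HM3; rewrite mul1r => HM3.
  rewrite expRN ler_pdivrMr ?expR_gt0 // mulrC -ler_pdivrMr //.
  apply: le_trans (ltW HM3); rewrite -[leLHS]mulr1; apply: ler_wpM2l.
    by apply: divr_ge0 => //; exact: ltW.
  exact: le_trans mu14.
apply: le_trans fin; move: pn an; rewrite -!mulrA.
by move: (_ * _ : R) (expR mu%:R * expR (- (mu%:R ^+ 2 * eps))) (expR (- mu%:R)) => a b d; lra.
Qed.

(** * Two-point inequalities *)

Section TwoPoint.
Variable R : realType.
Implicit Types (t s theta lam x y : R).

(** Once negative, the derivative stays nonpositive, so F rises and then falls and is smallest at an
    endpoint. A negative value at t would yield, by the mean value theorem, c < t < d with dF c < 0
    < dF d. *)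
Lemma mvt_rise_fall (F dF : R -> R) : 0 <= F 0 -> 0 <= F 1 ->
  (forall t, 0 <= t <= 1 -> is_derive t 1 F (dF t)) ->
  (forall c d, 0 < c -> c < d -> d < 1 -> dF c < 0 -> dF d <= 0) ->
  forall t, 0 <= t <= 1 -> 0 <= F t.
Proof.
move=> F0 F1 Fd sgn t /andP[t0 t1]; rewrite leNgt; apply/negP => Ft.
have t_gt0 : 0 < t.
  by rewrite lt_neqAle t0 andbT; apply: contraTneq Ft => <-; rewrite -leNgt.
have t_lt1 : t < 1.
  by rewrite lt_neqAle t1 andbT; apply: contraTneq Ft => ->; rewrite -leNgt.
have cont a b : 0 <= a -> b <= 1 -> {within `[a, b], continuous F}%classic.
  move=> a0 b1; apply: derivable_within_continuous => x; rewrite in_itv /= => /andP[ax xb].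
  by have xI : 0 <= x <= 1 by [apply/andP; split; lra]; case: (Fd x xI).
have [c] := @MVT _ F dF 0 t t_gt0
  (fun x hx => Fd x ltac:(move: hx; rewrite in_itv /= => /andP[? ?]; apply/andP; split; lra))
  (cont 0 t (lexx 0) t1).
rewrite in_itv /= => /andP[c0 ct] ec.
have [d] := @MVT _ F dF t 1 t_lt1
  (fun x hx => Fd x ltac:(move: hx; rewrite in_itv /= => /andP[? ?]; apply/andP; split; lra))
  (cont t 1 t0 (lexx 1)).
rewrite in_itv /= => /andP[dt d1] ed.
have cd : c < d by lra.
have dc : dF c < 0.
  have : dF c * (t - 0) < 0 by lra.
  by rewrite subr0 pmulr_llt0.
have := sgn c d c0 cd d1 dc.
have : 0 < dF d * (1 - t) by lra.
rewrite pmulr_lgt0; [lra|by rewrite subr_gt0].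
Qed.

Lemma is_derive_ln1D t : 0 < 1 + t -> is_derive t 1 (fun x : R => ln (1 + x)) (1 + t)^-1.
Proof.
move=> t0; have d1 := is_derive1_ln t0.
have d2 : is_derive t 1 (fun x : R => 1 + x) 1 by apply: is_derive_eq; ring.
by have := @is_derive1_comp _ (@ln R) (fun x : R => 1 + x) t _ _ d1 d2; rewrite mulr1.
Qed.

Lemma is_derive_ln1B t : 0 < 1 - t -> is_derive t 1 (fun x : R => ln (1 - x)) (- (1 - t)^-1).
Proof.
move=> t0; have d1 := is_derive1_ln t0.
have d2 : is_derive t 1 (fun x : R => 1 - x) (-1) by apply: is_derive_eq; ring.
by have := @is_derive1_comp _ (@ln R) (fun x : R => 1 - x) t _ _ d1 d2; rewrite mulrN1.
Qed.

(** The concave function (1 + t)^lam lies above its chord on [0, 1]. *)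
Lemma two_point_power_one theta lam t : 0 <= lam <= 1 -> 1 + theta = expR (lam * ln 2) ->
  0 <= t <= 1 -> 1 + theta * t <= expR (lam * ln (1 + t)).
Proof.
move=> /andP[l0 l1] e tI; rewrite -subr_ge0.
pose F t := expR (lam * ln (1 + t)) - (1 + theta * t).
pose dF t := lam / (1 + t) * expR (lam * ln (1 + t)) - theta.
rewrite -/(F t); apply: (@mvt_rise_fall F dF) => //.
- by rewrite /F addr0 ln1 mulr0 expR0 mulr0 addr0 subrr.
- by rewrite /F mulr1 e subrr.
- move=> s /andP[s0 s1].
  have s1' : 0 < 1 + s by lra.
  have d3 := is_derive_ln1D s1'.
  rewrite /F /dF; apply: is_derive_eq.
  rewrite /GRing.scale /=; ring.
move=> c d c0 cd d1; rewrite /dF => h; suff : lam / (1 + d) * expR (lam * ln (1 + d)) <=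
   lam / (1 + c) * expR (lam * ln (1 + c)) by lra.
rewrite -!mulrA; apply: ler_wpM2l => //.
have c1 : 0 < 1 + c by lra.
have d1' : 0 < 1 + d by lra.
have inv x : 0 < x -> x^-1 * expR (lam * ln x) = expR (- ((1 - lam) * ln x)).
  move=> x0.
  have -> : x^-1 = expR (- ln x) by rewrite expRN lnK ?posrE.
  by rewrite -expRD; congr expR; ring.
rewrite !inv // ler_expR lerN2; apply: ler_wpM2l; first lra.
by rewrite ler_ln ?posrE //; lra.
Qed.

(** The divergence in nats of a bit with probabilities (1 + t)/2 and (1 - t)/2 from a fair one. *)
Definition entropy2 t := ((1 + t) * ln (1 + t) + (1 - t) * ln (1 - t)) / 2.

Lemma entropy2_deriv t : -1 < t -> t < 1 ->
  is_derive t 1 entropy2 ((ln (1 + t) - ln (1 - t)) / 2).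
Proof.
move=> t0 t1.
have p0 : 0 < 1 + t by lra.
have p1 : 0 < 1 - t by lra.
have d3 := is_derive_ln1D p0; have e3 := is_derive_ln1B p1.
rewrite /entropy2; apply: is_derive_eq.
rewrite /GRing.scale /=; field.
by apply/andP; split; rewrite gt_eqF.
Qed.

(** The second derivative 1/(1 - s^2) is nondecreasing, hence smaller at theta s than at s;
    integrate twice from 0, where both sides and their derivatives vanish. *)
Lemma entropy2_scale_lt theta t : 0 <= theta <= 1 -> 0 <= t < 1 ->
  entropy2 (theta * t) <= theta ^+ 2 * entropy2 t.
Proof.
move=> /andP[h0 h1] /andP[t0 t1].
pose at2 s : R := ln (1 + s) - ln (1 - s).
have dat s : 0 <= s <= t -> is_derive s 1 at2 (2 / (1 - s ^+ 2)).
  move=> /andP[s0 st].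
  have p0 : 0 < 1 + s by lra.
  have p1 : 0 < 1 - s by lra.
  have d3 := is_derive_ln1D p0; have e3 := is_derive_ln1B p1.
  rewrite /at2; apply: is_derive_eq.
  by field; rewrite !gt_eqF //= (_ : 1 - s ^+ 2 = (1 + s) * (1 - s)); [rewrite mulr_gt0|ring].
have scaleD s : is_derive s 1 (fun x : R => theta * x) theta.
  by apply: is_derive_eq; rewrite /GRing.scale /= mulr1.
have hs s : 0 <= s <= t -> 0 <= theta * s <= s.
  move=> /andP[s0 st]; apply/andP; split; first exact: mulr_ge0.
  by rewrite -[leRHS]mul1r; apply: ler_wpM2r.
have at2_le s : 0 <= s <= t -> at2 (theta * s) <= theta * at2 s.
  move=> sI; have /andP[s0 st] := sI.
  pose F x := at2 (theta * x) - theta * at2 x.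
  pose dF x := 2 / (1 - (theta * x) ^+ 2) * theta - theta * (2 / (1 - x ^+ 2)).
  have Fd x : 0 <= x <= t -> is_derive x 1 F (dF x).
    move=> xI; have /andP[x0 xt] := xI; have /andP[hx0 hx1] := hs x xI.
    have d1 := dat x xI; have hxI : 0 <= theta * x <= t by apply/andP; split; lra.
    have d2 := @is_derive1_comp _ at2 (fun x : R => theta * x) x _ _ (dat _ hxI) (scaleD x).
    by rewrite /F /dF; apply: is_derive_eq.
  have : F s <= F 0.
    apply: (is_derive_nincr Fd) => // x xI; have /andP[x0 xt] := xI.
    have /andP[hx0 hx1] := hs x xI.
    rewrite /dF [X in _ - X]mulrC -mulrBl; apply: mulr_le0_ge0 => //.
    rewrite subr_le0 ler_pM2l // lef_pV2 ?posrE; last 2 first.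
    - have : theta * x < 1 by lra.
      by move=> ?; nra.
    - by nra.
    by rewrite lerB // ler_sqr ?nnegrE.
  by rewrite /F mulr0 /at2 addr0 subr0 ln1; lra.
pose F x := entropy2 (theta * x) - theta ^+ 2 * entropy2 x.
pose dF x := at2 (theta * x) / 2 * theta - theta ^+ 2 * (at2 x / 2).
have Fd x : 0 <= x <= t -> is_derive x 1 F (dF x).
  move=> xI; have /andP[x0 xt] := xI; have /andP[hx0 hx1] := hs x xI.
  have d1 : is_derive x 1 entropy2 (at2 x / 2) by apply: entropy2_deriv; lra.
  have d0 : is_derive (theta * x) 1 entropy2 (at2 (theta * x) / 2).
    by apply: entropy2_deriv; lra.
  have d2 := @is_derive1_comp _ entropy2 (fun x : R => theta * x) x _ _ d0 (scaleD x).
  by rewrite /F /dF; apply: is_derive_eq.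
have : F t <= F 0.
  apply: (is_derive_nincr Fd) => // x xI; rewrite /dF.
  have := ler_wpM2l h0 (at2_le x xI); rewrite expr2; lra.
by rewrite /F mulr0 /entropy2 addr0 subr0 ln1; lra.
Qed.

Lemma entropy2_le t : 0 <= t <= 1 -> entropy2 t <= ln 2.
Proof.
move=> /andP[t0 t1]; have l2 : 0 <= ln 2 :> R by rewrite ln_ge0 // ler1n.
have H s : 0 <= s <= 2 -> s * ln s <= s * ln 2.
  move=> /andP[]; rewrite le_eqVlt => /orP[/eqP <- _|s0 s2]; first by rewrite !mul0r.
  by rewrite ler_pM2l // ler_ln ?posrE.
have h1 := H (1 + t) ltac:(apply/andP; split; lra).
have h2 := H (1 - t) ltac:(apply/andP; split; lra).
rewrite /entropy2; lra.
Qed.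

Lemma entropy2_1 : entropy2 1 = ln 2.
Proof. by rewrite /entropy2 subrr mul0r addr0 mulrAC divff ?mul1r. Qed.

Lemma entropy2_scale theta t : 0 <= theta <= 1 -> 0 <= t <= 1 ->
  entropy2 (theta * t) <= theta ^+ 2 * entropy2 t.
Proof.
move=> hI /andP[t0]; have /andP[h0 h1] := hI.
rewrite le_eqVlt => /orP[/eqP ->|t1]; last by apply: entropy2_scale_lt => //; rewrite t0.
rewrite mulr1 entropy2_1.
move: h1; rewrite le_eqVlt => /orP[/eqP ->|h1]; first by rewrite entropy2_1 expr1n mul1r.
have l2 : 0 <= ln 2 :> R by rewrite ln_ge0 // ler1n.
(* The endpoint t = 1, singular for ln(1 - t), is approached from inside: write theta as (theta / s)
   s with s < 1, then let s tend to 1. *)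
have B s : theta <= s -> 0 < s -> s < 1 -> s ^+ 2 * entropy2 theta <= theta ^+ 2 * ln 2.
  move=> hs s0 s1.
  have qI : 0 <= theta / s <= 1.
    by rewrite divr_ge0 ?(ltW s0) //= ler_pdivrMr // mul1r.
  have := @entropy2_scale_lt (theta / s) s qI; rewrite (ltW s0) s1 => /(_ isT).
  rewrite divfK ?gt_eqF // => h.
  have := ler_wpM2l (sqr_ge0 s) h; rewrite [leRHS]mulrA.
  have -> : s ^+ 2 * (theta / s) ^+ 2 = theta ^+ 2 by field; rewrite gt_eqF.
  move=> {}h; apply: le_trans h _; apply: ler_wpM2l; first exact: sqr_ge0.
  by apply: entropy2_le; apply/andP; split; lra.
rewrite leNgt; apply/negP => gap.
have e0 : 0 < entropy2 theta.
  by apply: le_lt_trans gap; rewrite mulr_ge0 ?sqr_ge0.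
have e1 : entropy2 theta <= ln 2 by apply: entropy2_le; rewrite h0 ltW.
(* For s >= 1 - d, s^2 >= 1 - 2d costs at most half of the supposed gap, contradicting [B]. *)
pose d := (entropy2 theta - theta ^+ 2 * ln 2) / (4 * entropy2 theta).
have d0 : 0 < d by apply: divr_gt0; [rewrite subr_gt0|apply: mulr_gt0].
have dE : d * entropy2 theta = (entropy2 theta - theta ^+ 2 * ln 2) / 4.
  by rewrite /d; field; rewrite gt_eqF.
pose s := Num.max (Num.max theta (1 - d)) (1 / 2).
have s1 : s < 1 by rewrite /s !gt_max h1; apply/andP; split; [apply/andP; split => //; lra|lra].
have s0 : 0 < s by rewrite /s !lt_max; apply/orP; right; lra.
have sh : theta <= s by rewrite /s !le_max lexx.
have sd : 1 - d <= s by rewrite /s !le_max lexx orbT.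
have := B s sh s0 s1.
have s2 : 1 - 2 * d <= s ^+ 2 by nra.
have := ler_wpM2r (ltW e0) s2; rewrite mulrBl mul1r -mulrA dE; lra.
Qed.
End TwoPoint.

(** * The two-point inequality for integer moments *)

Section TwoPointPower.
Variable R : realType.
Implicit Types (t s theta lam x y : R).

Lemma is_derive_exprn (f : R -> R) (df t : R) (n : nat) : is_derive t 1 f df ->
  is_derive t 1 (fun x => f x ^+ n.+1) (n.+1%:R * f t ^+ n * df).
Proof.
move=> fd; elim: n => [|n IH].
  by rewrite expr0 !mul1r; under eq_fun do rewrite expr1.
under eq_fun do rewrite exprS.
by apply: is_derive_eq; rewrite /GRing.scale /= -(natr1 n.+1) exprS; ring.
Qed.

Lemma is_derive_expn1D t (n : nat) :
  is_derive t 1 (fun x : R => (1 + x) ^+ n.+1) (n.+1%:R * (1 + t) ^+ n).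
Proof.
have d : is_derive t 1 (fun x : R => 1 + x) 1 by apply: is_derive_eq; ring.
by have := is_derive_exprn n d; rewrite mulr1.
Qed.

Lemma is_derive_expn1B t (n : nat) :
  is_derive t 1 (fun x : R => (1 - x) ^+ n.+1) (- (n.+1%:R * (1 - t) ^+ n)).
Proof.
have d : is_derive t 1 (fun x : R => 1 - x) (-1) by apply: is_derive_eq; ring.
by have := is_derive_exprn n d; rewrite mulrN1.
Qed.

Lemma addrV_homo x y : 1 <= x -> x <= y -> x + x^-1 <= y + y^-1.
Proof.
move=> x1 xy; rewrite -subr_ge0.
have -> : y + y^-1 - (x + x^-1) = (y - x) * (1 - (x * y)^-1).
  by field; rewrite !gt_eqF //; lra.
apply: mulr_ge0; first lra.
have : 1 <= x * y by nra.
by move=> h; rewrite subr_ge0 invf_le1 //; lra.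
Qed.

Lemma sym_power_homo (a b : nat) x y : 1 <= x -> x <= y ->
  x ^+ a * x^-1 ^+ b + x ^+ b * x^-1 ^+ a <= y ^+ a * y^-1 ^+ b + y ^+ b * y^-1 ^+ a.
Proof.
wlog ab : a b / (b <= a)%N.
  move=> H x1 xy; case: (leqP b a) => [|/ltnW] ab; first exact: H.
  by rewrite addrC [leRHS]addrC; exact: H.
move=> x1 xy.
have [d ->] : exists d, a = (d + b)%N by exists (a - b)%N; rewrite subnK.
have E (z : R) : 1 <= z -> z ^+ (d + b) * z^-1 ^+ b + z ^+ b * z^-1 ^+ (d + b) =
    z ^+ d + (z ^+ d)^-1.
  move=> z1; have z0 : z != 0 by rewrite gt_eqF //; lra.
  by rewrite !exprD !exprVn; field; rewrite !expf_neq0.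
rewrite !E //; last lra.
by apply: addrV_homo; [exact: exprn_ege1|apply: lerXn2r; rewrite ?nnegrE //; lra].
Qed.

(** The quotient (x^n - x^-n)/(x - x^-1) as a sum of powers; pairing opposite exponents shows that
    it increases for x >= 1. *)
Definition sym_quot (n : nat) x : R := \sum_(i < n) x ^+ (n.-1 - i) * x^-1 ^+ i.

Lemma sym_quot_homo n x y : 1 <= x -> x <= y -> sym_quot n x <= sym_quot n y.
Proof.
move=> x1 xy.
have E (z : R) : 2 * sym_quot n z =
    \sum_(i < n) (z ^+ (n.-1 - i) * z^-1 ^+ i + z ^+ i * z^-1 ^+ (n.-1 - i)).
  rewrite big_split /= -[sym_quot n z]/(\sum_(i < n) z ^+ (n.-1 - i) * z^-1 ^+ i).
  set S := \sum_(i < n) _; rewrite [X in _ + X](reindex_inj rev_ord_inj) /=.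
  rewrite [X in _ + X](eq_bigr (fun i : 'I_n => z ^+ (n.-1 - i) * z^-1 ^+ i)).
    by rewrite -/S; ring.
  move=> i _; have -> : (n - i.+1 = n.-1 - i)%N by rewrite -subn1 subnAC subnS subn1.
  rewrite subKn //; case: n i {S} => [[]//|n'] i; rewrite /= -ltnS; exact: ltn_ord.
rewrite -(ler_pM2l (ltr0n R 2)) !E; apply: ler_sum => i _; exact: sym_power_homo.
Qed.

Variable k' : nat.
Let k := k'.+1.

(** The moment of order p = k' + 2 of the density with values 1 + t and 1 - t on a fair bit. *)
Definition pow_phi t : R := ((1 + t) ^+ k.+1 + (1 - t) ^+ k.+1) / 2.
Let N t : R := (1 + t) ^+ k - (1 - t) ^+ k.
Let M t : R := (1 + t) ^+ k.+1 + (1 - t) ^+ k.+1.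
Let S t : R := (1 + t) ^+ k + (1 - t) ^+ k.
(* The elasticity of t * pow_phi' / pow_phi, in a form where monotonicity is visible. *)
Let b t : R := S t / M t * (1 + k%:R / sym_quot k ((1 + t) / (1 - t))).

Let N_gt0 t : 0 < t < 1 -> 0 < N t.
Proof.
by move=> /andP[t0 t1]; rewrite subr_gt0; apply: ltrXn2r; rewrite ?nnegrE //; lra.
Qed.
Let S_gt0 t : 0 < t < 1 -> 0 < S t.
Proof. by move=> /andP[t0 t1]; rewrite addr_gt0 ?exprn_gt0 //; lra. Qed.
Let M_gt0 t : 0 <= t <= 1 -> 0 < M t.
Proof.
move=> /andP[t0 t1]; apply: ltr_pwDl; first by apply: exprn_gt0; lra.
by apply: exprn_ge0; lra.
Qed.

Let sym_quotE t : 0 < t < 1 ->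
  4 * t * ((1 + t) ^+ k' * (1 - t) ^+ k') * sym_quot k ((1 + t) / (1 - t)) = N t * S t.
Proof.
move=> /andP[t0 t1].
have x0 : 1 + t != 0 by rewrite gt_eqF //; lra.
have u0 : 1 - t != 0 by rewrite gt_eqF //; lra.
have -> : N t * S t = ((1 + t) ^+ 2) ^+ k - ((1 - t) ^+ 2) ^+ k.
  by rewrite -!exprM ![(2 * _)%N]mulnC !exprM /N /S; ring.
rewrite subrXX -/k.
have -> : (1 + t) ^+ 2 - (1 - t) ^+ 2 = 4 * t by ring.
rewrite -mulrA; congr (_ * _); rewrite /sym_quot mulr_sumr; apply: eq_bigr => i _.
have ik : (i <= k')%N by rewrite -ltnS.
rewrite /= -[X in (1 + t) ^+ X * (1 - t) ^+ X](subnK ik).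
rewrite !exprD invf_div !exprMn !exprVn.
by field; rewrite !expf_neq0.
Qed.

Let sym_quot_gt0 t : 0 < t < 1 -> 0 < sym_quot k ((1 + t) / (1 - t)).
Proof.
move=> tI; have := sym_quotE tI; have /andP[t0 t1] := tI.
have c0 : 0 < 4 * t * ((1 + t) ^+ k' * (1 - t) ^+ k').
  by rewrite !mulr_gt0 ?exprn_gt0 //; lra.
move=> e; rewrite -(pmulr_rgt0 _ c0) e; apply: mulr_gt0; [exact: N_gt0|exact: S_gt0].
Qed.

Let b_nincr s t : 0 < s -> s <= t -> t < 1 -> b t <= b s.
Proof.
move=> s0 st t1.
have sI : 0 < s < 1 by apply/andP; split; lra.
have tI : 0 < t < 1 by apply/andP; split; lra.
have tI' : 0 <= t <= 1 by apply/andP; split; lra.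
have sI' : 0 <= s <= 1 by apply/andP; split; lra.
have Qs := sym_quot_gt0 sI; have Qt := sym_quot_gt0 tI.
apply: ler_pM.
- by rewrite divr_ge0 // ltW ?S_gt0 ?M_gt0.
- by rewrite addr_ge0 // divr_ge0 // ltW.
- rewrite ler_pdivrMr ?M_gt0 // mulrAC ler_pdivlMr ?M_gt0 //.
  have ME y : M y = S y + y * N y by rewrite /M /S /N !exprS; ring.
  rewrite !ME.
  have NS : S t * N s <= S s * N t.
    have A : (1 + s) ^+ k <= (1 + t) ^+ k by apply: lerXn2r; rewrite ?nnegrE; lra.
    have B : (1 - t) ^+ k <= (1 - s) ^+ k by apply: lerXn2r; rewrite ?nnegrE; lra.
    have As : 0 <= (1 + s) ^+ k by apply: exprn_ge0; lra.
    have Bt : 0 <= (1 - t) ^+ k by apply: exprn_ge0; lra.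
    have AB := ler_pM As Bt A B.
    by rewrite /S /N; lra.
  have Ss := S_gt0 sI; have St := S_gt0 tI; have Ns := N_gt0 sI.
  have := ler_wpM2l (ltW s0) NS.
  have : s * (S s * N t) <= t * (S s * N t).
    by apply: ler_wpM2r => //; rewrite mulr_ge0 // ltW // N_gt0.
  by lra.
- rewrite lerD2l ler_wpM2l // lef_pV2 ?posrE //.
  apply: sym_quot_homo.
    by rewrite ler_pdivlMr; lra.
  rewrite ler_pdivrMr; last lra.
  by rewrite mulrAC ler_pdivlMr; nra.
Qed.

(** The logarithm of t phi'/phi for phi = [pow_phi], up to the constant ln(k + 1). *)
Let la t : R := ln t + ln (N t) - ln (M t).

Let la_deriv t : 0 < t < 1 -> is_derive t 1 la (b t / t).
Proof.
move=> tI; have /andP[t0 t1] := tI.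
have tI' : 0 <= t <= 1 by apply/andP; split; lra.
have N0 := N_gt0 tI; have M0 := M_gt0 tI'; have S0 := S_gt0 tI.
have Q0 := sym_quot_gt0 tI.
pose dN := k%:R * ((1 + t) ^+ k' + (1 - t) ^+ k').
pose dM := k.+1%:R * N t.
have hN : is_derive t 1 N dN.
  have g1 := is_derive_expn1D t k'; have g2 := is_derive_expn1B t k'.
  by rewrite /N; apply: is_derive_eq; rewrite /dN -/k; ring.
have hM : is_derive t 1 M dM.
  have g1 := is_derive_expn1D t k; have g2 := is_derive_expn1B t k.
  by rewrite /M; apply: is_derive_eq; rewrite /dM /N; ring.
have h1 := is_derive1_ln t0.
have h2 := @is_derive1_comp _ (@ln R) N t _ _ (is_derive1_ln N0) hN.
have h3 := @is_derive1_comp _ (@ln R) M t _ _ (is_derive1_ln M0) hM.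
rewrite /la; apply: is_derive_eq.
have -> : b t = (S t + k%:R * (4 * t * ((1 + t) ^+ k' * (1 - t) ^+ k')) / N t) / M t.
  rewrite /b; have := sym_quotE tI; set Q := sym_quot _ _ => e.
  have -> : k%:R / Q = k%:R * (4 * t * ((1 + t) ^+ k' * (1 - t) ^+ k')) / (N t * S t).
    by rewrite -e; field; rewrite ?gt_eqF ?exprn_gt0 //=; lra.
  by field; rewrite !gt_eqF.
apply: (@mulfI _ (t * N t * M t)); first by rewrite !mulf_neq0 // gt_eqF.
have -> : t * N t * M t * (t^-1 + (N t)^-1 * dN - (M t)^-1 * dM) =
   N t * M t + t * M t * dN - t * N t * dM by field; rewrite !gt_eqF.
have -> : t * N t * M t * ((S t + k%:R * (4 * t * ((1 + t) ^+ k' * (1 - t) ^+ k')) / N t) / M t / t)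
  = N t * S t + k%:R * (4 * t * ((1 + t) ^+ k' * (1 - t) ^+ k')) by field; rewrite !gt_eqF.
rewrite /dN /dM /N /M /S -[k.+1%:R]natr1 !exprS; ring.
Qed.

(* If F s = lam ln(phi s) - ln(phi (theta s)) were negative somewhere on (0, 1), its
   derivative would change sign from - to +, against the monotonicity of [b]. *)
Lemma two_point_power theta lam t : 0 <= theta <= 1 -> 0 <= lam ->
  ln (pow_phi theta) = lam * ln (pow_phi 1) -> 0 <= t <= 1 ->
  ln (pow_phi (theta * t)) <= lam * ln (pow_phi t).
Proof.
move=> /andP[h0 h1] l0 e tI; rewrite -subr_ge0.
have phi0 : pow_phi 0 = 1 by rewrite /pow_phi addr0 subr0 !expr1n; field.
have phiM s : pow_phi s = M s / 2 by [].
have phi_gt0 s : 0 <= s <= 1 -> 0 < pow_phi s.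
  by move=> sI; rewrite phiM divr_gt0 // M_gt0.
have dphi s : is_derive s 1 pow_phi (k.+1%:R * N s / 2).
  have g1 := is_derive_expn1D s k; have g2 := is_derive_expn1B s k.
  by rewrite /pow_phi; apply: is_derive_eq; rewrite /N /GRing.scale /=; field.
have hs s : 0 <= s <= 1 -> 0 <= theta * s <= 1.
  by move=> /andP[s0 s1]; rewrite mulr_ge0 //= mulr_ile1.
pose G s := ln (pow_phi s).
pose dG s := k.+1%:R * N s / M s.
have Gd s : 0 <= s <= 1 -> is_derive s 1 G (dG s).
  move=> sI; have := @is_derive1_comp _ (@ln R) pow_phi s _ _
    (is_derive1_ln (phi_gt0 s sI)) (dphi s).
  rewrite (_ : (pow_phi s)^-1 * _ = dG s) // /dG phiM; field.
  by rewrite gt_eqF // M_gt0.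
(* At theta = 0 or 1 the calibration [e] forces lam = theta; they are set aside because the argument
   takes logarithms at theta s and at s, both inside (0, 1). *)
move: h0; rewrite le_eqVlt => /orP[/eqP h00|h0].
  move: e; rewrite -h00 mul0r phi0 ln1 subr0 => /esym/eqP; rewrite mulf_eq0.
  case/orP => [/eqP -> |]; first by rewrite mul0r.
  have : 1 < pow_phi 1.
    rewrite /pow_phi subrr expr0n /= addr0 -natr1 exprSr mulfK ?pnatr_eq0 //.
    by rewrite exprn_egt1 //; lra.
  by move=> /ln_gt0/gt_eqF ->.
move: h1; rewrite le_eqVlt => /orP[/eqP h11|h1].
  move: e; rewrite h11 mul1r => e.
  have : 1 < pow_phi 1.
    rewrite /pow_phi subrr expr0n /= addr0 -natr1 exprSr mulfK ?pnatr_eq0 //.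
    by rewrite exprn_egt1 //; lra.
  move=> /ln_gt0 lp; have -> : lam = 1.
    by apply: (@mulIf _ (ln (pow_phi 1))); rewrite ?gt_eqF // mul1r -e.
  by rewrite mul1r subrr.
pose F s := lam * G s - G (theta * s).
pose dF s := lam * dG s - dG (theta * s) * theta.
rewrite -[X in 0 <= X]/(F t); apply: (@mvt_rise_fall R F dF) => //.
- by rewrite /F /G mulr0 phi0 ln1; lra.
- by rewrite /F /G mulr1 e; lra.
- move=> s sI; have d1 := Gd s sI; have d2 := Gd _ (hs s sI).
  have sc : is_derive s 1 (fun x : R => theta * x) theta.
    by apply: is_derive_eq; rewrite /GRing.scale /= mulr1.
  have d3 := @is_derive1_comp _ G (fun x : R => theta * x) s _ _ d2 sc.
  by rewrite /F /dF; apply: is_derive_eq.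
move=> c d c0 cd d1.
pose a s := s * N s / M s.
have aE s : 0 < s < 1 -> a s = expR (la s).
  move=> sI; have /andP[s0 s1] := sI.
  have sI' : 0 <= s <= 1 by apply/andP; split; lra.
  by rewrite /la expRB expRD !lnK ?posrE ?N_gt0 ?M_gt0.
have hlt s : 0 < s < 1 -> 0 < theta * s < 1.
  by move=> /andP[s0 s1]; rewrite mulr_gt0 //= mulr_ilt1 // ltW.
have sdF s : 0 < s < 1 -> s * dF s = k.+1%:R * (lam * a s - a (theta * s)).
  move=> sI; have /andP[s0 s1] := sI.
  rewrite /dF /dG /a; set u := theta * s; have -> : theta = u / s by rewrite /u mulfK // gt_eqF.
  have M1 : 0 < M s by apply: M_gt0; rewrite (ltW s0) ltW.
  have M2 : 0 < M u by apply: M_gt0; have /andP[? ?] := hlt s sI; apply/andP; split; exact: ltW.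
  by field; rewrite !gt_eqF.
have cI : 0 < c < 1 by apply/andP; split; lra.
have dI : 0 < d < 1 by apply/andP; split; lra.
(* By [sdF] the sign of dF s is that of lam - a(theta s)/a(s). Since [b] is nonincreasing, this
   ratio is nondecreasing in s, so dF cannot turn positive again. *)
have mono : la (theta * c) - la c <= la (theta * d) - la d.
  pose L s := la s - la (theta * s).
  pose dL s := b s / s - b (theta * s) / (theta * s) * theta.
  have Ld s : c <= s <= d -> is_derive s 1 L (dL s).
    move=> /andP[cs sd]; have sI : 0 < s < 1 by apply/andP; split; lra.
    have g1 := la_deriv sI; have g2 := la_deriv (hlt s sI).
    have sc : is_derive s 1 (fun x : R => theta * x) theta.
      by apply: is_derive_eq; rewrite /GRing.scale /= mulr1.
    have g3 := @is_derive1_comp _ la (fun x : R => theta * x) s _ _ g2 sc.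
    by rewrite /L /dL; apply: is_derive_eq.
  have : L d <= L c.
    apply: (is_derive_nincr Ld) => //; last exact: ltW.
    move=> s /andP[cs sd]; have s0 : 0 < s by lra.
    have sI : 0 < s < 1 by apply/andP; split; lra.
    have /andP[hs0 hs1] := hlt s sI.
    rewrite /dL; have -> : b (theta * s) / (theta * s) * theta = b (theta * s) / s.
      by field; rewrite !gt_eqF.
    rewrite -mulrBl pmulr_lle0 ?invr_gt0 // subr_le0; apply: b_nincr => //; last lra.
    by rewrite -[leRHS]mul1r; apply: ler_wpM2r; exact: ltW.
  by rewrite /L; lra.
have ac : 0 < a c by rewrite aE // expR_gt0.
have ad : 0 < a d by rewrite aE // expR_gt0.
have ratio : a (theta * c) * a d <= a (theta * d) * a c.
  by rewrite !aE ?hlt // -!expRD ler_expR; lra.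
have kk : 0 < k.+1%:R :> R by rewrite ltr0n.
move=> neg.
have h : lam * a c < a (theta * c).
  have : c * dF c < 0 by rewrite pmulr_rlt0.
  by rewrite sdF // pmulr_rlt0 // subr_lt0.
have : d * dF d <= 0.
  rewrite sdF // pmulr_rle0 // subr_le0 -(ler_pM2r ac); apply: le_trans ratio.
  by rewrite mulrAC ler_pM2r // ltW.
by rewrite pmulr_rle0 //; lra.
Qed.
End TwoPointPower.

(** * Comparison of noise with erasures *)

Section Noise.
Variables (R : realType) (m n : nat) (H : 'M['F_2]_(m, n)).
Implicit Types (P : 'cV['F_2]_m -> R) (s h : 'cV['F_2]_m) (i : 'I_n) (l : seq 'I_n).
Implicit Types (a : R) (T : {set 'I_n}).

Lemma colF2_addK s h : s + h + h = s.
Proof. by apply/colP => j; rewrite !mxE -addrA addF2 addr0. Qed.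

Lemma sum_shift h P : \sum_s P (s + h) = \sum_s P s.
Proof. by rewrite [RHS](reindex_inj (addIr h)). Qed.

(* The law of s + z H_i, for s of law P and an independent bit z of parameter a. *)
Definition noise a i P : 'cV['F_2]_m -> R := fun s => (1 - a) * P s + a * P (s + col i H).

Definition noise_list a l P := foldl (fun P i => noise a i P) P l.

Lemma noiseC a b i j P : noise a i (noise b j P) = noise b j (noise a i P).
Proof.
apply/funext => s; rewrite /noise (_ : s + col j H + col i H = s + col i H + col j H); first ring.
by rewrite addrAC.
Qed.

Lemma noise_noise_list a b i l P : noise a i (noise_list b l P) = noise_list b l (noise a i P).
Proof. by elim: l P => //= j l IH P; rewrite IH noiseC. Qed.

Lemma noise_list_lin a l (b c : R) P Q :
  noise_list a l (fun s => b * P s + c * Q s) = (fun s => b * noise_list a l P s + c * noise_list a l Q s).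
Proof.
elim: l P Q => //= j l IH P Q; rewrite -IH; congr noise_list; apply/funext => s.
by rewrite /noise; ring.
Qed.

Definition indicator T : 'cV['F_2]_n := \col_i (i \in T)%:R.

Lemma PHZ_expect a s :
  PHZ a H s = expect a (fun T => (H *m indicator T == s)%:R).
Proof.
rewrite expectE /PHZ big_mkcond (reindex indicator) /=; last first.
  exists (fun z => [set i | z i 0 == 1]) => [A|z] _.
    by apply/setP => i; rewrite inE mxE; case: (i \in A).
  by apply/colP => i; rewrite mxE inE; case: (F2_cases (z i 0)) => ->.
apply: eq_bigr => A _; case: eqP => _; rewrite ?mulr0 // mulr1.
by apply: eq_bigr => i _; rewrite mxE; case: (i \in A).
Qed.

Lemma indicatorU1 T i : i \notin T -> H *m indicator (i |: T) = H *m indicator T + col i H.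
Proof.
move=> iT; rewrite colE -mulmxDr; congr (_ *m _).
apply/colP => j; rewrite !mxE !inE eqxx andbT; case: eqP => [->|_] /=.
  by rewrite (negbTE iT) add0r.
by rewrite addr0.
Qed.

Lemma PHZ_noise_list a : PHZ a H = noise_list a (enum 'I_n) (fun s => (s == 0)%:R).
Proof.
apply/funext => s; rewrite PHZ_expect.
suff G l T : uniq l -> (forall i, i \in l -> i \notin T) ->
   pexp a l (fun T => (H *m indicator T == s)%:R) T =
   noise_list a l (fun s' => (H *m indicator T == s')%:R) s.
  rewrite /expect G ?enum_uniq //; last by move=> i _; rewrite inE.
  congr (noise_list _ _ _ s); apply/funext => s'.
  rewrite (_ : indicator _ = 0) ?mulmx0 1?eq_sym //.
  by apply/colP => i; rewrite !mxE inE.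
elim: l T => // i l IH T /andP[il ul] lT.
have iT : i \notin T by apply: lT; rewrite inE eqxx.
rewrite pexp_cons /avg setD1_id // IH //; last first.
  move=> j jl; rewrite !inE negb_or lT ?inE ?jl ?orbT // andbT.
  by apply: contraNneq il => <-.
rewrite IH //; last by move=> j jl; apply: lT; rewrite inE jl orbT.
rewrite /= -[X in _ = noise_list a l X s]/(noise a i _).
have -> : noise a i (fun s' => (H *m indicator T == s')%:R) =
  (fun s' => a * (H *m indicator (i |: T) == s')%:R + (1 - a) * (H *m indicator T == s')%:R).
  apply/funext => s'; rewrite /noise indicatorU1 // addrC.
  suff -> : (H *m indicator T + col i H == s') = (H *m indicator T == s' + col i H) by [].
  by apply/eqP/eqP => [<-|->]; rewrite colF2_addK.
by rewrite noise_list_lin.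
Qed.

Definition density P := (forall s, 0 <= P s) /\ \sum_s P s = 1.

Lemma noise_density a i P : 0 <= a <= 1 -> density P -> density (noise a i P).
Proof.
move=> /andP[a0 a1] [P0 P1]; split.
  by move=> s; rewrite /noise addr_ge0 // mulr_ge0 // subr_ge0.
by rewrite /noise big_split /= -!mulr_sumr sum_shift P1; ring.
Qed.

Lemma noise_list_density a l P : 0 <= a <= 1 -> density P -> density (noise_list a l P).
Proof. by move=> aI; elim: l P => //= i l IH P dP; apply/IH/noise_density. Qed.

Definition span_density T : 'cV['F_2]_m -> R :=
  fun s => (s^T <= cspan H T)%MS%:R / 2 ^+ rk H T.

Lemma sum_span T : \sum_(s : 'cV['F_2]_m) (s^T <= cspan H T)%MS%:R = 2 ^+ rk H T :> R.
Proof.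
rewrite (reindex (@trmx 'F_2 1 m)) /=; last by exists (@trmx 'F_2 m 1) => ? _; exact: trmxK.
under eq_bigr do rewrite trmxK.
rewrite -natrX; have -> : (2 ^ rk H T = #|'F_2| ^ rk H T)%N by rewrite card_Fp.
rewrite /rk -mxabelem.card_rowg -sum1_card natr_sum [RHS]big_mkcond.
by apply: eq_bigr => v _; rewrite inE; case: (v <= _)%MS.
Qed.

Lemma span_density_density T : density (span_density T).
Proof.
split; first by move=> s; rewrite divr_ge0 ?exprn_ge0.
by rewrite /span_density -mulr_suml sum_span divff // expf_neq0 // pnatr_eq0.
Qed.

Lemma span_density0 : span_density finset.set0 = (fun s => (s == 0)%:R).
Proof.
apply/funext => s; rewrite /span_density rk0 expr0 divr1 /cspan big_set0 submx0.
by rewrite -(inj_eq (@trmx_inj _ m 1) s 0) trmx0.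
Qed.

Lemma noise_half_span T i : noise 2^-1 i (span_density T) = span_density (i |: T).
Proof.
apply/funext => s; rewrite /noise /span_density rkU1 (cspanU1 H T i).
have half (x y d : R) : d != 0 -> (1 - 2^-1) * (x / d) + 2^-1 * (y / d) = (x + y) / (2 * d).
  by move=> d0; field.
have d0 : 2 ^+ rk H T != 0 :> R by rewrite expf_neq0 // pnatr_eq0.
have tr : (s + col i H)^T = s^T + row i H^T by rewrite linearD /= tr_col.
case: (boolP (incl H T i)) => [|iT].
  move=> iT; rewrite addn0 tr (addsmx_idPl iT).
  have -> : ((s^T + row i H^T)%R <= cspan H T)%MS = (s^T <= cspan H T)%MS.
    apply/idP/idP => h; last exact: addmx_sub.
    have -> : s^T = s^T + row i H^T + row i H^T.
      by apply/rowP => j; rewrite !mxE -addrA addF2 addr0.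
    exact: addmx_sub.
  by rewrite -mulrDl subrK mul1r.
rewrite addn1 exprS tr.
(* As H_i is outside the span, the enlarged span is the disjoint union of the span and its translate
   by H_i, 0 and 1 being the only scalars. *)
have -> : (s^T <= cspan H T + row i H^T)%MS%:R =
  (s^T <= cspan H T)%MS%:R + ((s^T + row i H^T)%R <= cspan H T)%MS%:R :> R.
  case: (boolP (s^T <= cspan H T)%MS) => sT.
    rewrite (submx_trans sT (addsmxSl _ _)).
    case: (boolP ((s^T + row i H^T)%R <= cspan H T)%MS) => [h|_]; last by rewrite addr0.
    case/negP: iT; rewrite /incl.
    have -> : row i H^T = s^T + row i H^T - s^T by rewrite addrC addKr.
    by apply: addmx_sub => //; rewrite eqmx_opp.
  case: (boolP ((s^T + row i H^T)%R <= cspan H T)%MS) => h.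
    have -> : (s^T <= cspan H T + row i H^T)%MS; last by rewrite add0r.
    have -> : s^T = s^T + row i H^T - row i H^T by rewrite addrK.
    apply: addmx_sub; first exact: submx_trans (addsmxSl _ _).
    by rewrite eqmx_opp addsmxSr.
  rewrite addr0; case: (boolP (s^T <= cspan H T + row i H^T)%MS) => // /sub_addsmxP[[u v] /= e].
  have vE : v = (v 0 0)%:M by rewrite [LHS]mx11_scalar.
  move: e; rewrite vE mul_scalar_mx; case: (F2_cases (v 0 0)) => ->.
    by rewrite scale0r addr0 => e; case/negP: sT; rewrite e submxMl.
  rewrite scale1r => e; case/negP: h; rewrite e.
  have -> : u *m cspan H T + row i H^T + row i H^T = u *m cspan H T.
    by apply/rowP => j; rewrite !mxE -addrA addF2 addr0.
  exact: submxMl.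
exact: half.
Qed.

(* After Samorodnitsky. *)
Lemma noise_erasure_comparison (Phi : ('cV['F_2]_m -> R) -> R) (a lam : R) :
  0 <= a <= 1 -> 0 <= lam <= 1 ->
  (forall i P, density P ->
     Phi (noise a i P) <= lam * Phi P + (1 - lam) * Phi (noise 2^-1 i P)) ->
  Phi (PHZ a H) <= expect (1 - lam) (fun T => Phi (span_density T)).
Proof.
move=> aI /andP[l0 l1] step; rewrite PHZ_noise_list -span_density0 /expect.
suff G l T : uniq l -> (forall i, i \in l -> i \notin T) ->
    Phi (noise_list a l (span_density T)) <= pexp (1 - lam) l (fun T => Phi (span_density T)) T.
  by apply: G; [exact: enum_uniq|move=> i _; rewrite inE].
elim: l T => [T _ _|i l IH T]; first by rewrite lexx.
move=> /andP[il ul] lT.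
have iT : i \notin T by apply: lT; rewrite inE eqxx.
(* Since noises commute, the noise on [i] may come last, where [step] applies to the law produced by
   the others; the resulting fair bit is then commuted back and enlarges T by i. *)
rewrite pexp_cons -[noise_list a (i :: l) _]/(noise_list a l (noise a i (span_density T))) -noise_noise_list.
have dP : density (noise_list a l (span_density T)).
  by apply: noise_list_density => //; exact: span_density_density.
apply: le_trans (step i _ dP) _.
rewrite noise_noise_list noise_half_span /avg setD1_id // opprB addrCA subrr addr0 addrC.
apply: lerD; apply: ler_wpM2l => //; rewrite ?subr_ge0 //; apply: IH => // j jl.
  rewrite !inE negb_or lT ?inE ?jl ?orbT // andbT.
  by apply: contraNneq il => <-.
by apply: lT; rewrite inE jl orbT.
Qed.

Lemma expR_convex2 (lam x y : R) : 0 <= lam <= 1 ->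
  expR (lam * x + (1 - lam) * y) <= lam * expR x + (1 - lam) * expR y.
Proof.
move=> /andP[l0 l1]; set z := lam * x + (1 - lam) * y.
have E w : expR z * (1 + (w - z)) <= expR w.
  have -> : expR w = expR z * expR (w - z) by rewrite -expRD; congr expR; ring.
  by apply: ler_wpM2l; [exact: expR_ge0|exact: expR_ge1Dx].
have l1' : 0 <= 1 - lam by lra.
apply: le_trans (lerD (ler_wpM2l l0 (E x)) (ler_wpM2l l1' (E y))).
have -> : lam * (expR z * (1 + (x - z))) + (1 - lam) * (expR z * (1 + (y - z))) =
   expR z * (1 + (lam * x + (1 - lam) * y - z)) by ring.
by rewrite -/z subrr addr0 mulr1.
Qed.

Section PairStep.
Variables (a : R) (i : 'I_n) (P : 'cV['F_2]_m -> R).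
Hypothesis aI : 0 <= a <= 1.
Hypothesis dP : density P.

(** Even and odd parts of P on the pair {s, s + H_i}: noise of parameter a keeps [al] and multiplies
    [be] by 1 - 2a, and a fair bit erases [be]. *)
Let al s := (P s + P (s + col i H)) / 2.
Let be s := (P s - P (s + col i H)) / 2.

Let al_shift s : al (s + col i H) = al s.
Proof. by rewrite /al colF2_addK addrC. Qed.
Let be_shift s : be (s + col i H) = - be s.
Proof. by rewrite /be colF2_addK -mulNr opprB. Qed.
Let be_al s : `|be s| <= al s.
Proof.
by have [P0 _] := dP; have := P0 s; have := P0 (s + col i H);
  rewrite ler_norml /al /be => ? ?; apply/andP; split; lra.
Qed.
Let al0 s : 0 <= al s. Proof. by apply: le_trans (be_al s). Qed.

Let noiseE s : noise a i P s = al s + (1 - 2 * a) * be s.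
Proof. by rewrite /noise /al /be; field. Qed.
Let noise_half s : noise 2^-1 i P s = al s.
Proof. by rewrite /noise /al; field. Qed.
Let PE s : P s = al s + be s.
Proof. by rewrite /al /be; field. Qed.

Let sum_pair (F : R -> R) (c : R) :
  \sum_s F (al s + c * be s) = \sum_s (F (al s + c * be s) + F (al s - c * be s)) / 2.
Proof.
rewrite -mulr_suml big_split /= -[X in (_ + X) / 2](sum_shift (col i H)).
under [X in (_ + X) / 2]eq_bigr do rewrite al_shift be_shift mulrN opprK.
by field.
Qed.

Let abs_theta : 0 <= `|1 - 2 * a| <= 1.
Proof.
by rewrite normr_ge0 /= ler_norml; case/andP: aI => ? ?; apply/andP; split; lra.
Qed.

Let even_norm (F : R -> R -> R) s c : (forall x y, F x (- y) = F x y) ->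
  F (al s) (c * be s) = F (al s) (`|c| * `|be s|).
Proof.
move=> ev; rewrite -normrM; case: (ler0P (c * be s)) => // _; by rewrite ev.
Qed.

Let ratioI s : 0 < al s -> 0 <= `|be s| / al s <= 1.
Proof.
by move=> s0; rewrite divr_ge0 ?normr_ge0 ?(ltW s0) //= ler_pdivrMr // mul1r.
Qed.

(** The two-point inequality bounds each pair by a geometric mean, and Hölder's inequality sums
    these products. *)
Lemma power_step k lam : 0 <= lam <= 1 ->
  ln (pow_phi k `|1 - 2 * a|) = lam * ln (pow_phi k (1 : R)) ->
  ln (\sum_s noise a i P s ^+ k.+2) <=
  lam * ln (\sum_s P s ^+ k.+2) + (1 - lam) * ln (\sum_s noise 2^-1 i P s ^+ k.+2).
Proof.
move=> lI e; have /andP[l0 l1] := lI.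
have pos Q : density Q -> 0 < \sum_s Q s ^+ k.+2.
  move=> [Q0 Q1]; have [s s0] : exists s, 0 < Q s.
    apply/existsP; apply: contraT; rewrite negb_exists => /forallP h.
    have : \sum_s Q s <= 0 by apply: sumr_le0 => s _; rewrite leNgt.
    by rewrite Q1 ler10.
  rewrite (bigD1 s) //= ltr_pwDl ?exprn_gt0 //.
  by apply: sumr_ge0 => s' _; rewrite exprn_ge0.
have halfI : 0 <= (2^-1 : R) <= 1 by apply/andP; split; lra.
set SP := \sum_s P s ^+ k.+2; set SA := \sum_s noise 2^-1 i P s ^+ k.+2.
have SP0 : 0 < SP by exact: pos.
have SA0 : 0 < SA by apply: pos; exact: noise_density.
have SN0 : 0 < \sum_s noise a i P s ^+ k.+2 by apply: pos; exact: noise_density.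
set M := lam * ln SP + (1 - lam) * ln SA.
pose f x y : R := ((x + y) ^+ k.+2 + (x - y) ^+ k.+2) / 2.
have fE x t : 0 < x -> f x (x * t) = x ^+ k.+2 * pow_phi k t.
  move=> x0; rewrite /f /pow_phi.
  have -> : x + x * t = x * (1 + t) by ring.
  have -> : x - x * t = x * (1 - t) by ring.
  by rewrite !exprMn; ring.
have fev x y : f x (- y) = f x y by rewrite /f opprK addrC.
have SPE : SP = \sum_s f (al s) (be s).
  rewrite /SP; have := sum_pair (fun x => x ^+ k.+2) 1.
  under eq_bigr do rewrite mul1r -PE.
  by move=> ->; apply: eq_bigr => s _; rewrite mul1r.
have SNE : \sum_s noise a i P s ^+ k.+2 = \sum_s f (al s) ((1 - 2 * a) * be s).
  under eq_bigr do rewrite noiseE.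
  by rewrite (sum_pair (fun x => x ^+ k.+2)).
have SAE : SA = \sum_s al s ^+ k.+2 by apply: eq_bigr => s _; rewrite noise_half.
rewrite -(ler_expR (R := R)) lnK ?posrE //.
(* Hölder by normalization: the two families of weights each sum to 1, so it suffices to compare
   term by term, by convexity of exp. *)
have -> : expR M = \sum_s expR M * (lam * (f (al s) (be s) / SP) + (1 - lam) * (al s ^+ k.+2 / SA)).
  rewrite -mulr_sumr big_split /= -!mulr_sumr -mulr_suml -SPE -mulr_suml -SAE !divff ?gt_eqF //.
  by rewrite !mulr1 addrC subrK mulr1.
rewrite SNE; apply: ler_sum => s _.
have := al0 s; rewrite le_eqVlt => /orP[/eqP s0|s0].
  have b0 : be s = 0 by apply/eqP; rewrite -normr_le0 s0.
  by rewrite -s0 b0 mulr0 /f !addr0 !subr0 !expr0n /= !(mul0r, mulr0, addr0).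
set t := `|be s| / al s.
have tI : 0 <= t <= 1 by exact: ratioI.
have bt : `|be s| = al s * t by rewrite /t mulrC divfK // gt_eqF.
have fb : f (al s) (be s) = f (al s) (al s * t).
  by have := even_norm s 1 fev; rewrite normr1 !mul1r bt.
have fb' : f (al s) ((1 - 2 * a) * be s) = f (al s) (al s * (`|1 - 2 * a| * t)).
  by rewrite (even_norm s _ fev) bt mulrCA.
rewrite fb fb' !fE //.
have phi_gt0 u : 0 <= u <= 1 -> 0 < pow_phi k (u : R).
  move=> /andP[u0 u1]; rewrite /pow_phi divr_gt0 // ltr_pwDl //; first by apply: exprn_gt0; lra.
  by apply: exprn_ge0; lra.
have htI : 0 <= `|1 - 2 * a| * t <= 1.
  by case/andP: abs_theta => ? ?; case/andP: tI => ? ?; rewrite mulr_ge0 //= mulr_ile1.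
have tp := two_point_power abs_theta l0 e tI.
have A0 : 0 < al s ^+ k.+2 by exact: exprn_gt0.
set u := pow_phi k _ in tp *; set p1 := pow_phi k t in tp *.
have u0 : 0 < u by exact: phi_gt0.
have p10 : 0 < p1 by exact: phi_gt0.
move: A0; set B := al s ^+ k.+2 => A0.
have cvx := expR_convex2 (ln (B * p1) - ln SP) (ln B - ln SA) lI.
have Bp : 0 < B * p1 by exact: mulr_gt0.
move: cvx; rewrite !expRB !lnK ?posrE // => cvx.
apply: le_trans (ler_wpM2l (expR_ge0 M) cvx); rewrite -expRD.
have Bu : 0 < B * u by exact: mulr_gt0.
have lnB v : 0 < v -> ln (B * v) = ln B + ln v by move=> v0; rewrite lnM ?posrE.
rewrite -[leLHS]lnK ?posrE // ler_expR !lnB // /M; lra.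
Qed.

(** The entropy of a pair is x ln x + x [entropy2] t, with mean x and relative imbalance t; only the
    second term feels the noise, and [entropy2_scale] contracts it. *)
Lemma entropy_step :
  \sum_s noise a i P s * ln (noise a i P s) <=
  (1 - 2 * a) ^+ 2 * (\sum_s P s * ln (P s)) +
  (1 - (1 - 2 * a) ^+ 2) * (\sum_s noise 2^-1 i P s * ln (noise 2^-1 i P s)).
Proof.
pose f x y : R := ((x + y) * ln (x + y) + (x - y) * ln (x - y)) / 2.
have fev x y : f x (- y) = f x y by rewrite /f opprK addrC.
have fE x t : 0 < x -> 0 <= t <= 1 -> f x (x * t) = x * ln x + x * entropy2 t.
  move=> x0 /andP[t0 t1]; rewrite /f /entropy2.
  have L u : 0 <= u -> (x * u) * ln (x * u) = x * u * (ln x + ln u).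
    rewrite le_eqVlt => /orP[/eqP <-|u0]; first by rewrite mulr0 !mul0r.
    by rewrite lnM ?posrE.
  have -> : x + x * t = x * (1 + t) by ring.
  have -> : x - x * t = x * (1 - t) by ring.
  by rewrite !L; [field|lra|lra].
have SPE : \sum_s P s * ln (P s) = \sum_s f (al s) (be s).
  have := sum_pair (fun x => x * ln x) 1.
  under eq_bigr do rewrite mul1r -PE.
  by move=> ->; apply: eq_bigr => s _; rewrite mul1r.
have SNE : \sum_s noise a i P s * ln (noise a i P s) = \sum_s f (al s) ((1 - 2 * a) * be s).
  under eq_bigr do rewrite noiseE.
  by rewrite (sum_pair (fun x => x * ln x)).
rewrite SPE SNE !mulr_sumr -big_split; apply: ler_sum => s _ /=.
rewrite noise_half.
have := al0 s; rewrite le_eqVlt => /orP[/eqP s0|s0].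
  have b0 : be s = 0 by apply/eqP; rewrite -normr_le0 s0.
  by rewrite -s0 b0 mulr0 /f !addr0 !subr0 !(mul0r, mulr0, addr0).
set t := `|be s| / al s.
have tI : 0 <= t <= 1 by exact: ratioI.
have bt : `|be s| = al s * t by rewrite /t mulrC divfK // gt_eqF.
have fb : f (al s) (be s) = f (al s) (al s * t).
  by have := even_norm s 1 fev; rewrite normr1 !mul1r bt.
have fb' : f (al s) ((1 - 2 * a) * be s) = f (al s) (al s * (`|1 - 2 * a| * t)).
  by rewrite (even_norm s _ fev) bt mulrCA.
have htI : 0 <= `|1 - 2 * a| * t <= 1.
  by case/andP: abs_theta => ? ?; case/andP: tI => ? ?; rewrite mulr_ge0 //= mulr_ile1.
rewrite fb fb' !fE //.
have := ler_wpM2l (ltW s0) (entropy2_scale abs_theta tI).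
rewrite real_normK ?num_real //; set q := (1 - 2 * a) ^+ 2.
rewrite -/t; lra.
Qed.

Definition sup_density (Q : 'cV['F_2]_m -> R) : R := \big[Num.max/0]_s Q s.

Lemma le_sup_density Q s : Q s <= sup_density Q.
Proof. by rewrite /sup_density (bigD1 s) //= le_max lexx. Qed.

Lemma sup_density_gt0 Q : density Q -> 0 < sup_density Q.
Proof.
move=> [Q0 Q1]; rewrite ltNge; apply/negP => h.
have : \sum_s Q s <= 0 by apply: sumr_le0 => s _; apply: le_trans (le_sup_density Q s) h.
by rewrite Q1 ler10.
Qed.

(** The larger value of P on a pair is al (1 + t), and al (1 + theta t) <= (al (1 + t))^lam
    al^(1-lam). *)
Lemma sup_step lam : 0 <= lam <= 1 -> 1 + `|1 - 2 * a| = expR (lam * ln 2) ->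
  ln (sup_density (noise a i P)) <=
  lam * ln (sup_density P) + (1 - lam) * ln (sup_density (noise 2^-1 i P)).
Proof.
move=> lI e; have /andP[l0 l1] := lI.
have halfI : 0 <= (2^-1 : R) <= 1 by apply/andP; split; lra.
have SP0 := sup_density_gt0 dP.
have SA0 := sup_density_gt0 (noise_density i halfI dP).
have SN0 := sup_density_gt0 (noise_density i aI dP).
rewrite -(ler_expR (R := R)) lnK ?posrE //.
apply/bigmax_leP; split; first exact: expR_ge0.
move=> s _; rewrite noiseE.
have := al0 s; rewrite le_eqVlt => /orP[/eqP s0|s0].
  have b0 : be s = 0 by apply/eqP; rewrite -normr_le0 s0.
  by rewrite -s0 b0 mulr0 addr0 expR_ge0.
set t := `|be s| / al s.
have tI : 0 <= t <= 1 by exact: ratioI.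
have bt : `|be s| = al s * t by rewrite /t mulrC divfK // gt_eqF.
apply: (@le_trans _ _ (al s * (1 + `|1 - 2 * a| * t))).
  rewrite mulrDr mulr1 lerD2l [leRHS]mulrCA -bt -normrM; exact: ler_norm.
apply: le_trans (ler_wpM2l (ltW s0) (two_point_power_one lI e tI)) _.
have t1 : 0 < 1 + t by case/andP: tI; lra.
rewrite -{1}(lnK (x := al s)) ?posrE // -expRD ler_expR.
have h1 : ln (al s) + ln (1 + t) <= ln (sup_density P).
  have e1 : al s * (1 + t) = al s + `|be s| by rewrite bt; ring.
  have e2 : 0 < al s * (1 + t) by exact: mulr_gt0.
  rewrite -lnM ?posrE // ler_ln ?posrE // e1.
  case: (ler0P (be s)) => _; last by rewrite -PE le_sup_density.
  by rewrite -be_shift -al_shift -PE le_sup_density.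
have h2 : ln (al s) <= ln (sup_density (noise 2^-1 i P)).
  by rewrite ler_ln ?posrE // -noise_half le_sup_density.
have l1' : 0 <= 1 - lam by lra.
have := ler_wpM2l l0 h1; have := ler_wpM2l l1' h2; lra.
Qed.
End PairStep.
End Noise.

(** * Divergences *)

Section DivergenceBounds.
Variables (R : realType) (m n : nat) (H : 'M['F_2]_(m, n)) (delta : R).
Hypothesis hdelta : 0 < delta < 1.

Let l2 : 0 < ln 2 :> R. Proof. by rewrite ln_gt0 // ltr1n. Qed.
Let dI : 0 <= delta <= 1. Proof. by case/andP: hdelta => *; apply/andP; split; exact: ltW. Qed.
Let P := PHZ delta H.
Let mean_deficit q := expect q (fun T => (m - rk H T)%:R : R).

Lemma PHZ_density : density P.
Proof.
rewrite /P PHZ_noise_list -(span_density0 R H); apply: noise_list_density => //.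
exact: span_density_density.
Qed.

Lemma unifE s : unif 'cV['F_2]_m s = expR (- (m%:R * ln 2)) :> R.
Proof. by rewrite /unif card_mx card_Fp // muln1 expRN expRM_natl lnK ?posrE // natrX. Qed.

Lemma sum_unif : \sum_(s : 'cV['F_2]_m) expR (- (m%:R * ln 2)) = 1 :> R.
Proof.
rewrite sumr_const card_mx card_Fp // muln1 -[_ *+ (2 ^ m)]mulr_natl expRN expRM_natl.
by rewrite lnK ?posrE // natrX divff // expf_neq0 // pnatr_eq0.
Qed.

Lemma defectE q : mean_deficit q = m%:R - expect q (fun T => (rk H T)%:R).
Proof.
transitivity (expect q (fun T => m%:R - (rk H T)%:R : R)); last by rewrite expectB expect_cst.
by congr (expect _ _); apply/funext => T; rewrite natrB // rk_le.
Qed.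

Lemma Bernoulli (x : R) (k : nat) : 0 <= x -> 1 + k%:R * (x - 1) <= x ^+ k.
Proof.
move=> x0; elim: k => [|k IH]; first by rewrite mul0r addr0 expr0.
rewrite exprS; apply: le_trans (ler_wpM2l x0 IH).
rewrite -natr1; have := mulr_ge0 (ler0n R k) (sqr_ge0 (x - 1)); lra.
Qed.

Lemma ln_power_sum T k :
  ln (\sum_s span_density R H T s ^+ k.+2) = - (k.+1%:R * ln 2) * (rk H T)%:R.
Proof.
have -> : \sum_s span_density R H T s ^+ k.+2 =
    (\sum_(s : 'cV['F_2]_m) (s^T <= cspan H T)%MS%:R) / (2 ^+ rk H T) ^+ k.+2.
  rewrite mulr_suml; apply: eq_bigr => s _; rewrite /span_density expr_div_n.
  by case: (s^T <= _)%MS; rewrite ?expr1n // expr0n.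
rewrite sum_span [_ ^+ k.+2]exprS invfM mulrA divff ?expf_neq0 ?pnatr_eq0 // mul1r.
rewrite lnV ?posrE ?exprn_gt0 // -exprM lnXn // -[_ *+ (rk H T * _)]mulr_natl natrM; ring.
Qed.

Lemma power_sum_gt0 k : 0 < \sum_s P s ^+ k.+2.
Proof.
have [P0 P1] := PHZ_density; have := sup_density_gt0 PHZ_density; rewrite /sup_density => sup0.
have [s s0] : exists s, 0 < P s.
  apply/existsP; apply: contraT; rewrite negb_exists => /forallP h.
  have : \sum_s P s <= 0 by apply: sumr_le0 => s _; rewrite leNgt.
  by rewrite P1 ler10.
rewrite (bigD1 s) //= ltr_pwDl ?exprn_gt0 //.
by apply: sumr_ge0 => s' _; rewrite exprn_ge0.
Qed.

Lemma Renyi_divE k : Renyi_div k.+2%:R P (unif _) =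
  m%:R + ln (\sum_s P s ^+ k.+2) / (k.+1%:R * ln 2).
Proof.
have [P0 P1] := PHZ_density.
rewrite /Renyi_div /log2.
under eq_bigr do rewrite powR_mulrn // unifE.
rewrite -mulr_suml lnM ?posrE ?power_sum_gt0 ?powR_gt0 ?expR_gt0 // ln_powR expRK.
have -> : k.+2%:R = k.+1%:R + 1 :> R by rewrite natr1.
by field; rewrite !gt_eqF // ?ltr0n.
Qed.

(** Bernoulli's inequality for the p-th power of M P(s), where M = 2^m: the linear terms sum to zero
    because P has mass 1. *)
Lemma Renyi_div_ge0 k : 0 <= Renyi_div k.+2%:R P (unif _).
Proof.
have [P0 P1] := PHZ_density; rewrite Renyi_divE.
have kl : 0 < k.+1%:R * ln 2 :> R by rewrite mulr_gt0 // ltr0n.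
rewrite -(ler_pM2r kl) mul0r mulrDl divfK ?gt_eqF //.
set M := expR (m%:R * ln 2) : R; have M0 : 0 < M by exact: expR_gt0.
have card : \sum_(s : 'cV['F_2]_m) (1 : R) = M.
  by rewrite sumr_const card_mx card_Fp // muln1 /M expRM_natl lnK ?posrE // natrX.
have key : M <= \sum_s (M * P s) ^+ k.+2.
  apply: (@le_trans _ _ (\sum_s (1 + k.+2%:R * (M * P s - 1)))).
    rewrite big_split /= card -mulr_sumr sumrB -mulr_sumr P1 card; lra.
  by apply: ler_sum => s _; apply: Bernoulli; rewrite mulr_ge0 // ltW.
have SS0 := power_sum_gt0 k; have MM0 : 0 < M ^+ k.+2 by exact: exprn_gt0.
have MS0 : 0 < M ^+ k.+2 * \sum_s P s ^+ k.+2 by exact: mulr_gt0.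
have : ln M <= ln (M ^+ k.+2 * \sum_s P s ^+ k.+2).
  rewrite ler_ln ?posrE //; apply: le_trans key _.
  by rewrite mulr_sumr; apply: ler_sum => s _; rewrite exprMn.
rewrite lnM ?posrE // lnXn // -[_ *+ k.+2]mulr_natl /M expRK.
have -> : k.+2%:R = k.+1%:R + 1 :> R by rewrite natr1.
lra.
Qed.

Let dmax := Num.max delta (1 - delta).
Let dmaxE : 1 + `|1 - 2 * delta| = 2 * dmax /\ 1 - `|1 - 2 * delta| = 2 * (1 - dmax).
Proof. rewrite /dmax; case: leP => h; case: (ler0P (1 - 2 * delta)) => h'; split; lra. Qed.
Let dmaxI : 1 / 2 <= dmax < 1.
Proof.
case/andP: hdelta => ? ?; rewrite /dmax.
by case: (leP delta (1 - delta)) => h; apply/andP; split; lra.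
Qed.

Lemma pow_phi1 k : ln (pow_phi k (1 : R)) = k.+1%:R * ln 2.
Proof.
rewrite /pow_phi subrr expr0n /= addr0 -natr1 exprSr mulfK ?pnatr_eq0 //.
by rewrite (_ : 1 + 1 = 2 :> R) // lnXn // mulr_natl.
Qed.

(** The origin of h_p: lam = 1 - h_p(delta) is the value that makes the two-point inequality for
    moments an equality at t = 1. *)
Lemma pow_phi_h_p k :
  ln (pow_phi k `|1 - 2 * delta|) = (1 - h_p k.+2%:R delta) * ln (pow_phi k (1 : R)).
Proof.
case/andP: hdelta => d0 d1.
have S : pow_phi k `|1 - 2 * delta| = 2 ^+ k.+1 * (delta ^+ k.+2 + (1 - delta) ^+ k.+2).
  have [e1 e2] := dmaxE; rewrite /pow_phi e1 e2 /dmax.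
  have pw (x y : R) : ((2 * x) ^+ k.+2 + (2 * y) ^+ k.+2) / 2 = 2 ^+ k.+1 * (x ^+ k.+2 + y ^+ k.+2).
    by rewrite !exprMn [2 ^+ k.+2]exprS; move: (x ^+ _) (y ^+ _) (2 ^+ k.+1) => b c d; field.
  rewrite pw; case: (leP delta (1 - delta)) => _ //.
  by rewrite (_ : 1 - (1 - delta) = delta) 1?addrC //; ring.
have S0 : 0 < delta ^+ k.+2 + (1 - delta) ^+ k.+2.
  by rewrite addr_gt0 ?exprn_gt0 ?subr_gt0.
rewrite pow_phi1 S lnM ?posrE ?exprn_gt0 // lnXn // -[_ *+ k.+1]mulr_natl /h_p /log2.
rewrite !powR_mulrn ?(ltW d0) ?subr_ge0 ?(ltW d1) //.
have -> : k.+2%:R = k.+1%:R + 1 :> R by rewrite natr1.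
have k0 : 0 < k.+1%:R :> R by rewrite ltr0n.
move: (ln (delta ^+ _ + _)) => b; field.
by rewrite (gt_eqF l2) /= lt_eqF //; have := ler0n R k; lra.
Qed.

Lemma h_pI k : 0 <= 1 - h_p k.+2%:R delta <= 1.
Proof.
have kl : 0 < k.+1%:R * ln 2 :> R by rewrite mulr_gt0 // ltr0n.
have e := pow_phi_h_p k; rewrite pow_phi1 in e.
have /andP[t0 t1] : 0 <= `|1 - 2 * delta| <= 1.
  have [e1 e2] := dmaxE; have /andP[? ?] := dmaxI; apply/andP; split; lra.
set t := `|1 - 2 * delta| in e t0 t1.
have lo : 1 <= pow_phi k t.
  have t0' : 0 <= 1 + t by lra.
  have t1' : 0 <= 1 - t by lra.
  by rewrite /pow_phi; have := Bernoulli k.+2 t0'; have := Bernoulli k.+2 t1'; lra.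
have hi : ln (pow_phi k t) <= k.+1%:R * ln 2.
  rewrite -pow_phi1 ler_ln ?posrE; last 2 first.
  - by lra.
  - by rewrite /pow_phi subrr expr0n /= addr0 divr_gt0 // exprn_gt0.
  have B x : 0 <= x <= 2 -> x ^+ k.+2 <= 2 ^+ k.+1 * x :> R.
    move=> /andP[x0 x2]; rewrite exprSr; apply: ler_wpM2r => //.
    by apply: lerXn2r; rewrite ?nnegrE.
  have b1 : (1 + t) ^+ k.+2 <= 2 ^+ k.+1 * (1 + t) by apply: B; apply/andP; split; lra.
  have b2 : (1 - t) ^+ k.+2 <= 2 ^+ k.+1 * (1 - t) by apply: B; apply/andP; split; lra.
  rewrite /pow_phi subrr expr0n /= addr0 (_ : 1 + 1 = 2 :> R) // (exprSr 2 k.+1); lra.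
have lo' : 0 <= ln (pow_phi k t) by exact: ln_ge0.
rewrite e in lo' hi; apply/andP; split.
  by move: lo'; rewrite pmulr_lge0.
by move: hi; rewrite -[X in _ <= X]mul1r ler_pM2r.
Qed.

Lemma Renyi_div_defect k :
  Renyi_div k.+2%:R P (unif _) <= mean_deficit (h_p k.+2%:R delta).
Proof.
set lam := 1 - h_p k.+2%:R delta.
have lamI : 0 <= lam <= 1 by exact: h_pI.
have /= := @noise_erasure_comparison R m n H (fun Q => ln (\sum_s Q s ^+ k.+2)) delta lam dI lamI
  (fun i Q dQ => power_step H i dI dQ lamI (pow_phi_h_p k)).
rewrite (funext (fun T => ln_power_sum T k)).
rewrite expectZ -/P opprB addrCA subrr addr0 => cmp.
have kl : 0 < k.+1%:R * ln 2 :> R by rewrite mulr_gt0 // ltr0n.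
rewrite Renyi_divE defectE lerD2l ler_pdivrMr // mulNr mulrC -mulNr; exact: cmp.
Qed.

Lemma ln_sup_span T : ln (sup_density (span_density R H T)) = - ln 2 * (rk H T)%:R.
Proof.
have -> : sup_density (span_density R H T) = (2 ^+ rk H T)^-1.
  apply/eqP; rewrite eq_le; apply/andP; split; last first.
    apply: le_trans (le_sup_density _ 0).
    by rewrite /span_density trmx0 sub0mx mul1r.
  apply/bigmax_leP; split; first by rewrite invr_ge0 exprn_ge0.
  move=> s _; rewrite /span_density -[leRHS]mul1r.
  by apply: ler_wpM2r; rewrite ?invr_ge0 ?exprn_ge0 // lern1 leq_b1.
by rewrite lnV ?posrE ?exprn_gt0 // lnXn // -mulr_natl; ring.
Qed.

Lemma h_infI : 0 <= 1 - h_inf delta <= 1.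
Proof.
have /andP[? d1] := dmaxI.
rewrite /h_inf opprK /log2 -/dmax.
have d0 : 0 < dmax by lra.
have h1 : ln dmax <= 0 by rewrite -(ln1 R) ler_ln ?posrE //; lra.
have h2 : - ln 2 <= ln dmax by rewrite -lnV ?posrE // ler_ln ?posrE ?invr_gt0 //; lra.
apply/andP; split.
  by rewrite -(ler_pM2r l2) mul0r mulrDl mul1r divfK ?gt_eqF //; lra.
by rewrite gerDl; rewrite -(ler_pM2r l2) mul0r divfK ?gt_eqF.
Qed.

Lemma h_inf_exp : 1 + `|1 - 2 * delta| = expR ((1 - h_inf delta) * ln 2).
Proof.
have /andP[? d1] := dmaxI; have [-> _] := dmaxE.
have -> : (1 - h_inf delta) * ln 2 = ln 2 + ln dmax.
  by rewrite /h_inf /log2 -/dmax; field; rewrite gt_eqF.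
by rewrite expRD !lnK ?posrE //; lra.
Qed.

Lemma Renyi_inf_defect x0 :
  0 <= Renyi_inf x0 P (unif _) <= mean_deficit (h_inf delta).
Proof.
have [P0 P1] := PHZ_density.
have PU s : P s / unif _ s = P s * expR (m%:R * ln 2) by rewrite unifE expRN invrK.
set lam := 1 - h_inf delta.
have lamI : 0 <= lam <= 1 by exact: h_infI.
have /= := @noise_erasure_comparison R m n H (fun Q => ln (sup_density Q)) delta lam dI lamI
  (fun i Q dQ => sup_step H i dI dQ lamI h_inf_exp).
rewrite (funext (fun T => ln_sup_span T)).
rewrite expectZ -/P opprB addrCA subrr addr0 => cmp.
have D0 : 0 <= mean_deficit (h_inf delta).
  apply: expect_ge0; last by move=> T; rewrite ler0n.
  by have := h_infI; case/andP => ? ?; apply/andP; split; lra.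
have up s : log2 (P s / unif _ s) <= mean_deficit (h_inf delta).
  rewrite PU /log2 ler_pdivrMr //.
  (* Since ln 0 = 0, a point of mass zero enters the maximum as 0 instead of minus infinity; the
     bound survives because the mean deficit is nonnegative. *)
  have := P0 s; rewrite le_eqVlt => /orP[/eqP <-|s0].
    by rewrite mul0r ln0 // mulr_ge0 // ltW.
  rewrite lnM ?posrE ?expR_gt0 // expRK defectE.
  have : ln (P s) <= ln (sup_density P).
    by rewrite ler_ln ?posrE ?le_sup_density // sup_density_gt0 //; exact: PHZ_density.
  by move: cmp; lra.
apply/andP; split; last by apply/bigmax_leP; split.
have [s sP] : exists s, 1 <= P s / unif _ s.
  apply/existsP; apply: contraT; rewrite negb_exists => /forallP h.
  have : \sum_s P s < \sum_(s : 'cV['F_2]_m) expR (- (m%:R * ln 2)) :> R.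
    apply: ltr_sum; first by apply/hasP; exists 0 => //; exact: mem_index_enum.
    move=> s _; have := h s; rewrite -ltNge PU expRN => h'.
    by rewrite -[X in _ < X]mul1r ltr_pdivlMr ?expR_gt0.
  by rewrite P1 sum_unif ltxx.
rewrite /Renyi_inf (bigD1 s) //= le_max; apply/orP; left.
by apply: divr_ge0; [exact: ln_ge0|exact: ltW].
Qed.

Lemma entropy_span T :
  \sum_s span_density R H T s * ln (span_density R H T s) = - ln 2 * (rk H T)%:R.
Proof.
have [S0 S1] := span_density_density R H T.
transitivity (\sum_s span_density R H T s * (- ln 2 * (rk H T)%:R)); last first.
  by rewrite -mulr_suml S1 mul1r.
apply: eq_bigr => s _; rewrite /span_density; case: (s^T <= _)%MS; last by rewrite !mul0r.
rewrite mul1r; congr (_ * _).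
by rewrite lnV ?posrE ?exprn_gt0 // lnXn // -mulr_natl; ring.
Qed.

Lemma KL_divE : KL_div P (unif _) = m%:R + (\sum_s P s * ln (P s)) / ln 2.
Proof.
have [P0 P1] := PHZ_density.
rewrite /KL_div big_mkcond /=.
transitivity (\sum_s (P s * m%:R + (P s * ln (P s)) / ln 2)).
  apply: eq_bigr => s _; case: eqP => [->|/eqP s0] /=; first by rewrite !mul0r addr0.
  have s0' : 0 < P s by rewrite lt_neqAle eq_sym s0 P0.
  rewrite unifE expRN invrK /log2 lnM ?posrE ?expR_gt0 // expRK.
  by field; rewrite gt_eqF.
by rewrite big_split /= -!mulr_suml P1 mul1r.
Qed.

Lemma KL_div_defect : 0 <= KL_div P (unif _) <= mean_deficit (1 - (1 - 2 * delta) ^+ 2).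
Proof.
have [P0 P1] := PHZ_density.
have lamI : 0 <= (1 - 2 * delta) ^+ 2 <= 1.
  by case/andP: hdelta => ? ?; rewrite sqr_ge0 /=; nra.
have /= := @noise_erasure_comparison R m n H (fun Q => \sum_s Q s * ln (Q s)) delta _ dI lamI
  (fun i Q dQ => entropy_step H i dI dQ).
rewrite (funext (fun T => entropy_span T)).
rewrite expectZ -/P => cmp.
rewrite KL_divE; apply/andP; split; last first.
  by rewrite defectE lerD2l ler_pdivrMr // mulNr mulrC -mulNr.
rewrite -(ler_pM2r l2) mul0r mulrDl divfK ?gt_eqF //.
set M := m%:R * ln 2.
have card : \sum_(s : 'cV['F_2]_m) expR (- M) = 1 :> R.
  exact: sum_unif.
(* Gibbs' inequality: each term P ln(P/U) is at least P - U, and these differences sum to zero. *)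
have : 0 <= \sum_s (P s * (M + ln (P s)) - (P s - expR (- M))).
  apply: sumr_ge0 => s _.
  have := P0 s; rewrite le_eqVlt => /orP[/eqP <-|s0].
    by rewrite mul0r !sub0r opprK expR_ge0.
  have := @ln_le_sub1 R (expR (- M) / P s); rewrite divr_gt0 ?expR_gt0 // => /(_ isT).
  rewrite ln_div ?posrE ?expR_gt0 // expRK => h.
  have := ler_wpM2l (ltW s0) h.
  have -> : P s * (expR (- M) / P s - 1) = expR (- M) - P s by field; rewrite gt_eqF.
  lra.
rewrite sumrB sumrB card P1 subrr subr0.
under eq_bigr do rewrite mulrDr.
by rewrite big_split /= -mulr_suml P1 mul1r.
Qed.
End DivergenceBounds.

(** * Passage to the limit *)

Section RMSequence.
Variables (R : realType) (Rate : R) (r mu m : nat -> nat).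
Variable H : forall j : nat, 'M['F_2]_(m j, 2 ^ mu j).
Hypothesis hR : 0 < Rate < 1.
Hypothesis hn : forall N : nat, exists J : nat, forall j : nat,
  (J <= j)%N -> (N <= 2 ^ mu j)%N.
Hypothesis hrate : ((fun j => RM_rate (R := R) (r j) (mu j)) @ \oo --> Rate)%classic.
Hypothesis hrank : forall j, \rank (H j) = m j.
Hypothesis hker : forall j (c : 'cV['F_2]_(2 ^ mu j)),
  RM (r j) (mu j) c <-> H j *m c = 0.

Lemma expected_deficit_eventually_le (q e : R) : 1 - Rate < q <= 1 -> 0 < e ->
  (\forall j \near \oo, expect q (deficit R (H j)) <= e)%classic.
Proof.
(* q = 1 occurs for delta = 1/2; then T contains every column and the deficit is zero. *)
move=> /andP[Rq]; rewrite le_eqVlt => /orP[/eqP -> e0|q1 e0].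
  by near=> j; rewrite expect1 /deficit rk_setT hrank subnn ltW.
(* The midpoint of 1 - q and the limit rate: all late rates exceed it, and q > 1 - rho still
   holds. *)
case/andP: hR => R0 R1; pose rho := (1 - q + Rate) / 2.
have rI : 0 < rho < 1 by rewrite /rho; apply/andP; split; lra.
have qI : 1 - rho < q < 1 by rewrite /rho; apply/andP; split; lra.
have [M HM] := expected_deficit_small rI qI e0.
have [J HJ] := hn (2 ^ M).
have near_rate : (\forall j \near \oo, rho <= RM_rate (r j) (mu j))%classic.
  have gap : 0 < Rate - rho by rewrite /rho; lra.
  move/cvgrPdist_lt: hrate => /(_ _ gap).
  by apply: filterS => j; rewrite ltr_norml => /andP[_]; lra.
near=> j; apply: HM.
- rewrite -(leq_exp2l (m := 2)) //; apply: HJ; near: j; exact: nbhs_infty_ge.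
- exact: hrank.
- exact: hker.
- by near: j.
Unshelve. all: by end_near. Qed.

Lemma squeeze_deficit (q : R) (D : nat -> R) : 1 - Rate < q <= 1 ->
  (forall j, 0 <= D j <= expect q (deficit R (H j))) -> (D @ \oo --> (0 : R))%classic.
Proof.
move=> qI DI; apply/cvgrPdist_le => e e0; near=> j.
rewrite sub0r normrN; have /andP[D0 De] := DI j; rewrite ger0_norm //.
apply: le_trans De _; near: j; exact: expected_deficit_eventually_le.
Unshelve. all: by end_near. Qed.
End RMSequence.

Local Open Scope classical_set_scope.
Unset Implicit Arguments.

Theorem theorem4p1 (R : realType) (Rate delta : R)
  (hR : 0 < Rate < 1) (hdelta : 0 < delta < 1)
  (r mu m : nat -> nat)
  (H : forall j : nat, 'M['F_2]_(m j, 2 ^ mu j))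
  (hn : forall N : nat, exists J : nat, forall j : nat, (J <= j)%N -> (N <= 2 ^ mu j)%N)
  (hrate : (fun j => RM_rate (R := R) (r j) (mu j)) @ \oo --> Rate)
  (hrank : forall j, \rank (H j) = m j)
  (hker : forall j (c : 'cV['F_2]_(2 ^ mu j)), RM (r j) (mu j) c <-> H j *m c = 0) :
  (forall p : nat, (2 <= p)%N -> Rate > 1 - h_p p%:R delta ->
     (fun j => Renyi_div p%:R (PHZ delta (H j)) (unif _)) @ \oo --> (0 : R))
  /\ (Rate > 1 - h_inf delta ->
     (fun j => Renyi_inf 0 (PHZ delta (H j)) (unif _)) @ \oo --> (0 : R))
  /\ (Rate > (1 - 2 * delta) ^+ 2 ->
     (fun j => KL_div (PHZ delta (H j)) (unif _)) @ \oo --> (0 : R)).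
Proof.
split; [|split].
- move=> [|[|k]] // _ hp; have := h_pI hdelta k => /andP[? ?].
  apply: (squeeze_deficit hR hn hrate hrank hker (q := h_p k.+2%:R delta)) => [|j].
    by apply/andP; split; lra.
  by rewrite Renyi_div_ge0 // Renyi_div_defect.
- move=> hp; have := h_infI hdelta => /andP[? ?].
  apply: (squeeze_deficit hR hn hrate hrank hker (q := h_inf delta)) => [|j].
    by apply/andP; split; lra.
  exact: Renyi_inf_defect.
- move=> hp.
  apply: (squeeze_deficit hR hn hrate hrank hker (q := 1 - (1 - 2 * delta) ^+ 2)) => [|j].
    by have := sqr_ge0 (1 - 2 * delta) => ?; apply/andP; split; lra.
  exact: KL_div_defect.
Qed.
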